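(* The functor from (purely even) restricted vertex algebras to one-truncated vertex algebras, sending $V$ to $V_{\le1}=V_0\oplus V_1$ with the induced operations, admits a left adjoint $U_1$. Moreover, for every one-truncated vertex algebra $W$ one has $(U_1W)_{\le1}=W$ (i.e. the canonical map $W\to(U_1W)_{\le 1}$ is an isomorphism).
   Context: A vertex algebra is a complex vector space $V$ with a vacuum $|0\rangle$, bilinear operations $a_{(n)}b$ ($n\in\mathbb Z$) with $a_{(n)}b=0$ for $n\gg0$, and an operator $\partial$, with $|0\rangle_{(n)}a=\delta_{n,-1}a$, $a_{(n)}|0\rangle=0$ for $n\ge0$, $a_{(-1)}|0\rangle=a$, $\partial a=a_{(-2)}|0\rangle$, satisfying for all $a,b,c$ and $m,n,k\in\mathbb Z$ the Borcherds identity $$\sum_{j\ge0}\binom mj(a_{(n+j)}b)_{(m+k-j)}c=\sum_{j\ge0}(-1)^j\binom nj a_{(n+m-j)}(b_{(k+j)}c)-\sum_{j\ge0}(-1)^{j+n}\binom nj b_{(n+k-j)}(a_{(m+j)}c).$$ It is graded if $V=\bigoplus_\Delta V_\Delta$ (eigenspaces of a diagonalizable operator; $\Delta$ are the conformal weights) with $_{(n)}:V_\Delta\otimes V_{\Delta'}\to V_{\Delta+\Delta'-n-1}$; then $|0\rangle\in V_0$ and $\partial V_\Delta\subset V_{\Delta+1}$. A graded vertex algebra is restricted if it has no negative integer conformal weights. Morphisms preserve the vacuum, all operations, and the grading. A one-truncated vertex algebra is a space $W=W_0\oplus W_1$ with a vacuum vector $|0\rangle\in W_0$, a linear map $\partial:W_0\to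 W_1$ and operations $_{(n)}:W_i\times W_j\to W_{i+j-n-1}$ for all $i,j,n$ such that $i,j,i+j-n-1\in\{0,1\}$, satisfying the vacuum axioms, $\partial a=a_{(-2)}|0\rangle$, $\partial|0\rangle=0$, $\partial$ being a derivation of the operations, and the Borcherds identities above, whenever the indices belong to the indicated range: that is, for homogeneous $a,b,c\in W$ and $m,n,k$ such that all elements occurring in the identity (including the intermediate ones $a_{(n+j)}b$, $b_{(k+j)}c$, $a_{(m+j)}c$, $j\ge0$) would have weight $\le1$, operations with values in negative weight being set to zero. Morphisms are linear maps preserving weights, $|0\rangle$, $\partial$ and the operations. *)

(* Defs.v *)
From HB Require Import structures.
From mathcomp Require Import all_boot all_order all_algebra.
From mathcomp Require finmap.
From mathcomp Require Import boolp classical_sets functions cardinality fsbigop.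
From mathcomp Require Import reals.
From mathcomp.real_closed Require Import complex.
From mathcomp Require Import ring zify.

Set Implicit Arguments.
Unset Strict Implicit.
Unset Printing Implicit Defensive.

Import Order.TTheory GRing.Theory Num.Theory.
Local Open Scope complex_scope.
Local Open Scope ring_scope.

Record category := Category {
  obj :> Type;
  hom : obj -> obj -> Type;
  idm : forall a, hom a a;
  comp : forall a b c, hom b c -> hom a b -> hom a c;
  comp_idl : forall a b (f : hom a b), comp (idm b) f = f;
  comp_idr : forall a b (f : hom a b), comp f (idm a) = f;
  compA : forall a b c d (f : hom c d) (g : hom b c) (h : hom a b),
    comp f (comp g h) = comp (comp f g) h }.

Record functor (A B : category) := Functor {
  fobj :> A -> B;
  fmap : forall a b, hom a b -> hom (fobj a) (fobj b);
  fmap_id : forall a, fmap (idm a) = idm (fobj a);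
  fmap_comp : forall a b c (f : hom b c) (g : hom a b),
    fmap (comp f g) = comp (fmap f) (fmap g) }.

Definition is_iso (A : category) (a b : A) (f : hom a b) : Prop :=
  exists g : hom b a, comp g f = idm a /\ comp f g = idm b.

(* [adjunction F G] : [F] is left adjoint to [G]. *)
Record adjunction (A B : category) (F : functor A B) (G : functor B A) :=
  Adjunction {
  transpose : forall a b, hom (F a) b -> hom a (G b);
  transpose_bij : forall a b, bijective (@transpose a b);
  transpose_natural : forall a a' b b' (f : hom a' a) (g : hom b b')
      (h : hom (F a) b),
    transpose (comp g (comp h (fmap F f)))
    = comp (fmap G g) (comp (transpose h) f) }.

Definition unit_of (A B : category) (F : functor A B) (G : functor B A)
  (adj : adjunction F G) (a : A) : hom a (G (F a)) :=
  transpose adj (idm (F a)).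

Section VertexAlgebras.
Variable R : realType.
Local Notation C := R[i].

(* The binomial coefficient m (m - 1) ... (m - j + 1) / j!, for m in Z. *)
Definition binz (m : int) (j : nat) : C :=
  (\prod_(i < j) (m - i%:Z)%:~R) / (j`!)%:R.

(* The sums range over all j >= 0; [\sum_(_ \in _)] is the sum of a finitely
   supported family, and the three families below are finitely supported as
   soon as x_(p) y = 0 for p >> 0. *)
Definition borcherds (V : lmodType C) (op : int -> V -> V -> V)
    (m n k : int) (a b c : V) : Prop :=
  \sum_(j \in [set: nat]) binz m j *: op (m + k - j%:Z) (op (n + j%:Z) a b) c
  = \sum_(j \in [set: nat])
      ((-1) ^+ j * binz n j) *: op (n + m - j%:Z) a (op (k + j%:Z) b c)
  - \sum_(j \in [set: nat])
      ((-1) ^ (j%:Z + n) * binz n j) *: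
        op (n + k - j%:Z) b (op (m + j%:Z) a c).

Record vertexAlgebra := VertexAlgebra {
  va_space :> lmodType C;
  va_vac : va_space;
  va_op : int -> va_space -> va_space -> va_space;
  va_d : {linear va_space -> va_space};
  va_opr_linear : forall n a, linear (va_op n a);
  va_opl_linear : forall n b, linear (va_op n ^~ b);
  va_local : forall a b, exists N : int, forall n : int, N <= n -> va_op n a b = 0;
  va_vacl : forall n a, va_op n va_vac a = if n == -1 then a else 0;
  va_vacr0 : forall n a, 0 <= n -> va_op n a va_vac = 0;
  va_vacr : forall a, va_op (-1) a va_vac = a;
  va_dE : forall a, va_d a = va_op (-2) a va_vac;
  va_borcherds : forall m n k a b c, borcherds va_op m n k a b c }.

Definition in_eigenspace (V : lmodType C) (H : V -> V) (D : C) : {pred V} :=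
  fun v => H v == D *: v.

(* No directness condition is needed: eigenspaces of a linear map for distinct
   eigenvalues are always independent. *)
Definition diagonalizable (V : lmodType C) (H : {linear V -> V}) : Prop :=
  forall v : V, exists s : seq V,
    (forall x, x \in s -> exists D, x \in in_eigenspace H D)
    /\ v = \sum_(x <- s) x.

Record gradedVA := GradedVA {
  gva_va :> vertexAlgebra;
  gva_H : {linear gva_va -> gva_va};
  gva_diag : diagonalizable gva_H;
  gva_op : forall n D D' (a b : gva_va),
    a \in in_eigenspace gva_H D -> b \in in_eigenspace gva_H D' ->
    va_op n a b \in in_eigenspace gva_H (D + D' - n%:~R - 1) }.

Definition in_weight (V : gradedVA) (D : C) : {pred V} :=
  in_eigenspace (gva_H V) D.
Arguments in_weight : clear implicits.

Definition conformal_weight (V : gradedVA) (D : C) : Prop :=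
  exists2 v : V, v \in in_weight V D & v != 0.

Record restrictedVA := RestrictedVA {
  rva_gva :> gradedVA;
  rva_restricted :
    forall z : int, z < 0 -> ~ conformal_weight rva_gva z%:~R }.

Record vaHom (V V' : gradedVA) := VAHom {
  va_fun :> V -> V';
  va_fun_linear : linear va_fun;
  va_fun_vac : va_fun (va_vac V) = va_vac V';
  va_fun_op : forall n a b, va_fun (va_op n a b) = va_op n (va_fun a) (va_fun b);
  va_fun_weight : forall D a, a \in in_weight V D -> va_fun a \in in_weight V' D }.

Lemma vaHom_eq (V V' : gradedVA) (f g : vaHom V V') : f =1 g -> f = g.
Proof.
case: f g => [f f1 f2 f3 f4] [g g1 g2 g3 g4] /= /funext fg; subst g.
by congr VAHom; exact: Prop_irrelevance.
Qed.

Lemma vaHom_id_linear (V : gradedVA) : linear (@id V).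
Proof. by []. Qed.

Definition vaHom_id (V : gradedVA) : vaHom V V :=
  @VAHom V V id (@vaHom_id_linear V) erefl (fun _ _ _ => erefl)
    (fun _ _ h => h).

Lemma vaHom_comp_proof (V1 V2 V3 : gradedVA) (f : vaHom V2 V3) (g : vaHom V1 V2) :
  [/\ linear (f \o g), (f \o g) (va_vac V1) = va_vac V3,
      forall n a b, (f \o g) (va_op n a b) = va_op n ((f \o g) a) ((f \o g) b)
    & forall D a, a \in in_weight V1 D -> (f \o g) a \in in_weight V3 D].
Proof.
split=> [x u v||n a b|D a aD] /=.
- by rewrite !va_fun_linear.
- by rewrite !va_fun_vac.
- by rewrite !va_fun_op.
- by do 2!apply: va_fun_weight.
Qed.

Definition vaHom_comp (V1 V2 V3 : gradedVA) (f : vaHom V2 V3) (g : vaHom V1 V2) :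
  vaHom V1 V3 :=
  @VAHom V1 V3 (f \o g)
    (let: And4 h _ _ _ := vaHom_comp_proof f g in h)
    (let: And4 _ h _ _ := vaHom_comp_proof f g in h)
    (let: And4 _ _ h _ := vaHom_comp_proof f g in h)
    (let: And4 _ _ _ h := vaHom_comp_proof f g in h).

Lemma vaHom_idl (V V' : restrictedVA) (f : vaHom V V') :
  vaHom_comp (vaHom_id V') f = f.
Proof. exact: vaHom_eq. Qed.

Lemma vaHom_idr (V V' : restrictedVA) (f : vaHom V V') :
  vaHom_comp f (vaHom_id V) = f.
Proof. exact: vaHom_eq. Qed.

Lemma vaHom_compA (V1 V2 V3 V4 : restrictedVA)
    (f : vaHom V3 V4) (g : vaHom V2 V3) (h : vaHom V1 V2) :
  vaHom_comp f (vaHom_comp g h) = vaHom_comp (vaHom_comp f g) h.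
Proof. exact: vaHom_eq. Qed.

Definition RestrictedVACat : category :=
  @Category restrictedVA (fun V V' => vaHom V V') (fun V => vaHom_id V)
    (fun _ _ _ f g => vaHom_comp f g) vaHom_idl vaHom_idr vaHom_compA.

(* One-truncated vertex algebras.  The weights 0 and 1 are the booleans [false]
   and [true], coerced to numbers.  As the weight of a_(n) b determines n, the
   operations are given by the family [op i j l : W i -> W j -> W l], which is
   a_(n) b for n = i + j - l - 1. *)

Section Truncated.
Variables (W : bool -> lmodType C).
Variable op : forall i j l : bool, W i -> W j -> W l.

Definition tsum : lmodType C := (W false * W true)%type.

Definition tinj (i : bool) : W i -> tsum :=
  if i return W i -> tsum then fun x => (0, x) else fun x => (x, 0).

Definition tpart (x : tsum) (i : bool) : W i :=
  if i return W i then x.2 else x.1.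

(* The operation _(n) on W_0 + W_1.  Products a_(n) b that would have a weight
   other than 0 or 1 are set to 0. *)
Definition tprod (n : int) (x y : tsum) : tsum :=
  let part (l : bool) : W l :=
    \sum_(i : bool) \sum_(j : bool | i%:Z + j%:Z - n - 1 == l%:Z)
      op l (tpart x i) (tpart y j) in
  (part false, part true).

End Truncated.

Record oneTruncVA := OneTruncVA {
  ot_space :> bool -> lmodType C;
  ot_vac : ot_space false;
  ot_op : forall i j l : bool, ot_space i -> ot_space j -> ot_space l;
  ot_d : {linear ot_space false -> ot_space true};
  ot_prod := tprod ot_op;
  ot_inj := @tinj ot_space;
  ot_opr_linear : forall i j l (a : ot_space i), linear (@ot_op i j l a);
  ot_opl_linear : forall i j l (b : ot_space j),
    linear ((@ot_op i j l) ^~ b);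
  ot_vacl : forall (n : int) (i : bool) (a : ot_space i),
    ot_prod n (ot_inj ot_vac) (ot_inj a) = if n == -1 then ot_inj a else 0;
  ot_vacr0 : forall (n : int) (i : bool) (a : ot_space i), 0 <= n ->
    ot_prod n (ot_inj a) (ot_inj ot_vac) = 0;
  ot_vacr : forall i (a : ot_space i),
    ot_prod (-1) (ot_inj a) (ot_inj ot_vac) = ot_inj a;
  ot_dE : forall a : ot_space false,
    ot_inj (ot_d a) = ot_prod (-2) (ot_inj a) (ot_inj ot_vac);
  ot_dvac : ot_d ot_vac = 0;
  (* Since d a and d b must make sense, a and b have weight 0; then d (a_(n) b)
     has weight - n. *)
  ot_deriv : forall (n : int) (a b : ot_space false), - n <= 1 ->
    ot_inj (ot_d (ot_prod n (ot_inj a) (ot_inj b)).1)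
    = ot_prod n (ot_inj (ot_d a)) (ot_inj b)
    + ot_prod n (ot_inj a) (ot_inj (ot_d b));
  (* The bounds are on the weights of a_(n) b, b_(k) c, a_(m) c and of the
     identity itself; those of a_(n+j) b, etc., for j > 0 are smaller. *)
  ot_borcherds : forall (m n k : int) (i j l : bool)
      (a : ot_space i) (b : ot_space j) (c : ot_space l),
    i%:Z + j%:Z - n - 1 <= 1 -> j%:Z + l%:Z - k - 1 <= 1 ->
    i%:Z + l%:Z - m - 1 <= 1 ->
    i%:Z + j%:Z + l%:Z - m - n - k - 2 <= 1 ->
    borcherds ot_prod m n k (ot_inj a) (ot_inj b) (ot_inj c) }.

Record otHom (W W' : oneTruncVA) := OTHom {
  ot_fun :> forall i, W i -> W' i;
  ot_fun_linear : forall i, linear (@ot_fun i);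
  ot_fun_vac : ot_fun (ot_vac W) = ot_vac W';
  ot_fun_d : forall a, ot_fun (ot_d W a) = ot_d W' (ot_fun a);
  ot_fun_op : forall i j l (a : W i) (b : W j),
    ot_fun (ot_op l a b) = ot_op l (ot_fun a) (ot_fun b) }.

Lemma otHom_eq (W W' : oneTruncVA) (f g : otHom W W') :
  (forall i, f i =1 g i) -> f = g.
Proof.
case: f g => [f f1 f2 f3 f4] [g g1 g2 g3 g4] /= fg.
have {}fg : f = g by apply: functional_extensionality_dep => i; exact/funext/fg.
by subst g; congr OTHom; exact: Prop_irrelevance.
Qed.

Lemma otHom_id_linear (W : oneTruncVA) i : linear (@id (W i)).
Proof. by []. Qed.

Definition otHom_id (W : oneTruncVA) : otHom W W :=
  @OTHom W W (fun i => id) (@otHom_id_linear W) erefl (fun=> erefl)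
    (fun _ _ _ _ _ => erefl).

Lemma otHom_comp_proof (W1 W2 W3 : oneTruncVA) (f : otHom W2 W3)
    (g : otHom W1 W2) (h := fun i => f i \o g i) :
  [/\ forall i, linear (h i), h false (ot_vac W1) = ot_vac W3,
      forall a, h true (ot_d W1 a) = ot_d W3 (h false a)
    & forall i j l (a : W1 i) (b : W1 j),
        h l (ot_op l a b) = ot_op l (h i a) (h j b)].
Proof.
rewrite /h; split=> [i x u v||a|i j l a b] /=.
- by rewrite !ot_fun_linear.
- by rewrite !ot_fun_vac.
- by rewrite !ot_fun_d.
- by rewrite !ot_fun_op.
Qed.

Definition otHom_comp (W1 W2 W3 : oneTruncVA) (f : otHom W2 W3)
    (g : otHom W1 W2) : otHom W1 W3 :=
  @OTHom W1 W3 (fun i => f i \o g i)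
    (let: And4 h _ _ _ := otHom_comp_proof f g in h)
    (let: And4 _ h _ _ := otHom_comp_proof f g in h)
    (let: And4 _ _ h _ := otHom_comp_proof f g in h)
    (let: And4 _ _ _ h := otHom_comp_proof f g in h).

Lemma otHom_idl (W W' : oneTruncVA) (f : otHom W W') :
  otHom_comp (otHom_id W') f = f.
Proof. exact: otHom_eq. Qed.

Lemma otHom_idr (W W' : oneTruncVA) (f : otHom W W') :
  otHom_comp f (otHom_id W) = f.
Proof. exact: otHom_eq. Qed.

Lemma otHom_compA (W1 W2 W3 W4 : oneTruncVA)
    (f : otHom W3 W4) (g : otHom W2 W3) (h : otHom W1 W2) :
  otHom_comp f (otHom_comp g h) = otHom_comp (otHom_comp f g) h.
Proof. exact: otHom_eq. Qed.

Definition OneTruncVACat : category :=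
  @Category oneTruncVA otHom otHom_id otHom_comp
    otHom_idl otHom_idr otHom_compA.

Section FiniteSums.
Variables (V V' : lmodType C).

Lemma fsum_ord N (F : nat -> V) : (forall j, (N <= j)%N -> F j = 0) ->
  \sum_(j \in [set: nat]) F j = \sum_(j < N) F j.
Proof.
move=> F0; rewrite (fsbig_ord _ N F); apply/esym/fsbig_widen => // j [_] /negP.
by rewrite -leqNgt => /F0.
Qed.

Lemma linear_fsum (e : {linear V -> V'}) (F : nat -> V) : injective e ->
  e (\sum_(j \in [set: nat]) F j) = \sum_(j \in [set: nat]) e (F j).
Proof.
move=> e_inj; rewrite raddf_sum /=.
suff -> : finite_support 0 [set: nat] F
          = finite_support 0 [set: nat] (fun j => e (F j)) by [].
rewrite /finite_support !unlock; congr (finmap.enum_fset (fset_set _)); apply/seteqP.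
split=> j [_ /= Fj0]; split=> //= h; apply: Fj0; last by rewrite h linear0.
by apply: e_inj; rewrite h linear0.
Qed.

End FiniteSums.

Lemma binz0 m : binz m 0 = 1.
Proof. by rewrite /binz big_ord0 divr1. Qed.

Lemma binz1 m : binz m 1 = m%:~R.
Proof. by rewrite /binz big_ord1 subr0 divr1. Qed.

Lemma binz0S j : binz 0 j.+1 = 0.
Proof. by rewrite /binz big_ord_recl /= subr0 !mul0r. Qed.

Section TruncatedTheory.
Variables (W : bool -> lmodType C).
Variable op : forall i j l : bool, W i -> W j -> W l.
Hypothesis opr_linear : forall i j l (a : W i), linear (@op i j l a).
Hypothesis opl_linear : forall i j l (b : W j), linear ((@op i j l) ^~ b).

Let op0r i j l a : @op i j l a 0 = 0.
Proof. by have := @opr_linear i j l a (-1) 0 0; rewrite scaler0 addr0 scaleN1r addNr. Qed.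

Let op0l i j l b : @op i j l 0 b = 0.
Proof. by have := @opl_linear i j l b (-1) 0 0; rewrite scaler0 addr0 scaleN1r addNr. Qed.

Lemma tinj0 i : tinj (0 : W i) = 0.
Proof. by case: i. Qed.

Lemma tprod_tinj n i j (a : W i) (b : W j) :
  tprod op n (tinj a) (tinj b) =
  if i%:Z + j%:Z - n - 1 == 0 then tinj (op false a b)
  else if i%:Z + j%:Z - n - 1 == 1 then tinj (op true a b) else 0.
Proof.
rewrite /tprod; case: i a => a; case: j b => b; rewrite !big_bool /=;
  rewrite !(big_mkcond (fun _ : bool => _ == _)) !big_bool /=;
  rewrite ?(op0l, op0r) ?if_same ?addr0 ?add0r;
  case: eqP => [->|_] //=; case: eqP => //=.
Qed.

Lemma tprod0l n y : tprod op n 0 y = 0.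
Proof.
rewrite /tprod; congr pair; apply: big1 => i _; apply: big1 => j _;
  by case: i; rewrite op0l.
Qed.

Lemma tprod0r n y : tprod op n y 0 = 0.
Proof.
rewrite /tprod; congr pair; apply: big1 => i _; apply: big1 => j _;
  by case: j; rewrite op0r.
Qed.

End TruncatedTheory.

Section VertexAlgebraTheory.
Variable V : vertexAlgebra.

Lemma va_op0r n (a : V) : va_op n a 0 = 0.
Proof.
by have := va_opr_linear n a (-1) 0 0; rewrite scaler0 addr0 scaleN1r addNr.
Qed.

Lemma va_op0l n (b : V) : va_op n 0 b = 0.
Proof.
by have := va_opl_linear n b (-1) 0 0; rewrite scaler0 addr0 scaleN1r addNr.
Qed.

Lemma va_opDr n (a b c : V) : va_op n a (b + c) = va_op n a b + va_op n a c.
Proof. by have := va_opr_linear n a 1 b c; rewrite !scale1r. Qed.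

Lemma va_opDl n (a b c : V) : va_op n (a + b) c = va_op n a c + va_op n b c.
Proof. by have := va_opl_linear n c 1 a b; rewrite !scale1r. Qed.

Lemma va_opZr n (a b : V) x : va_op n a (x *: b) = x *: va_op n a b.
Proof. by have := va_opr_linear n a x b 0; rewrite va_op0r !addr0. Qed.

Lemma va_opZl n (a b : V) x : va_op n (x *: a) b = x *: va_op n a b.
Proof. by have := va_opl_linear n b x a 0; rewrite va_op0l !addr0. Qed.

Lemma va_d_op n (a b : V) :
  va_d V (va_op n a b) = va_op n a (va_d V b) - n%:~R *: va_op (n - 1) a b.
Proof.
have := va_borcherds 0 n (-2) a b (va_vac V); rewrite /borcherds.
rewrite (@fsum_ord _ 1) => [|[//|j] _]; last by rewrite binz0S scale0r.
rewrite big_ord1 (@fsum_ord _ 2) => [|j j2]; last first.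
  by rewrite va_vacr0 ?va_op0r ?scaler0; [|lia].
rewrite (@fsum_ord _ 0) => [|j _]; last first.
  by rewrite va_vacr0 ?va_op0r ?scaler0; [|lia].
rewrite big_ord0 big_ord_recl big_ord1 /= /bump /= !binz0 binz1.
rewrite !addn0 -![0%:Z]/(0 : int) !va_dE ?(subr0, addr0, add0r) !scale1r.
rewrite -[-2 + 1%:Z]/(-1 : int) -[1%:Z]/(1 : int).
by rewrite expr0 mul1r expr1 scale1r va_vacr mulN1r scaleNr => ->.
Qed.

Lemma va_d_opl n (a b : V) : n = -1 \/ n = 0 ->
  va_op n (va_d V a) b = - n%:~R *: va_op (n - 1) a b.
Proof.
move=> n01; have := va_borcherds 0 (-2) n a (va_vac V) b; rewrite /borcherds.
rewrite (@fsum_ord _ 1) => [|[//|j] _]; last by rewrite binz0S scale0r.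
rewrite big_ord1 (@fsum_ord _ 1) => [|j j1]; last first.
  rewrite va_vacl; case: eqP => [|_]; last by rewrite va_op0r scaler0.
  by case: n01 => ->; lia.
rewrite (@fsum_ord _ 0) => [|j _]; last first.
  rewrite va_vacl; case: eqP => [|_]; last by rewrite scaler0.
  by case: n01 => ->; lia.
rewrite big_ord0 big_ord1 /= -![0%:Z]/(0 : int) va_dE !binz0 ?(subr0, addr0, add0r) !scale1r.
rewrite expr0 mul1r scale1r va_vacl => ->.
case: n01 => ->; first by rewrite eqxx opprK scale1r.
by rewrite va_op0r oppr0 scale0r.
Qed.

Lemma va_deriv01 n (a b : V) : n = -1 \/ n = 0 ->
  va_d V (va_op n a b) = va_op n (va_d V a) b + va_op n a (va_d V b).
Proof. by move=> n01; rewrite va_d_op va_d_opl // scaleNr addrC. Qed.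

End VertexAlgebraTheory.

Section GradedTheory.
Variable V : gradedVA.
Local Notation H := (gva_H V).

Lemma gva_H_op n (a b : V) :
  H (va_op n a b) = va_op n (H a) b + va_op n a (H b)
                    - (n + 1)%:~R *: va_op n a b.
Proof.
have [s [sP ->]] := gva_diag a; have [t [tP ->]] := gva_diag b.
elim: s sP => [|x s IHs] sP.
  by rewrite big_nil linear0 !va_op0l linear0 scaler0 subr0 addr0.
rewrite big_cons linearD !va_opDl linearD IHs; last first.
  by move=> y ys; apply: sP; rewrite inE ys orbT.
have {sP IHs} [D xD] := sP x (mem_head _ _).
suff -> : forall y, H (va_op n x y) = va_op n (H x) y + va_op n x (H y)
                    - (n + 1)%:~R *: va_op n x y.
  by rewrite scalerDr opprD addrACA (addrACA (va_op n (H x) _)).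
move=> y; have [{}t [{}tP ->]] := gva_diag y.
elim: t tP => [|z t IHt] tP.
  by rewrite big_nil linear0 !va_op0r linear0 scaler0 subr0 addr0.
rewrite big_cons linearD !va_opDr linearD IHt; last first.
  by move=> y' yt; apply: tP; rewrite inE yt orbT.
have [D' zD'] := tP z (mem_head _ _).
suff -> : H (va_op n x z) = va_op n (H x) z + va_op n x (H z)
                    - (n + 1)%:~R *: va_op n x z.
  by rewrite scalerDr opprD addrACA (addrACA (va_op n (H x) _)).
have /eqP -> := gva_op n xD zD'.
rewrite (eqP xD) (eqP zD') va_opZl va_opZr -scalerDl -scalerBl.
by congr (_ *: _); rewrite rmorphD /= opprD addrA.
Qed.

Lemma va_vac_weight : va_vac V \in in_weight V 0.
Proof.
apply/eqP; have := gva_H_op (-1) (va_vac V) (va_vac V).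
rewrite addNr scale0r subr0 !va_vacr !va_vacl eqxx scale0r => h.
by apply/esym/(addrI (H (va_vac V))); rewrite addr0 -h.
Qed.

End GradedTheory.

Section WeightSpace.
Variables (V : gradedVA) (D : C).

Lemma in_weight_submod_closed : submod_closed (in_weight V D).
Proof.
split=> [|x u v /eqP Hu /eqP Hv]; apply/eqP; first by rewrite linear0 scaler0.
by rewrite linearP Hu Hv scalerDr !scalerA mulrC.
Qed.

HB.instance Definition _ :=
  GRing.isSubmodClosed.Build C V (in_weight V D) in_weight_submod_closed.

Record weightSpace :=
  WeightSpace { wval :> V; wvalP : wval \in in_weight V D }.

HB.instance Definition _ := [isSub for wval].
HB.instance Definition _ := [Choice of weightSpace by <:].
HB.instance Definition _ := [SubChoice_isSubLmodule of weightSpace by <:].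

End WeightSpace.

Section TruncationObject.
Variable V : restrictedVA.

Definition trunc_space (i : bool) : lmodType C := weightSpace V (i%:R).

Lemma trunc_op_subproof i j l (a : trunc_space i) (b : trunc_space j) :
  va_op (i%:Z + j%:Z - l%:Z - 1) (wval a) (wval b) \in in_weight V l%:R.
Proof.
have := gva_op (i%:Z + j%:Z - l%:Z - 1) (wvalP a) (wvalP b).
by congr (_ \in in_weight V _); rewrite !(rmorphD, rmorphB) /=; ring.
Qed.

Definition trunc_op i j l (a : trunc_space i) (b : trunc_space j) :
  trunc_space l := WeightSpace (trunc_op_subproof l a b).

Definition trunc_vac : trunc_space false := WeightSpace (va_vac_weight V).

Lemma trunc_d_subproof (a : trunc_space false) :
  va_d V (wval a) \in in_weight V true%:R.
Proof.
have := gva_op (-2) (wvalP a) (va_vac_weight V); rewrite -va_dE.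
by congr (_ \in in_weight V _); rewrite /= !rmorphN /=; ring.
Qed.

Definition trunc_d_fun (a : trunc_space false) : trunc_space true :=
  WeightSpace (trunc_d_subproof a).

Lemma trunc_d_linear : linear trunc_d_fun.
Proof. by move=> x a b; apply: val_inj; rewrite /= linearP. Qed.

HB.instance Definition _ := GRing.isLinear.Build C (trunc_space false)
  (trunc_space true) *:%R trunc_d_fun trunc_d_linear.

Definition trunc_d : {linear trunc_space false -> trunc_space true} :=
  trunc_d_fun.

Lemma trunc_d_val (a : trunc_space false) :
  wval (trunc_d a) = va_d V (wval a).
Proof. by []. Qed.

Lemma trunc_opr_linear i j l (a : trunc_space i) : linear (@trunc_op i j l a).
Proof. by move=> x b c; apply: val_inj; rewrite /= va_opDr va_opZr. Qed.

Lemma trunc_opl_linear i j l (b : trunc_space j) :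
  linear ((@trunc_op i j l) ^~ b).
Proof. by move=> x a c; apply: val_inj; rewrite /= va_opDl va_opZl. Qed.

Local Notation TS := (tsum trunc_space).

Definition trunc_val (x : TS) : V := wval x.1 + wval x.2.

Lemma trunc_val_linear : linear trunc_val.
Proof.
by move=> x u v; rewrite /trunc_val /= scalerDr addrACA.
Qed.

HB.instance Definition _ :=
  GRing.isLinear.Build C TS V *:%R trunc_val trunc_val_linear.

Lemma trunc_valD x y : trunc_val (x + y) = trunc_val x + trunc_val y.
Proof. exact: linearD. Qed.

Lemma trunc_val_inj : injective trunc_val.
Proof.
suff h x : trunc_val x = 0 -> x = 0.
  by move=> x y xy; apply/eqP; rewrite -subr_eq0; apply/eqP/h;
    rewrite linearB /= xy subrr.
case: x => x y; rewrite /trunc_val /= => xy0.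
have /(congr1 (gva_H V)) := xy0.
rewrite linearD (eqP (wvalP x)) (eqP (wvalP y)) linear0 scale0r scale1r add0r.
move=> y0; move: xy0; rewrite y0 addr0 => x0.
by congr pair; apply: val_inj.
Qed.

Lemma trunc_val_tinj i (a : trunc_space i) : trunc_val (tinj a) = wval a.
Proof. by case: i a => a; rewrite /trunc_val /= ?addr0 ?add0r. Qed.

Lemma weight_neg0 (z : int) (v : V) : z < 0 -> v \in in_weight V z%:~R -> v = 0.
Proof.
move=> z0 vz; apply/eqP/negPn/negP => v0.
by apply: (rva_restricted z0); exists v.
Qed.

Local Notation tp := (tprod trunc_op).

Let homog (w : int) (x : TS) : Prop :=
  x = 0 \/ exists i (a : trunc_space i), w = i%:Z /\ x = tinj a.

Let homog_inj i (a : trunc_space i) : homog i%:Z (tinj a).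
Proof. by right; exists i, a. Qed.

Let tp0l n x : tp n 0 x = 0.
Proof. exact: (tprod0l trunc_opl_linear). Qed.

Let tp0r n x : tp n x 0 = 0.
Proof. exact: (tprod0r trunc_opr_linear). Qed.

Let tpE n i j (a : trunc_space i) (b : trunc_space j) :
  tp n (tinj a) (tinj b) =
  if i%:Z + j%:Z - n - 1 == 0 then tinj (trunc_op false a b)
  else if i%:Z + j%:Z - n - 1 == 1 then tinj (trunc_op true a b) else 0.
Proof. exact: (tprod_tinj trunc_opr_linear trunc_opl_linear). Qed.

Let homog_tp n w w' x y :
  homog w x -> homog w' y -> homog (w + w' - n - 1) (tp n x y).
Proof.
move=> [->|[i [a [-> ->]]]]; first by left; rewrite tp0l.
move=> [->|[j [b [-> ->]]]]; first by left; rewrite tp0r.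
rewrite tpE; case: eqP => [->|_]; first exact: homog_inj.
by case: eqP => [->|_]; [exact: homog_inj | left].
Qed.

Let tp_val n w w' x y : homog w x -> homog w' y -> w + w' - n - 1 <= 1 ->
  trunc_val (tp n x y) = va_op n (trunc_val x) (trunc_val y).
Proof.
move=> [->|[i [a [-> ->]]]]; first by rewrite tp0l linear0 va_op0l.
move=> [->|[j [b [-> ->]]]]; first by rewrite tp0r linear0 va_op0r.
move=> le1; rewrite tpE; case: eqP => [e|n0].
  rewrite !trunc_val_tinj /=; congr va_op; lia.
case: eqP => [e|n1]; first by rewrite !trunc_val_tinj /=; congr va_op; lia.
rewrite linear0 !trunc_val_tinj; apply/esym.
apply: (@weight_neg0 (i%:Z + j%:Z - n - 1)); first by lia.
have := gva_op n (wvalP a) (wvalP b).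
by congr (_ \in in_weight V _); rewrite !rmorphB rmorphD.
Qed.

Let vac := tinj trunc_vac : TS.

Let homog_vac : homog 0 vac. Proof. exact: (homog_inj trunc_vac). Qed.

Let vac_val : trunc_val vac = va_vac V.
Proof. by rewrite trunc_val_tinj. Qed.

Lemma trunc_vacl n i (a : trunc_space i) :
  tp n vac (tinj a) = if n == -1 then tinj a else 0.
Proof.
have [le1|gt1] := lerP (0 + i%:Z - n - 1) 1.
  apply: trunc_val_inj; rewrite (tp_val homog_vac (homog_inj a) le1).
  by rewrite vac_val va_vacl; case: ifP => // _; rewrite linear0.
rewrite tpE; move: gt1; have := leq_b1 i; move: (nat_of_bool i) => i' i1 gt1.
case: eqP => [|_]; first by move=> /=; lia.
case: eqP => [|_]; first by move=> /=; lia.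
by case: eqP => // e; lia.
Qed.

Lemma trunc_vacr0 n i (a : trunc_space i) : 0 <= n -> tp n (tinj a) vac = 0.
Proof.
move=> n0; apply: trunc_val_inj; rewrite (tp_val (homog_inj a) homog_vac).
  by rewrite vac_val va_vacr0 // linear0.
by have := leq_b1 i; lia.
Qed.

Lemma trunc_vacr i (a : trunc_space i) : tp (-1) (tinj a) vac = tinj a.
Proof.
apply: trunc_val_inj; rewrite (tp_val (homog_inj a) homog_vac).
  by rewrite vac_val va_vacr.
by have := leq_b1 i; lia.
Qed.

Lemma trunc_dE (a : trunc_space false) :
  tinj (trunc_d a) = tp (-2) (tinj a) vac.
Proof.
apply: trunc_val_inj; rewrite (tp_val (homog_inj a) homog_vac) //.
by rewrite vac_val !trunc_val_tinj /= va_dE.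
Qed.

Lemma trunc_dvac : trunc_d trunc_vac = 0.
Proof. by apply: val_inj; rewrite /= va_dE va_vacl. Qed.

Lemma trunc_deriv (n : int) (a b : trunc_space false) : - n <= 1 ->
  tinj (trunc_d (tp n (tinj a) (tinj b)).1)
  = tp n (tinj (trunc_d a)) (tinj b) + tp n (tinj a) (tinj (trunc_d b)) :> TS.
Proof.
move=> n1; have ha := homog_inj a; have hb := homog_inj b.
have hda := homog_inj (trunc_d a); have hdb := homog_inj (trunc_d b).
have [n0|n0] := lerP n 0; last first.
  rewrite !tpE; do 6?[case: eqP => [|_]; first by move=> /=; lia].
  by rewrite linear0 addr0 tinj0.
apply: trunc_val_inj; rewrite trunc_valD (tp_val hda hb); last by move=> /=; lia.
rewrite (tp_val ha hdb); last by move=> /=; lia.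
rewrite !trunc_val_tinj !trunc_d_val -va_deriv01; last by lia.
congr (va_d V _); have := tp_val (n := n) ha hb.
rewrite !trunc_val_tinj => <-; last by move=> /=; lia.
rewrite tpE; case: eqP => [_|]; first by rewrite trunc_val_tinj.
case: eqP => [|_ _]; first by move=> /=; lia.
by rewrite /trunc_val /= addr0.
Qed.

Lemma trunc_borcherds (m n k : int) (i j l : bool)
    (a : trunc_space i) (b : trunc_space j) (c : trunc_space l) :
    i%:Z + j%:Z - n - 1 <= 1 -> j%:Z + l%:Z - k - 1 <= 1 ->
    i%:Z + l%:Z - m - 1 <= 1 ->
    i%:Z + j%:Z + l%:Z - m - n - k - 2 <= 1 ->
  borcherds tp m n k (tinj a) (tinj b) (tinj c).
Proof.
have := (homog_inj a, homog_inj b, homog_inj c).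
move: (tinj a) (tinj b) (tinj c) => x y z [[hx hy] hz] h1 h2 h3 h4.
apply: trunc_val_inj; rewrite linearB !(linear_fsum _ trunc_val_inj).
have := va_borcherds m n k (trunc_val x) (trunc_val y) (trunc_val z).
rewrite /borcherds => e; etransitivity; last etransitivity; [|exact: e|].
  apply: eq_fsbigr => t _; rewrite linearZ /=; congr (_ *: _).
  by rewrite (tp_val (homog_tp _ hx hy) hz) ?(tp_val hx hy) //; lia.
congr (_ - _); apply: eq_fsbigr => t _; rewrite linearZ /=; congr (_ *: _).
  by rewrite (tp_val hx (homog_tp _ hy hz)) ?(tp_val hy hz) //; lia.
by rewrite (tp_val hy (homog_tp _ hx hz)) ?(tp_val hx hz) //; lia.
Qed.

Definition truncation : oneTruncVA :=
  OneTruncVA trunc_opr_linear trunc_opl_linear trunc_vacl trunc_vacr0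
    trunc_vacr trunc_dE trunc_dvac trunc_deriv trunc_borcherds.

End TruncationObject.

Section TruncationMorphism.
Variables (V V' : restrictedVA) (f : vaHom V V').

Definition trunc_fun (i : bool) (a : trunc_space V i) : trunc_space V' i :=
  WeightSpace (va_fun_weight f (wvalP a)).

Lemma trunc_fun_linear i : linear (@trunc_fun i).
Proof. by move=> x a b; apply: val_inj; rewrite /= va_fun_linear. Qed.

Lemma trunc_fun_vac : trunc_fun (trunc_vac V) = trunc_vac V'.
Proof. by apply: val_inj; rewrite /= va_fun_vac. Qed.

Lemma trunc_fun_d a : trunc_fun (trunc_d V a) = trunc_d V' (trunc_fun a).
Proof. by apply: val_inj; rewrite /= !va_dE va_fun_op va_fun_vac. Qed.

Lemma trunc_fun_op i j l (a : trunc_space V i) (b : trunc_space V j) :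
  trunc_fun (trunc_op l a b) = trunc_op l (trunc_fun a) (trunc_fun b).
Proof. by apply: val_inj; rewrite /= va_fun_op. Qed.

Definition truncation_map : otHom (truncation V) (truncation V') :=
  @OTHom (truncation V) (truncation V') trunc_fun trunc_fun_linear
    trunc_fun_vac trunc_fun_d trunc_fun_op.

End TruncationMorphism.

Lemma truncation_map_id (V : restrictedVA) :
  truncation_map (vaHom_id V) = otHom_id (truncation V).
Proof. by apply: otHom_eq => i x; apply: val_inj. Qed.

Lemma truncation_map_comp (V1 V2 V3 : restrictedVA)
    (f : vaHom V2 V3) (g : vaHom V1 V2) :
  truncation_map (vaHom_comp f g)
  = otHom_comp (truncation_map f) (truncation_map g).
Proof. by apply: otHom_eq => i x; apply: val_inj. Qed.

Definition TruncationFunctor : functor RestrictedVACat OneTruncVACat :=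
  @Functor RestrictedVACat OneTruncVACat truncation
    (fun V V' f => truncation_map f) truncation_map_id truncation_map_comp.

End VertexAlgebras.

(* Main.v *)
From HB Require Import structures.
From mathcomp Require Import all_boot all_order all_algebra generic_quotient.
From mathcomp Require Import boolp classical_sets functions cardinality fsbigop.
From mathcomp Require Import reals.
From mathcomp.real_closed Require Import complex.
From mathcomp Require Import ring zify.
Require Import Defs.

(** The left adjoint is given by generators and relations. Write [A] and [B] for
    the parts of weight zero and one of [W]. The modes [x_(n)] with [x] in [B] and
    [a_(n)] with [a] in [A], where [(d a)_(n) = - n a_(n-1)], should span a Lie
    algebra [L], on which the translation [T] acts, and which is the sum of the
    subalgebra [p] of the modes that do not raise the weight and the subalgebra
    [q] of those that do; as the modes [a_(n)] with [n <= -2] come from [d a],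
    [q] consists of the [x_(n)] with [n < 0]. The envelope [env] is generated by
    the states of [A] under [q] and [T], with the commutators in [q] and [T] as
    relations and with [x_(-1) a = (x_(-1) a)_(-1) 1] and [T a = (d a)_(-1) 1],
    where the products on the right are those of [W].

    The modes in [p] act on words by recursion: they are moved to the right by
    means of their commutators until they meet a state of [A], on which [W]
    prescribes their value. That this respects the relations ([modes_walg]) and
    gives a representation of [L] ([commP]) are finite computations with the
    identities which the Borcherds identities of [W] give in weights zero and one.

    The operators of [L] form mutually local fields, translation covariant and
    generating from the vacuum [1]. The reconstruction theorem ([reconstruct])
    makes the envelope a vertex algebra: products of local fields are local
    ([dong]), a field is determined by the state it creates ([goddard]), and so
    every state has exactly one field. The Borcherds identity follows from its
    case [m = 0], which describes the products of fields, since both sides satisfy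
    the same recursion ([Y_borcherds]).

    Words have nonnegative integral weights, hence the envelope is restricted. The
    relations respect the map that keeps only the words [a] and [x_(-1) a], with
    values in [W], and [T a]. It splits the map from [W] ([unit_funK]), and a state
    of weight zero is some [a], one of weight one is some [x_(-1) 1]
    ([low_decomposition]). So [W] is the part of weight at most one of its
    envelope ([unit_iso]).

    A morphism from [W] to the truncation of a restricted vertex algebra sends the
    relations to identities, hence extends to the envelope ([ext_walg]). The
    extension commutes with all modes ([F_modesP]), therefore with all products
    ([F_op]); it is unique because the modes generate ([env_hom_eq]). *)

Set Implicit Arguments.
Unset Strict Implicit.
Unset Printing Implicit Defensive.

Import Order.TTheory GRing.Theory Num.Theory.
Local Open Scope complex_scope.
Local Open Scope ring_scope.

(** * Linear identities *)

Section LinearCombinations.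
Variables (K : comNzRingType) (V : lmodType K).

(** Linear expressions over numbered atoms. Equality of linear combinations is
    decided by comparing the coefficients of the atoms. *)
Inductive lexp :=
  LAtom of nat | LZero | LAdd of lexp & lexp | LOpp of lexp
| LScale of K & lexp.

Fixpoint leval (env : seq V) (e : lexp) : V :=
  match e with
  | LAtom i => nth 0 env i
  | LZero => 0
  | LAdd e1 e2 => leval env e1 + leval env e2
  | LOpp e1 => - leval env e1
  | LScale c e1 => c *: leval env e1
  end.

Fixpoint lcoef (e : lexp) (i : nat) : K :=
  match e with
  | LAtom j => if eqn j i then 1 else 0
  | LZero => 0
  | LAdd e1 e2 => lcoef e1 i + lcoef e2 i
  | LOpp e1 => - lcoef e1 i
  | LScale c e1 => c * lcoef e1 i
  end.

Lemma levalE env e : leval env e = \sum_(i < size env) lcoef e i *: env`_i.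
Proof.
elim: e => [j||e1 IH1 e2 IH2|e1 IH1|c e1 IH1] /=.
- have [jlt|jge] := ltnP j (size env).
    rewrite (bigD1 (Ordinal jlt)) //= -[eqn j j]/(j == j :> nat) eqxx scale1r big1 ?addr0 // => i.
    by rewrite -[eqn j i]/(j == i :> nat) -val_eqE /= eq_sym => /negbTE ->; rewrite scale0r.
  rewrite nth_default // big1 // => i _; rewrite -[eqn j i]/(j == i :> nat).
  by rewrite gtn_eqF ?scale0r // (leq_trans (ltn_ord i) jge).
- by rewrite big1 // => i _; rewrite scale0r.
- by rewrite IH1 IH2 -big_split; apply: eq_bigr => i _; rewrite scalerDl.
- by rewrite IH1 -sumrN; apply: eq_bigr => i _; rewrite scaleNr.
- by rewrite IH1 scaler_sumr; apply: eq_bigr => i _; rewrite scalerA.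
Qed.

Fixpoint lcoef_eq (e1 e2 : lexp) (n : nat) : Prop :=
  if n is n'.+1 then lcoef e1 n' = lcoef e2 n' /\ lcoef_eq e1 e2 n' else True.

Lemma leval_eq env e1 e2 :
  lcoef_eq e1 e2 (size env) -> leval env e1 = leval env e2.
Proof.
move=> h; rewrite !levalE; apply: eq_bigr => i _; congr (_ *: _).
move: (size env) h i => n; elim: n => [_ [] //|n IH] /= [hn h] i.
by have [] := ltngtP i n; [move=> lt; exact: (IH h (Ordinal lt))
  | move: (ltn_ord i); rewrite ltnS leqNgt => /negP // | move=> ->].
Qed.

End LinearCombinations.

Ltac lmod_head x := match x with ?f _ => lmod_head f | _ => x end.

(** Atoms with the same head symbol are compared up to conversion, as the
    indices in them may be written with different canonical structures. *)
Ltac lmod_same x y :=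
  match constr:(Set) with
  | _ => let _ := match constr:(Set) with _ => constr_eq x y end in constr:(true)
  | _ => let f := lmod_head x in let g := lmod_head y in
         let _ := match constr:(Set) with _ => constr_eq f g; unify x y end in
         constr:(true)
  | _ => constr:(false)
  end.

Ltac lmod_index x l :=
  match l with
  | ?y :: ?l' =>
      let e := lmod_same x y in
      match e with
      | true => constr:(0%N)
      | false => let i := lmod_index x l' in constr:(S i)
      end
  end.

Ltac lmod_mem x l :=
  match l with
  | nil => constr:(false)
  | ?y :: ?l' =>
      let e := lmod_same x y in
      match e with true => constr:(true) | false => lmod_mem x l' end
  end.

Ltac lmod_atoms t l :=
  match t with
  | (?a + ?b)%R => let l' := lmod_atoms a l in lmod_atoms b l'
  | (- ?a)%R => lmod_atoms a l
  | (_ *: ?a)%R => lmod_atoms a l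
  | 0%R => l
  | _ => let m := lmod_mem t l in
         match m with true => l | false => constr:(t :: l) end
  end.

Ltac lmod_reify K t l :=
  match t with
  | (?a + ?b)%R =>
      let a' := lmod_reify K a l in let b' := lmod_reify K b l in
      constr:(@LAdd K a' b')
  | (- ?a)%R => let a' := lmod_reify K a l in constr:(@LOpp K a')
  | (?c *: ?a)%R => let a' := lmod_reify K a l in constr:(@LScale K c a')
  | 0%R => constr:(@LZero K)
  | _ => let i := lmod_index t l in constr:(@LAtom K i)
  end.

(** Reduces an equation between linear combinations in a module [V] over [K] to
    the equations between the coefficients of each atom. *)
Tactic Notation "lmod_coefs" constr(K) constr(V) :=
  match goal with
  | |- ?x = ?y =>
      let l := lmod_atoms x (@nil V) in
      let l := lmod_atoms y l in
      let ex := lmod_reify K x l in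
      let ey := lmod_reify K y l in
      change (leval l ex = leval l ey);
      apply: leval_eq; cbv [size lcoef_eq lcoef eqn];
      repeat (split; [try by [] |]); try by []
  end.

Section LinearFunctions.
Variables (K : nzRingType) (U V : lmodType K) (f : U -> V).
Hypothesis f_lin : linear f.

Lemma linD u v : f (u + v) = f u + f v.
Proof. by have := f_lin 1 u v; rewrite !scale1r. Qed.

Lemma lin0 : f 0 = 0.
Proof. by have := f_lin (-1) 0 0; rewrite scaler0 addr0 scaleN1r addNr. Qed.

Lemma linZ c u : f (c *: u) = c *: f u.
Proof. by have := f_lin c u 0; rewrite lin0 !addr0. Qed.

Lemma linN u : f (- u) = - f u.
Proof. by rewrite -scaleN1r linZ scaleN1r. Qed.

Lemma linB u v : f (u - v) = f u - f v.
Proof. by rewrite linD linN. Qed.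

Lemma lin_sum I (r : seq I) (F : I -> U) :
  f (\sum_(i <- r) F i) = \sum_(i <- r) f (F i).
Proof. exact: (big_morph f linD lin0). Qed.

End LinearFunctions.

(** * Sums over the natural numbers *)

Section EventuallyZero.
Variables (R : realType) (V : lmodType R[i]).
Local Notation C := R[i].
Implicit Types F G : nat -> V.

(** The families whose sum over all [j >= 0] in [borcherds] is finite; for
    other families that sum is the default value [0]. *)
Definition ev0 F := exists N, forall j, (N <= j)%N -> F j = 0.

(** The infinite sums of [borcherds]. *)
Definition fs F : V := \sum_(j \in [set: nat]) F j.

Lemma fsE F : \sum_(j \in [set: nat]) F j = fs F. Proof. by []. Qed.

Lemma eq_fs F G : F =1 G -> fs F = fs G.
Proof. by move=> /funext ->. Qed.

Lemma fs_ord N F : (forall j, (N <= j)%N -> F j = 0) -> fs F = \sum_(j < N) F j.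
Proof. exact: fsum_ord. Qed.

Lemma fs0 F : (forall j, F j = 0) -> fs F = 0.
Proof. by move=> F0; rewrite (@fs_ord 0) ?big_ord0. Qed.

Lemma fs1 F : (forall j, F j.+1 = 0) -> fs F = F 0.
Proof. by move=> F0; rewrite (@fs_ord 1) ?big_ord1 // => -[]. Qed.

Lemma ev0D F G : ev0 F -> ev0 G -> ev0 (fun j => F j + G j).
Proof.
move=> [N hN] [M hM]; exists (maxn N M) => j.
by rewrite geq_max => /andP[jN jM]; rewrite hN // hM // addr0.
Qed.

Lemma ev0Z (c : nat -> C) F : ev0 F -> ev0 (fun j => c j *: F j).
Proof. by move=> [N hN]; exists N => j jN; rewrite hN // scaler0. Qed.

Lemma ev0N F : ev0 F -> ev0 (fun j => - F j).
Proof. by move=> [N hN]; exists N => j jN; rewrite hN // oppr0. Qed.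

Lemma fsD F G : ev0 F -> ev0 G -> fs (fun j => F j + G j) = fs F + fs G.
Proof.
move=> [N hN] [M hM]; rewrite !(@fs_ord (maxn N M)) ?big_split // => j;
  by rewrite geq_max => /andP[jN jM]; rewrite ?hN // ?hM // addr0.
Qed.

Lemma fsZ c F : ev0 F -> fs (fun j => c *: F j) = c *: fs F.
Proof.
move=> [N hN]; rewrite !(@fs_ord N) ?scaler_sumr // => j jN.
by rewrite hN // scaler0.
Qed.

Lemma fsN F : ev0 F -> fs (fun j => - F j) = - fs F.
Proof.
by move=> h; rewrite -scaleN1r -fsZ //; apply: eq_fs => j; rewrite scaleN1r.
Qed.

Lemma fsB F G : ev0 F -> ev0 G -> fs (fun j => F j - G j) = fs F - fs G.
Proof. by move=> hF hG; rewrite fsD ?fsN //; exact: ev0N. Qed.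

Lemma fs_recl F : ev0 F -> fs F = F 0 + fs (fun j => F j.+1).
Proof.
move=> [N hN]; rewrite (@fs_ord N.+1) => [|j /ltnW]; last exact: hN.
rewrite (@fs_ord N) => [|j jN]; last by rewrite hN // ltnW.
by rewrite big_ord_recl.
Qed.

End EventuallyZero.

Lemma fs_lin (R : realType) (U V : lmodType R[i]) (f : U -> V) (F : nat -> U) :
  linear f -> ev0 F -> f (fs F) = fs (fun j => f (F j)).
Proof.
move=> fl [N hN]; rewrite !(@fs_ord _ _ N) ?lin_sum // => j jN.
by rewrite hN // lin0.
Qed.

Section Binomials.
Variable R : realType.

Lemma binzS_mul (m : int) j :
  (j.+1)%:R * binz R m j.+1 = (m - j%:Z)%:~R * binz R m j.
Proof.
rewrite /binz big_ord_recr /= factS natrM.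
have h1 : (j.+1)%:R != 0 :> R[i] by rewrite pnatr_eq0.
have h2 : (j`!)%:R != 0 :> R[i] by rewrite pnatr_eq0 -lt0n fact_gt0.
by field; rewrite h2 [1 + _]addrC natr1 h1.
Qed.

(** Pascal's rule holds for every integer [m], also a negative one; all the
    recursions between Borcherds identities below come from it. *)
Lemma binz_pascal (m : int) j :
  binz R (m + 1) j.+1 = binz R m j.+1 + binz R m j.
Proof.
elim: j m => [|j IH] m; first by rewrite !binz0 !binz1 rmorphD.
have n0 : (j.+2)%:R != 0 :> R[i] by rewrite pnatr_eq0.
apply: (mulfI n0); rewrite mulrDr !binzS_mul IH mulrDr.
have := binzS_mul m j; rewrite -!natr1 => e1.
have e2 : binz R m j * ((m - j%:Z)%:~R) = (j%:R + 1) * binz R m j.+1.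
  by rewrite e1 mulrC.
have -> : (m + 1 - (j.+1)%:Z)%:~R = (m - j%:Z)%:~R :> R[i].
  by congr (_%:~R); lia.
rewrite [X in _ + X = _]mulrC e2.
have -> : (m - j%:Z)%:~R = (m - (j.+1)%:Z)%:~R + 1 :> R[i].
  by rewrite -(rmorphD _ _ 1) /=; congr (_%:~R); lia.
by ring.
Qed.

End Binomials.

(** * Fields and their products *)

Section Fields.
Variables (R : realType) (V : lmodType R[i]).
Local Notation C := R[i].
Implicit Types (a b c F : int -> V -> V) (u v : V) (m n k l : int).

(** A field [F] is given by its modes: [F n] is the coefficient of
    [z ^ (- n - 1)] in [F(z)]. *)
Record is_field F : Prop := IsField {
  fld_lin : forall n, linear (F n);
  fld_trunc : forall v, exists N : nat, forall n, N%:Z <= n -> F n v = 0 }.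

Lemma fld0 F n : is_field F -> F n 0 = 0.
Proof. by move=> hF; apply: lin0; exact: fld_lin. Qed.

(** The coefficient of [z ^ (- m - 1) w ^ (- k - 1)] in
    [(z - w) ^ n a(z) b(w)], where the power is expanded for [|z| > |w|]. *)
Definition Pk a b n m k v : V :=
  fs (fun j => ((-1) ^+ j * binz R n j) *: a (n + m - j%:Z) (b (k + j%:Z) v)).

(** The same coefficient in [(z - w) ^ n [a(z), b(w)]], each of the two products
    with the power expanded in its own domain. This is the right hand side of
    the Borcherds identity. *)
Definition Bk a b n m k v : V :=
  Pk a b n m k v - (-1) ^ n *: Pk b a n k m v.

Lemma Pk_ev a b m k v (f : nat -> C) : is_field a -> is_field b ->
  ev0 (fun j => f j *: a (m - j%:Z) (b (k + j%:Z) v)).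
Proof.
move=> ha hb; apply: ev0Z; have [N hN] := fld_trunc hb v.
exists (N + absz k)%N => j jN; rewrite hN ?fld0 //; lia.
Qed.

Lemma Pk_evS a b m k v (f : nat -> C) : is_field a -> is_field b ->
  ev0 (fun j => f j *: a (m - (j.+1)%:Z) (b (k + (j.+1)%:Z) v)).
Proof.
move=> ha hb; apply: ev0Z; have [N hN] := fld_trunc hb v.
exists (N + absz k)%N => j jN; rewrite hN ?fld0 //; lia.
Qed.

End Fields.

Ltac ev_field :=
  match goal with ha : is_field _, hb : is_field _ |- _ =>
    solve [refine (Pk_ev _ _ _ _ ha hb) | refine (Pk_evS _ _ _ _ ha hb)
          |refine (ev0Z (fun=> _) _); refine (Pk_ev _ _ _ _ ha hb)]
  end.

Section FieldProducts.
Variables (R : realType) (V : lmodType R[i]).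
Local Notation C := R[i].
Implicit Types (a b c F : int -> V -> V) (u v : V) (m n k l : int).

Lemma Pk_lin a b n m k : is_field a -> is_field b -> linear (Pk a b n m k).
Proof.
move=> ha hb x u v; rewrite /Pk -fsZ; last ev_field.
rewrite -fsD; first apply: eq_fs => j.
- rewrite (fld_lin hb) (fld_lin ha).
  by lmod_coefs C V; ring.
- ev_field.
- ev_field.
Qed.

Lemma Bk_lin a b n m k : is_field a -> is_field b -> linear (Bk a b n m k).
Proof.
move=> ha hb x u v; rewrite /Bk !(Pk_lin _ _ _ _ _ x) //.
by lmod_coefs C V; ring.
Qed.

Lemma Pk0 a b m k v : Pk a b 0 m k v = a m (b k v).
Proof.
rewrite /Pk fs1 => [|j]; last by rewrite binz0S mulr0 scale0r.
by rewrite binz0 mulr1 scale1r add0r subr0 addr0.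
Qed.

Lemma Bk0 a b m k v : Bk a b 0 m k v = a m (b k v) - b k (a m v).
Proof. by rewrite /Bk !Pk0 expr0z scale1r. Qed.

(** Multiplication by [z - w] raises [n] by one. *)
Lemma Pk_D a b n m k v : is_field a -> is_field b ->
  Pk a b (n + 1) m k v = Pk a b n (m + 1) k v - Pk a b n m (k + 1) v.
Proof.
move=> ha hb.
rewrite /Pk fs_recl; last ev_field.
rewrite [fs (fun j => _ *: a (n + (m + 1) - _) _)]fs_recl; last ev_field.
rewrite (_ : n + 1 + m - 0%:Z = n + (m + 1) - 0%:Z); last by lia.
rewrite !binz0 -[RHS]addrA; congr (_ + _).
rewrite -fsB; [apply: eq_fs => j | ev_field..].
rewrite binz_pascal (_ : n + 1 + m - _ = n + m - j%:Z); last by lia.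
rewrite (_ : n + (m + 1) - _ = n + m - j%:Z); last by lia.
rewrite (_ : k + 1 + _ = k + (j.+1)%:Z); last by lia.
by rewrite exprS; lmod_coefs C V; ring.
Qed.

Lemma signzK n : ((-1) ^ n) * ((-1) ^ n) = 1 :> C.
Proof.
by rewrite -expfzMl mulrNN mulr1 exp1rz.
Qed.

Lemma signzS n : (-1) ^ (n + 1) = - ((-1) ^ n) :> C.
Proof. by rewrite expfzDr ?oppr_eq0 ?oner_eq0 // expr1z mulrN1. Qed.

Lemma Bk_D a b n m k v : is_field a -> is_field b ->
  Bk a b (n + 1) m k v = Bk a b n (m + 1) k v - Bk a b n m (k + 1) v.
Proof.
by move=> ha hb; rewrite /Bk !Pk_D // signzS; lmod_coefs C V; ring.
Qed.

Lemma Bk_sym a b n m k v :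
  Bk b a n k m v = - (-1) ^ n *: Bk a b n m k v.
Proof.
rewrite /Bk; move: ((-1) ^ n) (signzK n) => s ss.
by lmod_coefs C V; ring: ss.
Qed.

Lemma Pk_trunc_r a b n m v : is_field a -> is_field b ->
  exists N : nat, forall k, N%:Z <= k -> Pk a b n m k v = 0.
Proof.
move=> ha hb; have [N hN] := fld_trunc hb v; exists N => k hk.
by apply: fs0 => j; rewrite hN ?fld0 ?scaler0 //; lia.
Qed.

Lemma Pk_trunc_l a b n k v : is_field a -> is_field b ->
  exists N : nat, forall m, N%:Z <= m -> Pk a b n m k v = 0.
Proof.
move=> ha hb; have [M hM] := fld_trunc hb v.
pose J := (M + absz k)%N.
have [N hN] : exists N : nat, forall m j, (j < J)%N -> N%:Z <= m ->
    a m (b (k + j%:Z) v) = 0.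
  elim: (J) => [|J' [N IH]]; first by exists 0%N.
  have [N' hN'] := fld_trunc ha (b (k + J'%:Z) v).
  exists (maxn N N') => m j; rewrite ltnS leq_eqVlt => /orP[/eqP ->|jJ] hm.
    by apply: hN'; lia.
  by apply: IH => //; lia.
exists (N + J + absz n)%N => m hm; apply: fs0 => j.
have [jJ|Jj] := ltnP j J; first by rewrite hN ?scaler0 //; lia.
by rewrite hM ?fld0 ?scaler0 //; rewrite /J in Jj; lia.
Qed.

Lemma Bk_trunc_r a b n m v : is_field a -> is_field b ->
  exists N : nat, forall k, N%:Z <= k -> Bk a b n m k v = 0.
Proof.
move=> ha hb; have [N hN] := Pk_trunc_r n m v ha hb.
have [N' hN'] := Pk_trunc_l n m v hb ha.
exists (maxn N N') => k hk; rewrite /Bk hN ?hN' ?scaler0 ?subr0 //; lia.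
Qed.

Lemma Bk_trunc_l a b n k v : is_field a -> is_field b ->
  exists N : nat, forall m, N%:Z <= m -> Bk a b n m k v = 0.
Proof.
move=> ha hb; have [N hN] := Bk_trunc_r n k v hb ha.
by exists N => m hm; rewrite Bk_sym hN ?scaler0.
Qed.

(** The [n]-th product of two fields, the residue of [Bk] in the first
    variable. *)
Definition nprod n a b : int -> V -> V := fun k v => Bk a b n 0 k v.

Lemma nprod_field n a b : is_field a -> is_field b -> is_field (nprod n a b).
Proof.
move=> ha hb; split=> [k|v]; first exact: Bk_lin.
exact: Bk_trunc_r.
Qed.

(** For [n >= 0] nothing is expanded in [Bk], so that its vanishing says that
    [(z - w) ^ n] kills the commutator of [a(z)] and [b(w)]. *)
Definition loc a b : Prop :=
  exists N : nat, forall n m k v, N%:Z <= n -> Bk a b n m k v = 0.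

Lemma loc_from a b (n : nat) : is_field a -> is_field b ->
  (forall m k v, Bk a b n%:Z m k v = 0) -> loc a b.
Proof.
move=> ha hb h; exists n => n' m k v hn.
have -> : n' = n%:Z + (absz (n' - n%:Z))%:Z by lia.
elim: absz m k => [|j IH] m k; first by rewrite addr0 h.
by rewrite -[j.+1]addn1 PoszD addrA Bk_D // !IH subrr.
Qed.

Lemma loc_sym a b : loc a b -> loc b a.
Proof.
by move=> [N hN]; exists N => n m k v hn; rewrite Bk_sym hN // scaler0.
Qed.

Lemma Bk_lincomb_l c a a' b n m k v : is_field a -> is_field a' -> is_field b ->
  forall x, (forall n v, c n v = x *: a n v + a' n v) ->
  Bk c b n m k v = x *: Bk a b n m k v + Bk a' b n m k v.
Proof.
move=> ha ha' hb x hc; rewrite /Bk.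
have -> : Pk c b n m k v = x *: Pk a b n m k v + Pk a' b n m k v.
  rewrite /Pk -fsZ; last ev_field.
  rewrite -fsD; first apply: eq_fs => j.
  - by rewrite hc; lmod_coefs C V; ring.
  - ev_field.
  - ev_field.
have -> : Pk b c n k m v = x *: Pk b a n k m v + Pk b a' n k m v.
  rewrite /Pk -fsZ; last ev_field.
  rewrite -fsD; first apply: eq_fs => j.
  - by rewrite hc (fld_lin hb); lmod_coefs C V; ring.
  - ev_field.
  - ev_field.
by lmod_coefs C V; ring.
Qed.

Lemma loc_lincomb c a a' b x : is_field a -> is_field a' -> is_field b ->
  (forall n v, c n v = x *: a n v + a' n v) -> loc a b -> loc a' b -> loc c b.
Proof.
move=> ha ha' hb hc [N hN] [N' hN']; exists (maxn N N') => n m k v hn.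
by rewrite (Bk_lincomb_l _ _ _ _ ha ha' hb hc) hN ?hN' ?scaler0 ?addr0 //; lia.
Qed.

(** * Dong's lemma *)

Section Dong.
Variables (c : int -> V -> V) (v : V) (n : int).
Hypothesis hc : is_field c.
Local Notation K3 := (int -> int -> int -> V).

(** Multiplication by [z1 - z2], [z1 - z3] and [z2 - z3] on the coefficients
    of a series in three variables. *)
Definition D12 (f : K3) : K3 := fun m k l => f (m + 1) k l - f m (k + 1) l.
Definition D13 (f : K3) : K3 := fun m k l => f (m + 1) k l - f m k (l + 1).
Definition D23 (f : K3) : K3 := fun m k l => f m (k + 1) l - f m k (l + 1).

(** [commr3] and [comml3] are the two terms of
    [[a b, c] = a [b, c] + [a, c] b], summed as in [Pk a b n]. The commutator
    with [c] carries an extra power [i] of [z2 - z3], respectively [z1 - z3],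
    which [D23], respectively [D13], raises. *)
Definition commr3 a b i : K3 := fun m k l =>
  fs (fun j => ((-1) ^+ j * binz R n j) *:
               a (n + m - j%:Z) (Bk b c i (k + j%:Z) l v)).

Definition comml3 a b i : K3 := fun m k l =>
  fs (fun j => ((-1) ^+ j * binz R n j) *:
               Bk a c i (n + m - j%:Z) l (b (k + j%:Z) v)).

Lemma commr3_ev a b i m k l (g : nat -> C) : is_field a -> is_field b ->
  ev0 (fun j => g j *: a (m - j%:Z) (Bk b c i (k + j%:Z) l v)).
Proof.
move=> ha hb; apply: ev0Z; have [N hN] := Bk_trunc_l i l v hb hc.
by exists (N + absz k)%N => j jN; rewrite hN ?fld0 //; lia.
Qed.

Lemma comml3_ev a b i m k l (g : nat -> C) : is_field a -> is_field b ->
  ev0 (fun j => g j *: Bk a c i (m - j%:Z) l (b (k + j%:Z) v)).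
Proof.
move=> ha hb; apply: ev0Z; have [N hN] := fld_trunc hb v.
exists (N + absz k)%N => j jN; rewrite hN; last by lia.
by apply: lin0; exact: Bk_lin.
Qed.

Ltac ev_comm :=
  match goal with ha : is_field _, hb : is_field _ |- _ =>
    solve [refine (commr3_ev _ _ _ _ _ ha hb)
          |refine (comml3_ev _ _ _ _ _ ha hb)]
  end.

Lemma commr3_D a b i : is_field a -> is_field b ->
  D23 (commr3 a b i) = commr3 a b (i + 1).
Proof.
move=> ha hb; apply/funext => m; apply/funext => k; apply/funext => l.
rewrite /D23 /commr3.
rewrite -fsB; [apply: eq_fs => j | ev_comm..].
rewrite Bk_D // [in RHS](linB (fld_lin ha _)) -scalerBr.
by rewrite [k + 1 + _]addrAC.
Qed.

Lemma comml3_D a b i : is_field a -> is_field b ->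
  D13 (comml3 a b i) = comml3 a b (i + 1).
Proof.
move=> ha hb; apply/funext => m; apply/funext => k; apply/funext => l.
rewrite /D13 /comml3.
rewrite -fsB; [apply: eq_fs => j | ev_comm..].
rewrite Bk_D // -scalerBr; congr (_ *: (_ - _)).
by rewrite [n + (m + 1)]addrA [n + m + 1 - _]addrAC.
Qed.

Lemma Pk_comm a b m k l : is_field a -> is_field b ->
  Pk a b n m k (c l v) - c l (Pk a b n m k v)
  = commr3 a b 0 m k l + comml3 a b 0 m k l.
Proof.
move=> ha hb; rewrite /Pk (fs_lin (fld_lin hc _)); last ev_field.
rewrite -fsB; last first.
- have [N hN] := Pk_ev (n + m) k v (fun j => (-1) ^+ j * binz R n j) ha hb.
  by exists N => j jN; rewrite hN // fld0.
- ev_field.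
rewrite -fsD; [apply: eq_fs => j| ev_comm..].
rewrite !Bk0 (linZ (fld_lin hc _)) (linB (fld_lin ha _)).
by lmod_coefs C V; ring.
Qed.

Lemma iter_zero (M : zmodType) (X : M -> M) p q f : X 0 = 0 -> (q <= p)%N ->
  iter q X f = 0 -> iter p X f = 0.
Proof.
move=> X0 le h; rewrite -(subnK le) iterD h.
by elim: (_ - _)%N => //= d ->.
Qed.

(** As [Z = X - Y], the binomial expansion of [Z ^ (q + p + r)] into terms
    [Z ^ q X ^ i Y ^ j] with [i + j = p + r] has [i >= p] or [j >= r] in
    each. *)
Lemma commuting_nilpotent (M : zmodType) (X Y Z : M -> M) q :
  X 0 = 0 -> Y 0 = 0 -> (forall f g, Z (f - g) = Z f - Z g) ->
  (forall f, Z f = X f - Y f) -> (forall f, X (Y f) = Y (X f)) ->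
  (forall f, X (Z f) = Z (X f)) -> (forall f, Y (Z f) = Z (Y f)) ->
  forall s p r f, (p + r <= s)%N ->
    iter p X (iter q Z f) = 0 -> iter r Y f = 0 -> iter (q + s) Z f = 0.
Proof.
move=> X0 Y0 ZB ZE XY XZ YZ.
have Z0 : Z 0 = 0 by have := ZB 0 0; rewrite !subrr.
have itC (P Q : M -> M) d f : (forall f, P (Q f) = Q (P f)) ->
    iter d P (Q f) = Q (iter d P f).
  by move=> PQ; elim: d => //= d ->.
have itZB d f g : iter d Z (f - g) = iter d Z f - iter d Z g.
  by elim: d => //= d ->.
elim=> [|s IH] p r f le h1 h2.
  by move: le h1; rewrite leqn0 addn_eq0 addn0 => /andP[/eqP -> _].
case: p le h1 => [|p] le h1; first by apply: (@iter_zero _ Z _ q); rewrite ?leq_addr.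
case: r le h2 => [|r] le h2.
  by move: h2 => /= ->; exact: (@iter_zero _ _ _ 0).
have hX : iter (q + s) Z (X f) = 0.
  apply: (IH p r.+1); first by move: le; lia.
    by rewrite (itC Z X) // -iterSr.
  by rewrite (itC Y X) // h2 X0.
have hY : iter (q + s) Z (Y f) = 0.
  apply: (IH p.+1 r); first by move: le; lia.
    by rewrite (itC Z Y) // (itC X Y) // h1 Y0.
  by rewrite -iterSr.
by rewrite addnS iterSr ZE itZB hX hY subrr.
Qed.

End Dong.

Lemma iter_shift (D : (int -> int -> int -> V) -> int -> int -> int -> V)
    (F : int -> int -> int -> int -> V) :
  (forall i, D (F i) = F (i + 1)) ->
  forall p i, iter p D (F i) = F (i + p%:Z).
Proof.
by move=> h; elim=> [|p IH] i; rewrite ?addr0 //= IH h -addrA -[p.+1]addn1 PoszD.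
Qed.

Lemma Bk_field a b n m : is_field a -> is_field b ->
  is_field (fun k v => Bk a b n m k v).
Proof.
by move=> ha hb; split=> [k|v]; [exact: Bk_lin | exact: Bk_trunc_r].
Qed.

(** A power of [D12] kills the three point kernel of [[a_(n) b, c]] because [a]
    and [b] are local; a product of powers of [D13] and [D23] kills it because
    both are local to [c]. As [D23 = D13 - D12], a power of [D23] does. *)
Lemma dong a b c n : is_field a -> is_field b -> is_field c ->
  loc a b -> loc a c -> loc b c -> loc (nprod n a b) c.
Proof.
move=> ha hb hc [r0 hab] [p hac] [q hbc].
pose r := absz (r0%:Z - n).
apply: (@loc_from _ _ (q + (p + r))) => //; first exact: nprod_field.
move=> k l v.
(* [f n] is the three point kernel; [g] multiplies it by powers of [z2 - z3]. *)
pose f i : int -> int -> int -> V :=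
  fun m k l => Bk a b i m k (c l v) - c l (Bk a b i m k v).
pose g i : int -> int -> int -> V :=
  fun m k l => Bk (fun k v => Bk a b n m k v) c i k l v.
have fg : f n = g 0.
  by apply/funext => m; apply/funext => x; apply/funext => y; rewrite /g Bk0.
have fD i : D12 (f i) = f (i + 1).
  apply/funext => m; apply/funext => x; apply/funext => y; rewrite /D12 /f.
  rewrite !(Bk_D i) // (linB (fld_lin hc y) (Bk a b i (m + 1) x v)).
  by lmod_coefs C V; ring.
have gD i : D23 (g i) = g (i + 1).
  apply/funext => m; apply/funext => x; apply/funext => y; rewrite /D23 /g.
  by rewrite Bk_D //; exact: Bk_field.
have f0 : iter r D12 (f n) = 0.
  rewrite (iter_shift fD); apply/funext => m; apply/funext => x; apply/funext => y.
  by rewrite /f !hab ?(fld0 _ hc) ?subrr // /r; lia.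
have D13_0 : D13 (0 : int -> int -> int -> V) = 0.
  by do 3![apply/funext => ?]; rewrite /D13 subrr.
have D12_0 : D12 (0 : int -> int -> int -> V) = 0.
  by do 3![apply/funext => ?]; rewrite /D12 subrr.
have D23_0 : D23 (0 : int -> int -> int -> V) = 0.
  by do 3![apply/funext => ?]; rewrite /D23 subrr.
have addE (x y : int -> int -> int -> V) m i j :
  (x + y) m i j = x m i j + y m i j by [].
have oppE (x : int -> int -> int -> V) m i j : (- x) m i j = - x m i j by [].
have scaleE t (x : int -> int -> int -> V) m i j :
  (t *: x) m i j = t *: x m i j by [].
have DB (D : (int -> int -> int -> V) -> int -> int -> int -> V) :
    D = D13 \/ D = D23 -> (forall x y, D (x + y) = D x + D y)
    /\ (forall t x, D (t *: x) = t *: D x).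
  case=> ->; split=> [x y|t x]; do 3![apply/funext => ?];
    rewrite /D13 /D23 ?addE ?scaleE ?addE ?scaleE;
    by lmod_coefs C V; ring.
(* The terms of [f n] with [b] before [a] are those of [a] before [b] with the
   first two variables exchanged, which also exchanges [D13] and [D23]. *)
pose swap (h : int -> int -> int -> V) : int -> int -> int -> V :=
  fun m k l => h k m l.
have fE : f n = commr3 c v n a b 0 + comml3 c v n a b 0
    - (-1) ^ n *: (swap (commr3 c v n b a 0) + swap (comml3 c v n b a 0)).
  apply/funext => m; apply/funext => x; apply/funext => y.
  rewrite /f /Bk (linB (fld_lin hc _)) (linZ (fld_lin hc _)).
  have e1 := Pk_comm v n hc m x y ha hb; have e2 := Pk_comm v n hc x m y hb ha.
  rewrite -[RHS]/(commr3 c v n a b 0 m x y + comml3 c v n a b 0 m x y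
    - (-1) ^ n *: (commr3 c v n b a 0 x m y + comml3 c v n b a 0 x m y)).
  by rewrite -e1 -e2; lmod_coefs C V; ring.
have C13 h : D13 (swap h) = swap (D23 h) by [].
have C23 h : D23 (swap h) = swap (D13 h) by [].
have it13 d h : iter d D13 (swap h) = swap (iter d D23 h).
  by elim: d => //= d ->.
have it23 d h : iter d D23 (swap h) = swap (iter d D13 h).
  by elim: d => //= d ->.
have comm h : D13 (D23 h) = D23 (D13 h).
  do 3![apply/funext => ?]; rewrite /D13 /D23.
  by lmod_coefs C V; ring.
have commi d e h : iter d D13 (iter e D23 h) = iter e D23 (iter d D13 h).
  have c1 h' : iter d D13 (D23 h') = D23 (iter d D13 h').
    by elim: d => //= d ->.
  by elim: e => //= e <-.
have it0 D d : D 0 = 0 -> iter d D 0 = (0 : int -> int -> int -> V).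
  by move=> D0; elim: d => //= d ->.
have zr a' b' (ha' : is_field a') (hb' : is_field b') t :
    (forall i m k v, t%:Z <= i -> Bk b' c i m k v = 0) ->
    iter t D23 (commr3 c v n a' b' 0) = 0.
  move=> h; rewrite (iter_shift (F := commr3 c v n a' b')) => [|i]; last exact: commr3_D.
  do 3![apply/funext => ?]; apply: fs0 => j.
  by rewrite h ?(fld0 _ ha') ?scaler0 //; lia.
have zl a' b' (ha' : is_field a') (hb' : is_field b') t :
    (forall i m k v, t%:Z <= i -> Bk a' c i m k v = 0) ->
    iter t D13 (comml3 c v n a' b' 0) = 0.
  move=> h; rewrite (iter_shift (F := comml3 c v n a' b')) => [|i]; last exact: comml3_D.
  do 3![apply/funext => ?]; apply: fs0 => j.
  by rewrite h ?scaler0 //; lia.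
pose D := iter p D13 \o iter q D23.
have DD x y : D (x + y) = D x + D y.
  rewrite /D /=; have [h1 _] := DB _ (or_introl erefl).
  have [h2 _] := DB _ (or_intror erefl).
  have -> : iter q D23 (x + y) = iter q D23 x + iter q D23 y.
    by elim: (q) => //= d ->.
  by elim: (p) => //= d ->.
have DZ t x : D (t *: x) = t *: D x.
  rewrite /D /=; have [_ h1] := DB _ (or_introl erefl).
  have [_ h2] := DB _ (or_intror erefl).
  have -> : iter q D23 (t *: x) = t *: iter q D23 x.
    by elim: (q) => //= d ->.
  by elim: (p) => //= d ->.
have Df : D (f n) = 0.
  rewrite fE -scaleNr DD DZ !DD.
  have -> : D (commr3 c v n a b 0) = 0 by rewrite /D /= zr // it0.
  have -> : D (comml3 c v n a b 0) = 0 by rewrite /D /= commi zl // it0.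
  have -> : D (swap (commr3 c v n b a 0)) = 0.
    rewrite /D /= commi it13.
    have -> : iter p D23 (commr3 c v n b a 0) = 0 by apply: zr.
    by rewrite it0.
  have -> : D (swap (comml3 c v n b a 0)) = 0.
    rewrite /D /= it23.
    have -> : iter q D13 (comml3 c v n b a 0) = 0 by apply: zl.
    by rewrite it0.
  by rewrite !addr0 scaler0 addr0.
have : iter (q + (p + r)) D23 (f n) = 0.
  refine (@commuting_nilpotent (int -> int -> int -> V) D13 D12 D23 q _ _ _ _ _ _ _ _ p r (f n) _ _ _) => //.
  - move=> x y; do 3![apply/funext => ?].
    by rewrite /D23 !(addE, oppE); lmod_coefs C V; ring.
  - move=> x; do 3![apply/funext => ?]; rewrite !(addE, oppE) /D23 /D13 /D12.
    by lmod_coefs C V; ring.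
  - move=> x; do 3![apply/funext => ?]; rewrite /D13 /D12.
    by lmod_coefs C V; ring.
  - move=> x; do 3![apply/funext => ?]; rewrite /D23 /D12.
    by lmod_coefs C V; ring.
rewrite fg (iter_shift gD) add0r => /(congr1 (fun h => h 0 k l)).
by move=> h; exact: h.
Qed.

End FieldProducts.

(** * Reconstruction of a vertex algebra from generating fields *)

Section GoodFields.
Variables (R : realType) (V : lmodType R[i]) (vac : V) (T : {linear V -> V}).
Local Notation C := R[i].
Hypothesis T_vac : T vac = 0.
Implicit Types (a b F : int -> V -> V) (n m k : int) (u v w : V).

(** The conditions that the field of a state satisfies: it creates a state from
    the vacuum and commutes with translation as [d/dz]. *)
Record good F : Prop := Good {
  good_field : is_field F;
  good_vac : forall n, 0 <= n -> F n vac = 0;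
  good_T : forall n v, T (F n v) = F n (T v) - n%:~R *: F (n - 1) v }.

(** The field of the vacuum. *)
Definition idf : int -> V -> V := fun n v => if n == -1 then v else 0.

Lemma idf_field : is_field idf.
Proof.
split=> [n x u v|v]; rewrite /idf.
- by case: eqP => // _; rewrite scaler0 addr0.
- by exists 0%N => n n0; case: eqP => // e; lia.
Qed.

Lemma idf_good : good idf.
Proof.
split=> [|n n0|n v]; first exact: idf_field; rewrite /idf.
- by case: eqP => // e; lia.
- have [->|ne] := eqVneq n (-1); first by rewrite scaler0 subr0.
  rewrite linear0 sub0r; case: eqP => e; last by rewrite scaler0 oppr0.
  by rewrite (_ : n = 0) ?scale0r ?oppr0 //; lia.
Qed.

Lemma idf_loc b : is_field b -> loc idf b.
Proof.
move=> hb; apply: (@loc_from _ _ _ _ 0) => // [|m k v].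
  exact: idf_field.
rewrite Bk0 /idf; case: eqP => _; first by rewrite subrr.
by rewrite (fld0 _ hb) subr0.
Qed.

Lemma good_lincomb x a b F : good a -> good b ->
  (forall n v, F n v = x *: a n v + b n v) -> good F.
Proof.
move=> ha hb FE; split; [split|..] => [n y u v|v|n n0|n v].
- rewrite !FE (fld_lin (good_field ha)) (fld_lin (good_field hb)).
  by lmod_coefs C V; ring.
- have [N hN] := fld_trunc (good_field ha) v.
  have [N' hN'] := fld_trunc (good_field hb) v.
  by exists (maxn N N') => n hn; rewrite FE hN ?hN' ?scaler0 ?addr0 //; lia.
- by rewrite FE !good_vac // scaler0 addr0.
- rewrite !FE linearP !good_T //.
  by lmod_coefs C V; ring.
Qed.

(** The derivation [d/dz + d/dw] kills every power of [z - w]; on coefficients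
    this is the recursion [(j + 1) binz n (j + 1) = (n - j) binz n j]. *)
Lemma Pk_T a b n m k v : good a -> good b ->
  T (Pk a b n m k v) = Pk a b n m k (T v) - m%:~R *: Pk a b n (m - 1) k v
                       - k%:~R *: Pk a b n m (k - 1) v.
Proof.
move=> [ha _ aT] [hb _ bT].
rewrite /Pk (fs_lin (@linearP _ _ _ _ T)); last ev_field.
rewrite -fsZ; last ev_field.
rewrite -fsZ; last ev_field.
rewrite -[LHS]addr0.
pose c j : C := (-1) ^+ j * binz R n j.
have cS j : (j.+1)%:R * c j.+1 = - (n - j%:Z)%:~R * c j.
  by rewrite /c exprS mulrCA binzS_mul; ring.
have <- : fs (fun j => (j%:R * c j) *: a (n + m - j%:Z) (b (k - 1 + j%:Z) v))
  + fs (fun j => ((n - j%:Z)%:~R * c j) *: a (n + (m - 1) - j%:Z) (b (k + j%:Z) v))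
  = 0.
  rewrite fs_recl; last ev_field.
  rewrite mul0r scale0r add0r -fsD; [|ev_field..].
  apply: fs0 => j; rewrite cS.
  rewrite (_ : n + m - _ = n + (m - 1) - j%:Z); last by lia.
  rewrite (_ : k - 1 + _ = k + j%:Z); last by lia.
  by rewrite -scalerDl mulNr addNr scale0r.
have evT : ev0 (fun j => T (c j *: a (n + m - j%:Z) (b (k + j%:Z) v))).
  have [N hN] := Pk_ev (n + m) k v c ha hb.
  by exists N => j jN; rewrite hN ?linear0.
rewrite -fsD; [|ev_field..].
rewrite -fsD //; last by apply: ev0D; ev_field.
rewrite -fsB; [|ev_field..].
rewrite -fsB; [|by apply: ev0D; [|apply: ev0N]; ev_field|ev_field].
apply: eq_fs => j; rewrite linearZ /= aT bT (linB (fld_lin ha _)).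
rewrite (linZ (fld_lin ha _)) -/(c j).
rewrite (_ : n + m - j%:Z - 1 = n + (m - 1) - j%:Z); last by lia.
rewrite (_ : k + j%:Z - 1 = k - 1 + j%:Z); last by lia.
by lmod_coefs C V; ring.
Qed.

Lemma nprod_good n a b : good a -> good b -> good (nprod n a b).
Proof.
move=> ga gb; have [ha a0 aT] := ga; have [hb b0 bT] := gb.
split=> [|k k0|k v]; first exact: nprod_field.
- rewrite /nprod /Bk /Pk !fs0 ?scaler0 ?subrr // => j.
    by rewrite a0 ?(fld0 _ hb) ?scaler0 //; lia.
  by rewrite b0 ?(fld0 _ ha) ?scaler0 //; lia.
- rewrite /nprod /Bk linearB linearZ /= !Pk_T // !scale0r.
  by lmod_coefs C V; ring.
Qed.

Lemma nprod_state n a b : good a -> good b ->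
  nprod n a b (-1) vac = a n (b (-1) vac).
Proof.
move=> [ha a0 _] [hb b0 _]; rewrite /nprod /Bk /Pk fs1 => [|j].
  rewrite fs0 => [|j]; last by rewrite a0 ?(fld0 _ hb) ?scaler0 //; lia.
  by rewrite scaler0 subr0 binz0 mulr1 scale1r addr0 subr0 addr0.
by rewrite b0 ?(fld0 _ ha) ?scaler0 //; lia.
Qed.

End GoodFields.

Section Reconstruction.
Variables (R : realType) (V : lmodType R[i]) (vac : V) (T : {linear V -> V}).
Local Notation C := R[i].
Variables (I : Type) (gen : I -> int -> V -> V).
Hypothesis T_vac : T vac = 0.
Hypothesis gen_good : forall i, good vac T (gen i).
Hypothesis gen_loc : forall i j, loc (gen i) (gen j).
Hypothesis gen_span : forall P : V -> Prop,
  (forall x u v, P u -> P v -> P (x *: u + v)) -> P vac ->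
  (forall i n v, P v -> P (gen i n v)) -> forall v, P v.
Implicit Types (F : int -> V -> V) (n m k : int) (u v w : V).

(** Goddard's uniqueness: [F vac] vanishes by translation covariance, and
    locality moves [F] through the generators, down to the vacuum. *)
Lemma goddard0 F : good vac T F -> (forall i, loc F (gen i)) ->
  F (-1) vac = 0 -> forall n v, F n v = 0.
Proof.
move=> [hF F0 FT] Floc Fvac.
suff h v : forall n, F n v = 0 by move=> n v.
elim/gen_span: v => [x u v hu hv n|n|i k v hv].
- by rewrite (fld_lin hF) hu hv scaler0 addr0.
- have [n0|n0] := lerP 0 n; first exact: F0.
  have -> : n = - 1 - (absz (n + 1))%:Z by lia.
  elim: absz => [|d IH]; first by rewrite subr0.
  have := FT (-1 - d%:Z) vac; rewrite T_vac IH linear0 (fld0 _ hF) sub0r.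
  move/esym/eqP; rewrite oppr_eq0 scaler_eq0 intr_eq0 => /orP[/eqP e|/eqP <-].
    by lia.
  by congr (F _ _); lia.
- have hg := good_field (gen_good i).
  have [N hN] := Floc i; have [M hM] := fld_trunc hg v.
  have Pk_0 m l : Pk F (gen i) N%:Z m l v = 0.
    have := hN N%:Z m l v; rewrite lexx => /(_ isT).
    rewrite /Bk (_ : Pk (gen i) F _ _ _ _ = 0) ?scaler0 ?subr0 //.
    by apply: fs0 => j; rewrite hv (fld0 _ hg) scaler0.
  suff h d : forall l, M%:Z - d%:Z <= l -> forall n, F n (gen i l v) = 0.
    by apply: (h (absz (M%:Z - k))); lia.
  elim: d => [|d IH] l hl n.
    by rewrite hM ?(fld0 _ hF) //; lia.
  have := Pk_0 (n - N%:Z) l; rewrite /Pk fs1 => [|j].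
    by rewrite binz0 mulr1 scale1r subr0 addr0 (_ : N%:Z + _ = n) //; lia.
  by rewrite IH ?scaler0 //; lia.
Qed.

Lemma goddard F F' : good vac T F -> good vac T F' ->
  (forall i, loc F (gen i)) -> (forall i, loc F' (gen i)) ->
  F (-1) vac = F' (-1) vac -> forall n v, F n v = F' n v.
Proof.
move=> gF gF' lF lF' FF' n v.
pose D n v := (-1) *: F' n v + F n v.
have gD : good vac T D by apply: (good_lincomb gF' gF (x := -1)).
have lD i : loc D (gen i).
  apply: (loc_lincomb (c := D) (x := -1) _ _ _ _ (lF' i) (lF i)) => //.
  - exact: good_field gF'.
  - exact: good_field gF.
  - exact: good_field (gen_good i).
have := goddard0 gD lD _ n v; rewrite /D FF' scaleN1r addNr => /(_ erefl).
by rewrite scaleN1r addrC => /eqP; rewrite subr_eq0 => /eqP.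
Qed.

Definition state_field_spec v F :=
  [/\ good vac T F, forall i, loc F (gen i) & F (-1) vac = v].

(** The products of the generators with the fields already found produce a field
    for every state, and Dong's lemma keeps them local. *)
Lemma state_field_ex v : exists F, state_field_spec v F.
Proof.
elim/gen_span: v => [x u v [F [gF lF <-]] [G [gG lG <-]]||i n v [F [gF lF <-]]].
- exists (fun n v => x *: F n v + G n v); split=> //.
    exact: (good_lincomb gF gG).
  move=> i; apply: (loc_lincomb (x := x) _ _ _ _ (lF i) (lG i)) => //.
  - exact: good_field gF.
  - exact: good_field gG.
  - exact: good_field (gen_good i).
- exists (@idf R V); split=> // [|i]; first exact: idf_good.
  by apply: idf_loc; apply: good_field (gen_good i).
- exists (nprod n (gen i) F); split=> [|j|].
    exact: nprod_good (gen_good i) gF.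
    exact: (dong _ (good_field (gen_good i)) (good_field gF)
      (good_field (gen_good j)) (loc_sym (lF i)) (gen_loc i j) (lF j)).
  by rewrite (nprod_state _ (gen_good i) gF).
Qed.

Definition Y v : int -> V -> V := sval (cid (state_field_ex v)).

Lemma Y_spec v : state_field_spec v (Y v).
Proof. exact: (svalP (cid (state_field_ex v))). Qed.

Lemma Y_good v : good vac T (Y v). Proof. by case: (Y_spec v). Qed.
Lemma Y_field v : is_field (Y v). Proof. exact: good_field (Y_good v). Qed.
Lemma Y_loc_gen v i : loc (Y v) (gen i). Proof. by case: (Y_spec v). Qed.
Lemma Y_vacr v : Y v (-1) vac = v. Proof. by case: (Y_spec v). Qed.
Lemma gen_field i : is_field (gen i). Proof. exact: good_field (gen_good i). Qed.
Hint Resolve gen_field Y_good Y_field Y_loc_gen : core.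

Lemma Y_uniq F v : good vac T F -> (forall i, loc F (gen i)) ->
  F (-1) vac = v -> forall n u, Y v n u = F n u.
Proof. by move=> gF lF Fv; apply: goddard => //; rewrite Y_vacr. Qed.

Lemma Y_linear x u v n w : Y (x *: u + v) n w = x *: Y u n w + Y v n w.
Proof.
apply: (Y_uniq (F := fun n w => x *: Y u n w + Y v n w)) => [|i|].
- exact: (good_lincomb (Y_good u) (Y_good v)).
- by apply: (loc_lincomb (x := x) _ _ _ _ (Y_loc_gen u i) (Y_loc_gen v i)) => //.
- by rewrite !Y_vacr.
Qed.

Lemma Y_vacl n w : Y vac n w = idf n w.
Proof.
apply: Y_uniq; [exact: idf_good | | by []].
by move=> i; apply: idf_loc.
Qed.

Lemma Y_gen_vac i n w : Y (gen i (-1) vac) n w = gen i n w.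
Proof. exact: Y_uniq. Qed.

Lemma Y_gen i n u k w : Y (gen i n u) k w = nprod n (gen i) (Y u) k w.
Proof.
apply: Y_uniq => [|j|]; first exact: nprod_good.
  by apply: dong => //; exact: loc_sym.
by rewrite (nprod_state _ (gen_good i) (Y_good u)) Y_vacr.
Qed.

(** Locality with the generators is part of [Y_spec]; an induction on [u], with
    Dong's lemma for the products, extends it to all states. *)
Lemma Y_loc u v : loc (Y u) (Y v).
Proof.
elim/gen_span: u => [x u w hu hw||i n u hu].
- by apply: (loc_lincomb (a := Y u) (a' := Y w) (x := x)) => // *;
    rewrite Y_linear.
- have -> : Y vac = @idf R V.
    by apply/funext => n; apply/funext => w; rewrite Y_vacl.
  exact: idf_loc.
- have -> : Y (gen i n u) = nprod n (gen i) (Y u).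
    by apply/funext => k; apply/funext => w; rewrite Y_gen.
  by apply: dong => //; apply/loc_sym.
Qed.

(** The product of the fields of [u] and [v] creates [u_(n) v], hence is its
    field by uniqueness. *)
Lemma Y_prod u n v k w : Y (Y u n v) k w = nprod n (Y u) (Y v) k w.
Proof.
apply: Y_uniq => [|j|]; first exact: nprod_good.
  by apply: dong => //; apply: Y_loc.
by rewrite (nprod_state _ (Y_good u) (Y_good v)) Y_vacr.
Qed.

Lemma Y_opr_linear n u : linear (Y u n).
Proof. exact: fld_lin. Qed.

Lemma Y_opl_linear n v : linear (fun u => Y u n v).
Proof. by move=> x u w; rewrite Y_linear. Qed.

Lemma Y_local u v : exists N : int, forall n, N <= n -> Y u n v = 0.
Proof. by have [N hN] := fld_trunc (Y_field u) v; exists N. Qed.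

Lemma Y_vacr0 n u : 0 <= n -> Y u n vac = 0.
Proof. exact: good_vac. Qed.

Lemma Y_dE u : T u = Y u (-2) vac.
Proof.
rewrite -{1}(Y_vacr u) (good_T (Y_good u)) T_vac (fld0 _ (Y_field u)) sub0r.
by rewrite -scaleNr opprK scale1r.
Qed.

(** Both sides of the identity satisfy [X n (m + 1) k = X n m (k + 1) +
    X (n + 1) m k] and agree for [m = 0], where the identity describes the
    field of [a_(n) b]; they vanish for large [n]. A descending induction on
    [n] then makes them agree for every [m]. *)
Lemma Y_borcherds m n k a b c : borcherds (fun n a => Y a n) m n k a b c.
Proof.
pose S n m k := fs (fun j => binz R m j *: Y (Y a (n + j%:Z) b) (m + k - j%:Z) c).
suff SB : S n m k = Bk (Y a) (Y b) n m k c.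
  rewrite /borcherds !fsE -[LHS]/(S n m k) SB /Bk; congr (_ - _).
  rewrite -fsZ; last first.
    have ha := Y_field a; have hb := Y_field b; ev_field.
  apply: eq_fs => j; rewrite scalerA; congr (_ *: _).
  by rewrite expfzDr ?oppr_eq0 ?oner_eq0 // mulrCA mulrA.
have [N hN] := fld_trunc (Y_field a) b.
have [M hM] := Y_loc a b.
have S_ev n' (p : nat -> int) (g : nat -> C) :
    ev0 (fun j => g j *: Y (Y a (n' + j%:Z) b) (p j) c).
  exists (N + absz n')%N => j jN; rewrite hN; last by lia.
  by rewrite (lin0 (Y_opl_linear _ _)) scaler0.
have SD n' m' k' : S n' (m' + 1) k' = S n' m' (k' + 1) + S (n' + 1) m' k'.
  rewrite /S fs_recl; last refine (S_ev _ _ _).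
  rewrite [in RHS]fs_recl; last refine (S_ev _ _ _).
  rewrite !binz0 (_ : m' + 1 + k' = m' + (k' + 1)); last by lia.
  rewrite -[RHS]addrA; congr (_ + _); rewrite -fsD; first apply: eq_fs => j.
  - rewrite binz_pascal (_ : n' + 1 + j%:Z = n' + (j.+1)%:Z); last by lia.
    rewrite (_ : m' + k' - j%:Z = m' + (k' + 1) - (j.+1)%:Z); last by lia.
    by rewrite scalerDl.
  - exists (N + absz n')%N => j jN; rewrite hN; last by lia.
    by rewrite (lin0 (Y_opl_linear _ _)) scaler0.
  - refine (S_ev _ _ _).
have BD n' m' k' : Bk (Y a) (Y b) n' (m' + 1) k' c =
    Bk (Y a) (Y b) n' m' (k' + 1) c + Bk (Y a) (Y b) (n' + 1) m' k' c.
  by rewrite [in RHS]Bk_D // [RHS]addrC subrK.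
have S0 n' k' : S n' 0 k' = Bk (Y a) (Y b) n' 0 k' c.
  rewrite /S fs1 => [|j]; last by rewrite binz0S scale0r.
  by rewrite binz0 scale1r add0r subr0 addr0 Y_prod.
pose L := maxn N M.
suff h d : forall n, L%:Z - d%:Z <= n -> forall m k,
    S n m k = Bk (Y a) (Y b) n m k c.
  by apply: (h (absz (L%:Z - n))); lia.
elim: d => [|d IH] n' hn m' k'.
  rewrite hM; last by rewrite /L in hn; lia.
  apply: fs0 => j; rewrite hN; last by rewrite /L in hn; lia.
  by rewrite (lin0 (Y_opl_linear _ _)) scaler0.
case: m' => m'.
  elim: m' k' => [|m' IHm] k'; first exact: S0.
  by rewrite -addn1 PoszD SD BD IHm IH //; lia.
rewrite NegzE; elim: m'.+1 k' => [|m'' IHm] k'; first exact: S0.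
have e : - m''%:Z = - (m''.+1)%:Z + 1 by lia.
have := SD n' (- (m''.+1)%:Z) (k' - 1); rewrite -e IHm e BD subrK.
by rewrite (IH (n' + 1)); [move/addIr | lia].
Qed.

Definition reconstruct : vertexAlgebra R :=
  @VertexAlgebra R V vac (fun n a b => Y a n b) T Y_opr_linear Y_opl_linear
    Y_local Y_vacl Y_vacr0 Y_vacr Y_dE Y_borcherds.

End Reconstruction.

(** * The structure of a one-truncated vertex algebra *)

Section TruncatedIdentities.
Variables (R : realType) (W : oneTruncVA R).
Local Notation C := R[i].
Local Notation A := (ot_space W false).
Local Notation B := (ot_space W true).
Local Notation P := (@ot_prod R W).
Local Notation inj := (@ot_inj R W _).
Local Notation vac := (ot_vac W).
Local Notation d := (ot_d W).
Implicit Types (a b c : A) (x y z : B) (n m k : int).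

(** These five operations are [a_(-1) b], [x_(0) a], [x_(-1) a], [x_(1) y] and
    [x_(0) y]. The other three are expressed through them in [act_lact],
    [lmul_rmul] and [op_aa2]. *)
Definition mul a b : A := @ot_op R W false false false a b.
Definition act x a : A := @ot_op R W true false false x a.
Definition rmul x a : B := @ot_op R W true false true x a.
Definition pr x y : A := @ot_op R W true true false x y.
Definition br x y : B := @ot_op R W true true true x y.

Lemma prodE n i j (u : W i) (v : W j) :
  P n (inj u) (inj v) =
  if i%:Z + j%:Z - n - 1 == 0 then inj (ot_op false u v)
  else if i%:Z + j%:Z - n - 1 == 1 then inj (ot_op true u v) else 0.
Proof. exact: tprod_tinj (@ot_opr_linear R W) (@ot_opl_linear R W) _ _ _ _ _. Qed.

Lemma prod0l n u : P n 0 u = 0.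
Proof. exact: tprod0l (@ot_opl_linear R W) _ _. Qed.

Lemma prod0r n u : P n u 0 = 0.
Proof. exact: tprod0r (@ot_opr_linear R W) _ _. Qed.

Lemma prod_neg n i j (u : W i) (v : W j) :
  i%:Z + j%:Z - n - 1 < 0 -> P n (inj u) (inj v) = 0.
Proof. by move=> h; rewrite prodE; case: eqP => [|_]; [lia | case: eqP => //; lia]. Qed.

Lemma inj_inj i : injective (@ot_inj R W i).
Proof. by case: i => u v [h]. Qed.

Lemma inj0 i : @ot_inj R W i 0 = 0. Proof. by case: i. Qed.

Lemma inj_linear i : linear (@ot_inj R W i).
Proof.
by case: i => t u v; rewrite /ot_inj /tinj; congr pair;
  rewrite /= ?scaler0 ?addr0.
Qed.

Lemma P_aa a b : P (-1) (inj a) (inj b) = inj (mul a b).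
Proof. by rewrite prodE. Qed.
Lemma P_aa2 a b : P (-2) (inj a) (inj b) = inj (@ot_op R W false false true a b).
Proof. by rewrite prodE. Qed.
Lemma P_ax0 a x : P 0 (inj a) (inj x) = inj (@ot_op R W false true false a x).
Proof. by rewrite prodE. Qed.
Lemma P_ax a x : P (-1) (inj a) (inj x) = inj (@ot_op R W false true true a x).
Proof. by rewrite prodE. Qed.
Lemma P_xa0 x a : P 0 (inj x) (inj a) = inj (act x a).
Proof. by rewrite prodE. Qed.
Lemma P_xa x a : P (-1) (inj x) (inj a) = inj (rmul x a).
Proof. by rewrite prodE. Qed.
Lemma P_xx1 x y : P 1 (inj x) (inj y) = inj (pr x y).
Proof. by rewrite prodE. Qed.
Lemma P_xx0 x y : P 0 (inj x) (inj y) = inj (br x y).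
Proof. by rewrite prodE. Qed.

Definition PE := (P_aa, P_aa2, P_ax0, P_ax, P_xa0, P_xa, P_xx1, P_xx0).

Definition sum2 (T : nmodType) (N : nat) (F0 F1 : T) : T :=
  match N with 0%N => 0 | 1%N => F0 | _ => F0 + F1 end.

Lemma fs_sum2 (N : nat) (F : nat -> tsum W) : (N <= 2)%N ->
  (forall j, (N <= j)%N -> F j = 0) -> fs F = sum2 N (F 0%N) (F 1%N).
Proof.
move=> N2 F0; rewrite (fs_ord F0).
by case: N N2 F0 => [|[|[|//]]] _ _;
  rewrite ?big_ord0 ?big_ord1 // big_ord_recl big_ord1.
Qed.

(** The Borcherds identity cut off after [N1], [N2] and [N3] terms, at most
    two, where the remaining ones vanish because a binomial coefficient or a
    weight does. *)
Lemma borcherds2 m n k (N1 N2 N3 : nat) i j l (u : W i) (v : W j) (w : W l) :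
    [&& N1 <= 2, N2 <= 2 & N3 <= 2]%N ->
    [&& i%:Z + j%:Z - n - 1 <= 1, j%:Z + l%:Z - k - 1 <= 1,
        i%:Z + l%:Z - m - 1 <= 1 &
        i%:Z + j%:Z + l%:Z - m - n - k - 2 <= 1] ->
    (m == 0) && (0 < N1)%N || (i%:Z + j%:Z - n - N1%:Z - 1 < 0) ->
    (n == 0) && (0 < N2)%N || (j%:Z + l%:Z - k - N2%:Z - 1 < 0) ->
    (n == 0) && (0 < N3)%N || (i%:Z + l%:Z - m - N3%:Z - 1 < 0) ->
  sum2 N1 (P (m + k) (P n (inj u) (inj v)) (inj w))
    (m%:~R *: P (m + k - 1) (P (n + 1) (inj u) (inj v)) (inj w))
  = sum2 N2 (P (n + m) (inj u) (P k (inj v) (inj w)))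
      (- n%:~R *: P (n + m - 1) (inj u) (P (k + 1) (inj v) (inj w)))
  - sum2 N3 ((-1) ^ n *: P (n + k) (inj v) (P m (inj u) (inj w)))
      (- ((-1) ^ n * n%:~R) *:
         P (n + k - 1) (inj v) (P (m + 1) (inj u) (inj w))) :> tsum W.
Proof.
move=> /and3P[N12 N22 N32] /and4P[h1 h2 h3 h4] g1 g2 g3.
have := ot_borcherds u v w h1 h2 h3 h4; rewrite /borcherds !fsE.
rewrite (fs_sum2 N12) => [|t tN]; last first.
  case/orP: g1 => [/andP[/eqP -> N10]|g1].
    by case: t tN => [|t _]; [case: (N1) N10 | rewrite binz0S scale0r].
  by rewrite prod_neg ?prod0l ?scaler0 //; lia.
rewrite (fs_sum2 N22) => [|t tN]; last first.
  case/orP: g2 => [/andP[/eqP -> N20]|g2].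
    by case: t tN => [|t _]; [case: (N2) N20 | rewrite binz0S mulr0 scale0r].
  by rewrite [P (k + _) _ _]prod_neg ?prod0r ?scaler0 //; lia.
rewrite (fs_sum2 N32) => [|t tN]; last first.
  case/orP: g3 => [/andP[/eqP -> N30]|g3].
    by case: t tN => [|t _]; [case: (N3) N30 | rewrite binz0S mulr0 scale0r].
  by rewrite [P (m + _) _ _]prod_neg ?prod0r ?scaler0 //; lia.
rewrite !binz0 !binz1 !expr0 !expr1 !mulr1 !scale1r !mulN1r !subr0 add0r.
have -> : (-1) ^ (1 + n) = - (-1) ^ n :> C.
  by rewrite addrC expfzDr ?oppr_eq0 ?oner_eq0 // expr1z mulrN1.
by rewrite !mulNr.
Qed.

Lemma signN1 : (-1) ^ (-1) = -1 :> C.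
Proof. by rewrite -[LHS]/((-1)^-1) invrN1. Qed.

Lemma signN2 : (-1) ^ (-2) = 1 :> C.
Proof. by rewrite -[LHS]/(((-1) ^+ 2)^-1) sqrrN expr1n invr1. Qed.

Ltac zsimp := rewrite ?(mulr0z, mulr1z, mulrN1z, expr0z, expr1z, signN1, signN2,
  scale0r, scale1r, scaleN1r, mulN1r, mulr1, mul1r, opprK, oppr0, subr0, add0r,
  addr0, sub0r, scaler0, prod0l, prod0r).

Lemma injD i (u v : W i) : inj u + inj v = inj (u + v).
Proof. by rewrite (linD (@inj_linear i)). Qed.
Lemma injN i (u : W i) : - inj u = inj (- u).
Proof. by rewrite (linN (@inj_linear i)). Qed.
Lemma injZ i t (u : W i) : t *: inj u = inj (t *: u).
Proof. by rewrite (linZ (@inj_linear i)). Qed.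

Lemma mula1 a : mul a vac = a.
Proof. by apply: inj_inj; rewrite -P_aa ot_vacr. Qed.
Lemma mul1a a : mul vac a = a.
Proof. by apply: inj_inj; rewrite -P_aa ot_vacl. Qed.
Lemma rmul1 x : rmul x vac = x.
Proof. by apply: inj_inj; rewrite -P_xa ot_vacr. Qed.
Lemma act1 x : act x vac = 0.
Proof. by apply: inj_inj; rewrite -P_xa0 ot_vacr0 // inj0. Qed.
Lemma opd a : @ot_op R W false false true a vac = d a.
Proof. by apply: inj_inj; rewrite -P_aa2 ot_dE. Qed.
Lemma rmulx0 x : rmul x 0 = 0.
Proof. exact: (lin0 (@ot_opr_linear R W _ _ _ x)). Qed.
Lemma mula0 a : mul a 0 = 0.
Proof. exact: (lin0 (@ot_opr_linear R W _ _ _ a)). Qed.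
Lemma actx0 x : act x 0 = 0.
Proof. exact: (lin0 (@ot_opr_linear R W _ _ _ x)). Qed.
Lemma op_a0 a : @ot_op R W false false true a 0 = 0.
Proof. exact: (lin0 (@ot_opr_linear R W _ _ _ a)). Qed.
Definition V1 := (rmulx0, actx0, mula0, op_a0, mula1, mul1a, rmul1, act1, opd, inj0).

Ltac inject := rewrite !(PE, V1); zsimp;
  rewrite ?(injZ, injN, injD, V1); zsimp; rewrite ?(injZ, injN, injD); zsimp.

Lemma mul_linear_r a : linear (mul a). Proof. exact: ot_opr_linear. Qed.
Lemma mul_linear_l b : linear (mul^~ b). Proof. exact: ot_opl_linear. Qed.
Lemma act_linear_r x : linear (act x). Proof. exact: ot_opr_linear. Qed.
Lemma act_linear_l a : linear (act^~ a). Proof. exact: ot_opl_linear. Qed.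
Lemma rmul_linear_r x : linear (rmul x). Proof. exact: ot_opr_linear. Qed.
Lemma rmul_linear_l a : linear (rmul^~ a). Proof. exact: ot_opl_linear. Qed.
Lemma pr_linear_r x : linear (pr x). Proof. exact: ot_opr_linear. Qed.
Lemma pr_linear_l y : linear (pr^~ y). Proof. exact: ot_opl_linear. Qed.
Lemma br_linear_r x : linear (br x). Proof. exact: ot_opr_linear. Qed.
Lemma br_linear_l y : linear (br^~ y). Proof. exact: ot_opl_linear. Qed.

Lemma brN x y : br y x = d (pr x y) - br x y.
Proof.
have : P (-1) (P 0 (inj x) (inj y)) (inj vac)
    + (-1)%:~R *: P (-2) (P 1 (inj x) (inj y)) (inj vac)
  = P (-1) (inj x) (P 0 (inj y) (inj vac))
    - (-1) ^ 0 *: P 0 (inj y) (P (-1) (inj x) (inj vac)).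
  exact: (@borcherds2 (-1) 0 0 2 1 1 _ _ _ x y vac isT isT isT isT isT).
by inject => /inj_inj/(congr1 -%R); rewrite opprB opprK.
Qed.

Lemma prC x y : pr x y = pr y x.
Proof.
have : P (-1) (P 1 (inj x) (inj y)) (inj vac)
  = P 0 (inj x) (P 0 (inj y) (inj vac))
    - ((-1) ^ 1 *: P 1 (inj y) (P (-1) (inj x) (inj vac))
       + (- ((-1) ^ 1 * 1%:~R)) *: P 0 (inj y) (P 0 (inj x) (inj vac))).
  exact: (@borcherds2 (-1) 1 0 1 1 2 _ _ _ x y vac isT isT isT isT isT).
by inject => /inj_inj.
Qed.

Lemma act_lact a x : @ot_op R W false true false a x = - act x a.
Proof.
have : P (-1) (P 0 (inj a) (inj x)) (inj vac)
  = P (-1) (inj a) (P 0 (inj x) (inj vac))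
   - (-1) ^ 0 *: P 0 (inj x) (P (-1) (inj a) (inj vac)).
  exact: (@borcherds2 (-1) 0 0 1 1 1 _ _ _ a x vac isT isT isT isT isT).
by inject => /inj_inj.
Qed.

Lemma lmul_rmul a x : @ot_op R W false true true a x = rmul x a - d (act x a).
Proof.
have : P (-1) (P (-1) (inj x) (inj a)) (inj vac)
     + (-1)%:~R *: P (-2) (P 0 (inj x) (inj a)) (inj vac)
  = 0 - ((-1) ^ (-1) *: P (-1) (inj a) (P (-1) (inj x) (inj vac))
     + (- ((-1) ^ (-1) * (-1)%:~R)) *: P (-2) (inj a) (P 0 (inj x) (inj vac))).
  exact: (@borcherds2 (-1) (-1) 0 2 0 2 _ _ _ x a vac isT isT isT isT isT).
by inject => /inj_inj ->.
Qed.

Lemma op_aa2 a b : @ot_op R W false false true a b = rmul (d a) b.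
Proof.
have : P (-1) (P (-2) (inj a) (inj vac)) (inj b)
  = P (-2) (inj a) (P (-1) (inj vac) (inj b)) - 0.
  exact: (@borcherds2 0 (-2) (-1) 1 1 0 _ _ _ a vac b isT isT isT isT isT).
by inject => /inj_inj ->.
Qed.

Lemma br_jacobi x y z : br (br x y) z = br x (br y z) - br y (br x z).
Proof.
have : P 0 (P 0 (inj x) (inj y)) (inj z) = P 0 (inj x) (P 0 (inj y) (inj z))
   - (-1) ^ 0 *: P 0 (inj y) (P 0 (inj x) (inj z)).
  exact: (@borcherds2 0 0 0 1 1 1 _ _ _ x y z isT isT isT isT isT).
by inject => /inj_inj.
Qed.

Lemma pr_inv x y z : pr (br x y) z = act x (pr y z) - pr y (br x z).
Proof.
have : P 1 (P 0 (inj x) (inj y)) (inj z) = P 0 (inj x) (P 1 (inj y) (inj z))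
   - (-1) ^ 0 *: P 1 (inj y) (P 0 (inj x) (inj z)).
  exact: (@borcherds2 0 0 1 1 1 1 _ _ _ x y z isT isT isT isT isT).
by inject => /inj_inj.
Qed.

Lemma pr_d a x : pr (d a) x = act x a.
Proof.
have : P 1 (P (-2) (inj a) (inj vac)) (inj x)
   = 0 - (-1) ^ (-2) *: P (-1) (inj vac) (P 0 (inj a) (inj x)).
  exact: (@borcherds2 0 (-2) 1 1 0 1 _ _ _ a vac x isT isT isT isT isT).
rewrite P_ax0 ot_vacl eqxx; inject => /inj_inj ->.
by rewrite act_lact opprK.
Qed.

(** Two instances of the invariance of [pr] under [br], combined through the
    skew-symmetry of [br]. *)
Lemma act_pr x y z : act y (pr x z) =
  act z (pr x y) - act x (pr y z) + pr y (br x z) + pr x (br y z).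
Proof.
have := pr_inv y x z; rewrite (brN x y) (linB (pr_linear_l _)) pr_d pr_inv.
by move=> e1; rewrite -[LHS](subrK (pr x (br y z))) -e1 opprB
  [pr y _ - _]addrC addrA.
Qed.

Lemma br_x_d x a : br x (d a) = d (act x a).
Proof.
have : P (-2) (P 0 (inj x) (inj a)) (inj vac)
   = P 0 (inj x) (P (-2) (inj a) (inj vac))
     - (-1) ^ 0 *: P (-2) (inj a) (P 0 (inj x) (inj vac)).
  exact: (@borcherds2 0 0 (-2) 1 1 1 _ _ _ x a vac isT isT isT isT isT).
by inject => /inj_inj.
Qed.

Lemma br_d_x a x : br (d a) x = 0.
Proof. by rewrite brN prC pr_d br_x_d subrr. Qed.

Lemma act_br x y a : act (br x y) a = act x (act y a) - act y (act x a).
Proof.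
have : P 0 (P 0 (inj x) (inj y)) (inj a) = P 0 (inj x) (P 0 (inj y) (inj a))
   - (-1) ^ 0 *: P 0 (inj y) (P 0 (inj x) (inj a)).
  exact: (@borcherds2 0 0 0 1 1 1 _ _ _ x y a isT isT isT isT isT).
by inject => /inj_inj.
Qed.

Lemma act_mul x a b : act x (mul a b) = mul (act x a) b + mul a (act x b).
Proof.
have : P (-1) (P 0 (inj x) (inj a)) (inj b)
   = P 0 (inj x) (P (-1) (inj a) (inj b))
   - (-1) ^ 0 *: P (-1) (inj a) (P 0 (inj x) (inj b)).
  exact: (@borcherds2 0 0 (-1) 1 1 1 _ _ _ x a b isT isT isT isT isT).
by inject => /inj_inj ->; rewrite subrK.
Qed.

Lemma mulC a b : mul a b = mul b a.
Proof.
have : P (-1) (P (-1) (inj a) (inj b)) (inj vac)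
  = 0 - (-1) ^ (-1) *: P (-1) (inj b) (P (-1) (inj a) (inj vac)).
  exact: (@borcherds2 (-1) (-1) 0 1 0 1 _ _ _ a b vac isT isT isT isT isT).
by inject => /inj_inj.
Qed.

Lemma mulCA a b c : mul a (mul b c) = mul b (mul a c).
Proof.
have : 0 = P (-1) (inj a) (P (-1) (inj b) (inj c))
   - (-1) ^ 0 *: P (-1) (inj b) (P (-1) (inj a) (inj c)).
  exact: (@borcherds2 (-1) 0 (-1) 0 1 1 _ _ _ a b c isT isT isT isT isT).
inject; rewrite -(inj0 false) => /inj_inj/esym/eqP.
by rewrite subr_eq0 => /eqP.
Qed.

Lemma act_d a b : act (d a) b = 0.
Proof.
have : P 0 (P (-2) (inj a) (inj vac)) (inj b) = 0 - 0.
  exact: (@borcherds2 0 (-2) 0 1 0 0 _ _ _ a vac b isT isT isT isT isT).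
by inject; rewrite -(inj0 false) => /inj_inj.
Qed.

Lemma br_rmul y x a : rmul (br y x) a = br y (rmul x a) - rmul x (act y a).
Proof.
have : P (-1) (P 0 (inj y) (inj x)) (inj a)
   = P 0 (inj y) (P (-1) (inj x) (inj a))
   - (-1) ^ 0 *: P (-1) (inj x) (P 0 (inj y) (inj a)).
  exact: (@borcherds2 0 0 (-1) 1 1 1 _ _ _ y x a isT isT isT isT isT).
by inject => /inj_inj.
Qed.

Lemma pr_rmul y x a : pr y (rmul x a) = act (br y x) a + mul (pr y x) a.
Proof.
have : P 0 (P 0 (inj y) (inj x)) (inj a)
     + 1%:~R *: P (-1) (P 1 (inj y) (inj x)) (inj a)
   = P 1 (inj y) (P (-1) (inj x) (inj a)) - 0.
  exact: (@borcherds2 1 0 (-1) 2 1 0 _ _ _ y x a isT isT isT isT isT).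
by inject => /inj_inj.
Qed.

Lemma rmul_act x a b : act (rmul x a) b = mul a (act x b).
Proof.
have : P 0 (P (-1) (inj x) (inj a)) (inj b)
   = 0 - (-1) ^ (-1) *: P (-1) (inj a) (P 0 (inj x) (inj b)).
  exact: (@borcherds2 0 (-1) 0 1 0 1 _ _ _ x a b isT isT isT isT isT).
by inject => /inj_inj.
Qed.

Lemma rmul_rmul x a b : rmul (rmul x a) b = rmul x (mul a b) + rmul (d a) (act x b).
Proof.
have : P (-1) (P (-1) (inj x) (inj a)) (inj b)
   = P (-1) (inj x) (P (-1) (inj a) (inj b))
   - (-1) ^ (-1) *: P (-2) (inj a) (P 0 (inj x) (inj b)).
  exact: (@borcherds2 0 (-1) (-1) 1 1 1 _ _ _ x a b isT isT isT isT isT).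
by inject => /inj_inj ->; rewrite op_aa2.
Qed.

Lemma d_mul a b : d (mul a b) = rmul (d a) b + rmul (d b) a.
Proof.
have := @ot_deriv R W (-1) a b isT.
rewrite P_aa -[(inj (mul a b)).1]/(mul a b) !PE injD => /inj_inj ->.
by rewrite lmul_rmul act_d linear0 subr0.
Qed.

End TruncatedIdentities.

(** * The envelope by generators and relations *)

Local Open Scope quotient_scope.

Section EnvelopeAlgebras.
Variables (R : realType) (W : oneTruncVA R).
Local Notation C := R[i].
Local Notation A := (ot_space W false).
Local Notation B := (ot_space W true).
Local Notation vac := (ot_vac W).
Local Notation d := (ot_d W).

(** The ratio [k / (k + l)] of the modes [k = - p - 1] and [l = - q - 1]. *)
Definition kap (p q : nat) : C := p.+1%:R / (p + q).+2%:R.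

(** The commutator [[x_(k), y_(l)] = (x_(0) y)_(k + l) + k (x_(1) y)_(k + l - 1)]
    has only one term when [k + l <> 0], because
    [(d a)_(k + l) = - (k + l) a_(k + l - 1)]. *)
Definition brk p q (x y : B) : B := br x y - kap p q *: d (pr x y).

(** In an envelope of [W], [b a] is the state of [a] in weight zero, [X p x] is
    the mode [x_(- p - 1)] and [T] is the translation. The relations [walg_XX] and
    [walg_TX] are the commutators; [walg_XA] and [walg_TA] identify the products
    that already have a value in [W]. Modes [x_(n)] with [n >= 0] are not among the generators: they
    are determined by their action on the states of weight zero. The predicate
    [Q] restricts the relations to an invariant subspace. *)
Record is_walg (M : lmodType C) (Q : M -> Prop) (b : A -> M)
    (X : nat -> B -> M -> M) (T : M -> M) : Prop := IsWalg {
  walg_Q_lin : forall c u v, Q u -> Q v -> Q (c *: u + v);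
  walg_Q_base : forall a, Q (b a);
  walg_Q_X : forall p x s, Q s -> Q (X p x s);
  walg_Q_T : forall s, Q s -> Q (T s);
  walg_base_linear : linear b;
  walg_appl_linear : forall p s, Q s -> linear (fun x => X p x s);
  walg_appr_linear : forall p x, linear (X p x);
  walg_T_linear : linear T;
  walg_XX : forall p q x y s, Q s ->
    X p x (X q y s) = X q y (X p x s) + X (p + q).+1 (brk p q x y) s;
  walg_TX : forall p x s, Q s ->
    T (X p x s) = X p x (T s) + p.+1%:R *: X p.+1 x s;
  walg_XA : forall x a, X 0%N x (b a) = X 0%N (rmul x a) (b vac);
  walg_TA : forall a, T (b a) = X 0%N (d a) (b vac) }.

Inductive term :=
  TZero | TAdd of term & term | TScale of C & term
| TBase of A | TApp of nat & B & term | TT of term.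

Inductive eqv : term -> term -> Prop :=
| eqv_refl s : eqv s s
| eqv_sym s t : eqv s t -> eqv t s
| eqv_trans s t u : eqv s t -> eqv t u -> eqv s u
| eqv_add s s' t t' : eqv s s' -> eqv t t' -> eqv (TAdd s t) (TAdd s' t')
| eqv_scale c s s' : eqv s s' -> eqv (TScale c s) (TScale c s')
| eqv_app p x s s' : eqv s s' -> eqv (TApp p x s) (TApp p x s')
| eqv_T s s' : eqv s s' -> eqv (TT s) (TT s')
| eqv_addA s t u : eqv (TAdd s (TAdd t u)) (TAdd (TAdd s t) u)
| eqv_addC s t : eqv (TAdd s t) (TAdd t s)
| eqv_add0 s : eqv (TAdd TZero s) s
| eqv_addN s : eqv (TAdd (TScale (-1) s) s) TZero
| eqv_scaleA c e s : eqv (TScale c (TScale e s)) (TScale (c * e) s)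
| eqv_scale1 s : eqv (TScale 1 s) s
| eqv_scaleDr c s t :
    eqv (TScale c (TAdd s t)) (TAdd (TScale c s) (TScale c t))
| eqv_scaleDl c e s : eqv (TScale (c + e) s) (TAdd (TScale c s) (TScale e s))
| eqv_baseL c a b : eqv (TBase (c *: a + b)) (TAdd (TScale c (TBase a)) (TBase b))
| eqv_appLl p c x y s :
    eqv (TApp p (c *: x + y) s) (TAdd (TScale c (TApp p x s)) (TApp p y s))
| eqv_appLr p c x s t :
    eqv (TApp p x (TAdd (TScale c s) t)) (TAdd (TScale c (TApp p x s)) (TApp p x t))
| eqv_TL c s t : eqv (TT (TAdd (TScale c s) t)) (TAdd (TScale c (TT s)) (TT t))
| eqv_XX p q x y s : eqv (TApp p x (TApp q y s))
    (TAdd (TApp q y (TApp p x s)) (TApp (p + q).+1 (brk p q x y) s))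
| eqv_TX p x s : eqv (TT (TApp p x s))
    (TAdd (TApp p x (TT s)) (TScale p.+1%:R (TApp p.+1 x s)))
| eqv_XA x a : eqv (TApp 0 x (TBase a)) (TApp 0 (rmul x a) (TBase vac))
| eqv_TA a : eqv (TT (TBase a)) (TApp 0 (d a) (TBase vac)).

HB.instance Definition _ := gen_eqMixin term.
HB.instance Definition _ := gen_choiceMixin term.

Definition eqvb (s t : term) : bool := `[< eqv s t >].

Lemma eqvb_refl : reflexive eqvb.
Proof. by move=> s; apply/asboolP; exact: eqv_refl. Qed.
Lemma eqvb_sym : symmetric eqvb.
Proof. by move=> s t; apply/asboolP/asboolP; exact: eqv_sym. Qed.
Lemma eqvb_trans : transitive eqvb.
Proof. by move=> t s u /asboolP st /asboolP tu; apply/asboolP/(eqv_trans st). Qed.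

Canonical eqv_equiv := EquivRel eqvb eqvb_refl eqvb_sym eqvb_trans.

Definition env := {eq_quot eqv_equiv}.
HB.instance Definition _ := Choice.on env.
HB.instance Definition _ := EqQuotient.on env.

Definition cls (t : term) : env := (\pi_env t)%qT.

Lemma clsP s t : cls s = cls t <-> eqv s t.
Proof.
split=> [/eqmodP/asboolP //|h].
by apply/eqmodP/asboolP.
Qed.

Lemma cls_repr (v : env) : cls (repr v) = v.
Proof. exact: reprK. Qed.

Lemma repr_cls t : eqv (repr (cls t)) t.
Proof. by apply/clsP; rewrite cls_repr. Qed.

Lemma clsW (P : env -> Prop) : (forall t, P (cls t)) -> forall v, P v.
Proof. by move=> h v; rewrite -(cls_repr v). Qed.

Definition env_add (u v : env) := cls (TAdd (repr u) (repr v)).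
Definition env_opp (u : env) := cls (TScale (-1) (repr u)).
Definition env_scale (c : C) (u : env) := cls (TScale c (repr u)).

Lemma cls_add s t : cls (TAdd s t) = env_add (cls s) (cls t).
Proof. by apply/clsP/eqv_sym/eqv_add; exact: repr_cls. Qed.
Lemma cls_scale c s : cls (TScale c s) = env_scale c (cls s).
Proof. by apply/clsP/eqv_sym/eqv_scale; exact: repr_cls. Qed.
Lemma cls_opp s : cls (TScale (-1) s) = env_opp (cls s).
Proof. exact: cls_scale. Qed.

Lemma env_addA : associative env_add.
Proof.
elim/clsW=> s; elim/clsW=> t; elim/clsW=> u.
by rewrite -!cls_add; apply/clsP; exact: eqv_addA.
Qed.
Lemma env_addC : commutative env_add.
Proof.
by elim/clsW=> s; elim/clsW=> t; rewrite -!cls_add; apply/clsP; exact: eqv_addC.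
Qed.
Lemma env_add0 : left_id (cls TZero) env_add.
Proof. by elim/clsW=> s; rewrite -cls_add; apply/clsP; exact: eqv_add0. Qed.
Lemma env_addN : left_inverse (cls TZero) env_opp env_add.
Proof.
by elim/clsW=> s; rewrite -cls_opp -cls_add; apply/clsP; exact: eqv_addN.
Qed.

HB.instance Definition _ :=
  GRing.isZmodule.Build env env_addA env_addC env_add0 env_addN.

Lemma env_scaleA c e v : env_scale c (env_scale e v) = env_scale (c * e) v.
Proof. by elim/clsW: v=> s; rewrite -!cls_scale; apply/clsP; exact: eqv_scaleA. Qed.
Lemma env_scale1 : left_id 1 env_scale.
Proof. by elim/clsW=> s; rewrite -cls_scale; apply/clsP; exact: eqv_scale1. Qed.
Lemma env_scaleDr : right_distributive env_scale +%R.
Proof.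
move=> c; elim/clsW=> s; elim/clsW=> t.
rewrite -[LHS]/(env_scale c (env_add _ _)) -[RHS]/(env_add _ _).
by rewrite -cls_add -!cls_scale -cls_add; apply/clsP; exact: eqv_scaleDr.
Qed.
Lemma env_scaleDl v : {morph env_scale^~ v : c e / c + e}.
Proof.
elim/clsW: v=> s c e; rewrite -[RHS]/(env_add _ _).
by rewrite -!cls_scale -cls_add; apply/clsP; exact: eqv_scaleDl.
Qed.

HB.instance Definition _ := GRing.Zmodule_isLmodule.Build C env
  env_scaleA env_scale1 env_scaleDr env_scaleDl.

Definition base (a : A) : env := cls (TBase a).
Definition X (p : nat) (x : B) (v : env) : env := cls (TApp p x (repr v)).
Definition T (v : env) : env := cls (TT (repr v)).

Lemma clsD s t : cls (TAdd s t) = cls s + cls t.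
Proof. exact: cls_add. Qed.
Lemma clsZ c s : cls (TScale c s) = c *: cls s.
Proof. exact: cls_scale. Qed.
Lemma clsX p x s : cls (TApp p x s) = X p x (cls s).
Proof. by apply/clsP/eqv_sym/eqv_app; exact: repr_cls. Qed.
Lemma clsT s : cls (TT s) = T (cls s).
Proof. by apply/clsP/eqv_sym/eqv_T; exact: repr_cls. Qed.

Definition clsE := (clsD, clsZ, clsX, clsT).

Lemma env_walg : is_walg (fun=> True) base X T.
Proof.
split=> //.
- by move=> c a b; have /clsP := eqv_baseL c a b; rewrite !clsE.
- move=> p s _ c x y; elim/clsW: s => s.
  by have /clsP := eqv_appLl p c x y s; rewrite !clsE.
- move=> p x c; elim/clsW=> s; elim/clsW=> t.
  by have /clsP := eqv_appLr p c x s t; rewrite !clsE.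
- move=> c; elim/clsW=> s; elim/clsW=> t.
  by have /clsP := eqv_TL c s t; rewrite !clsE.
- move=> p q x y; elim/clsW=> s _.
  by have /clsP := eqv_XX p q x y s; rewrite !clsE.
- move=> p x; elim/clsW=> s _.
  by have /clsP := eqv_TX p x s; rewrite !clsE.
- by move=> x a; have /clsP := eqv_XA x a; rewrite !clsE.
- by move=> a; have /clsP := eqv_TA a; rewrite !clsE.
Qed.

Lemma env_ind (P : env -> Prop) :
  (forall c u v, P u -> P v -> P (c *: u + v)) ->
  (forall a, P (base a)) -> (forall p x v, P v -> P (X p x v)) ->
  (forall v, P v -> P (T v)) -> forall v, P v.
Proof.
move=> hL hb hX hT; elim/clsW; elim=> [|s hs t ht|c s hs|a|p x s hs|s hs].
- by have := hL (-1) _ _ (hb 0) (hb 0); rewrite scaleN1r addNr.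
- by rewrite clsD -[cls s]scale1r; exact: hL.
- have h0 : P 0 by have := hL (-1) _ _ (hb 0) (hb 0); rewrite scaleN1r addNr.
  by rewrite clsZ -[_ *: _]addr0; exact: hL.
- exact: hb.
- by rewrite clsX; exact: hX.
- by rewrite clsT; exact: hT.
Qed.

Section Recursor.
Variables (M : lmodType C) (Q : M -> Prop) (b : A -> M) (Y : nat -> B -> M -> M) (S : M -> M).
Hypothesis hM : is_walg Q b Y S.

Fixpoint eval_term (t : term) : M :=
  match t with
  | TZero => 0
  | TAdd s t => eval_term s + eval_term t
  | TScale c s => c *: eval_term s
  | TBase a => b a
  | TApp p x s => Y p x (eval_term s)
  | TT s => S (eval_term s)
  end.

Lemma eval_Q t : Q (eval_term t).
Proof.
have Q0 : Q 0.
  have := walg_Q_lin hM (-1) (walg_Q_base hM 0) (walg_Q_base hM 0).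
  by rewrite scaleN1r addNr.
elim: t => //= [s hs t ht|c s hs|a|p x s hs|s hs].
- by rewrite -[eval_term s]scale1r; exact: (walg_Q_lin hM).
- by rewrite -[_ *: _]addr0; exact: (walg_Q_lin hM).
- exact: (walg_Q_base hM).
- exact: (walg_Q_X hM).
- exact: (walg_Q_T hM).
Qed.

Lemma eval_eqv s t : eqv s t -> eval_term s = eval_term t.
Proof.
elim=> {s t} //=.
- by move=> s t u _ -> _ ->.
- by move=> s s' t t' _ -> _ ->.
- by move=> c s s' _ ->.
- by move=> p x s s' _ ->.
- by move=> s s' _ ->.
- by move=> s t u; rewrite addrA.
- by move=> s t; rewrite addrC.
- by move=> s; rewrite add0r.
- by move=> s; rewrite scaleN1r addNr.
- by move=> c e s; rewrite scalerA.
- by move=> s; rewrite scale1r.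
- by move=> c s t; rewrite scalerDr.
- by move=> c e s; rewrite scalerDl.
- by move=> c a a'; exact: (walg_base_linear hM).
- by move=> p c x y s; apply: (walg_appl_linear hM); exact: eval_Q.
- by move=> p c x s t; exact: (walg_appr_linear hM).
- by move=> c s t; exact: (walg_T_linear hM).
- by move=> p q x y s; apply: (walg_XX hM); exact: eval_Q.
- by move=> p x s; apply: (walg_TX hM); exact: eval_Q.
- by move=> x a; exact: (walg_XA hM).
- by move=> a; exact: (walg_TA hM).
Qed.

Definition env_rec (v : env) : M := eval_term (repr v).

Lemma env_rec_cls t : env_rec (cls t) = eval_term t.
Proof. exact/eval_eqv/repr_cls. Qed.

Lemma env_rec_linear : linear env_rec.
Proof.
move=> c; elim/clsW=> s; elim/clsW=> t.
by have := env_rec_cls (TAdd (TScale c s) t); rewrite !clsE /= !env_rec_cls.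
Qed.

Lemma env_rec_base a : env_rec (base a) = b a.
Proof. exact: env_rec_cls. Qed.

Lemma env_rec_X p x v : env_rec (X p x v) = Y p x (env_rec v).
Proof. by elim/clsW: v => s; rewrite -clsX !env_rec_cls. Qed.

Lemma env_rec_T v : env_rec (T v) = S (env_rec v).
Proof. by elim/clsW: v => s; rewrite -clsT !env_rec_cls. Qed.

End Recursor.

(** The universal property of [env]. *)
Record envelope := Envelope {
  ev_space :> lmodType C;
  ev_base : A -> ev_space;
  ev_X : nat -> B -> ev_space -> ev_space;
  ev_T : ev_space -> ev_space;
  ev_walg : is_walg (fun=> True) ev_base ev_X ev_T;
  ev_ind : forall P : ev_space -> Prop,
    (forall c u v, P u -> P v -> P (c *: u + v)) ->
    (forall a, P (ev_base a)) -> (forall p x v, P v -> P (ev_X p x v)) ->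
    (forall v, P v -> P (ev_T v)) -> forall v, P v;
  ev_rec : forall (M : lmodType C) (Q : M -> Prop) b Y S, is_walg Q b Y S ->
    {f : ev_space -> M | [/\ linear f, forall v, Q (f v),
       forall a, f (ev_base a) = b a, forall p x v, f (ev_X p x v) = Y p x (f v)
       & forall v, f (ev_T v) = S (f v)]} }.

Definition the_envelope : envelope.
Proof.
apply: (Envelope env_walg env_ind) => M Q b Y S hM.
exists (env_rec b Y S); split.
- exact: env_rec_linear hM.
- by elim/clsW=> t; rewrite (env_rec_cls hM); exact: eval_Q hM _.
- exact: env_rec_base hM.
- exact: env_rec_X hM.
- exact: env_rec_T hM.
Qed.

End EnvelopeAlgebras.

(** * Mode operators on the envelope *)

Section ModeSpace.
Variables (R : realType) (W : oneTruncVA R) (V : envelope W).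
Local Notation C := R[i].
Local Notation A := (ot_space W false).
Local Notation B := (ot_space W true).
Local Notation vac := (ot_vac W).
Local Notation d := (ot_d W).
Local Notation base := (@ev_base R W V).
Local Notation X := (@ev_X R W V).
Local Notation T := (@ev_T R W V).
Implicit Types (a b : A) (x y z : B) (n m k : int) (p q : nat) (v : V).

Lemma base_lin : linear base. Proof. exact: walg_base_linear (ev_walg V). Qed.
Lemma X_linl p v : linear (fun x => X p x v).
Proof. exact: (walg_appl_linear (ev_walg V)). Qed.
Lemma X_linr p x : linear (X p x). Proof. exact: (walg_appr_linear (ev_walg V)). Qed.
Lemma T_lin : linear T. Proof. exact: (walg_T_linear (ev_walg V)). Qed.
Lemma X_X p q x y v :
  X p x (X q y v) = X q y (X p x v) + X (p + q).+1 (brk p q x y) v.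
Proof. exact: (walg_XX (ev_walg V)). Qed.
Lemma T_X p x v : T (X p x v) = X p x (T v) + p.+1%:R *: X p.+1 x v.
Proof. exact: (walg_TX (ev_walg V)). Qed.
Lemma X_base x a : X 0 x (base a) = X 0 (rmul x a) (base vac).
Proof. exact: (walg_XA (ev_walg V)). Qed.
Lemma T_base a : T (base a) = X 0 (d a) (base vac).
Proof. exact: (walg_TA (ev_walg V)). Qed.

(** The modes [n >= 0] are defined by recursion on a word, together with the
    state of the word: a triple [(f, h, s)] stands for a state [s] with the values
    [f x n] of all [x_(n) s] and [h a n] of all [a_(n) s]. *)
Definition modes : lmodType C := ((B -> int -> V) * (A -> int -> V) * V)%type.
Implicit Types e : modes.

Record mode_ok e : Prop := ModeOk {
  mode_ok_fl : forall n, linear (fun x => e.1.1 x n);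
  mode_ok_hl : forall n, linear (fun a => e.1.2 a n);
  mode_ok_d : forall a n, e.1.1 (d a) n = - n%:~R *: e.1.2 a (n - 1);
  mode_ok_neg : forall x p, e.1.1 x (Negz p) = X p x e.2 }.

Definition baseE a : modes :=
  (fun x n => match n with
     | Posz 0 => base (act x a) | Posz _ => 0 | Negz p => X p x (base a) end,
   fun b n => match n with
     | Posz _ => 0 | Negz 0 => base (mul b a)
     | Negz p.+1 => p.+1%:R^-1 *: X p (d b) (base a) end,
   base a).

(** The commutators [[x_(n), y_(k)]] and [[a_(n), y_(k)]] with [k = - p - 1]. They
    hold for all [n], also where [x_(n)] is one of the generators. *)
Definition XE p y e : modes :=
  (fun x n => X p y (e.1.1 x n) + e.1.1 (br x y) (n + Negz p)
     + n%:~R *: e.1.2 (pr x y) (n + Negz p - 1),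
   fun a n => X p y (e.1.2 a n) - e.1.2 (act y a) (n + Negz p),
   X p y e.2).

Definition TE e : modes :=
  (fun x n => T (e.1.1 x n) + n%:~R *: e.1.1 x (n - 1),
   fun a n => T (e.1.2 a n) + n%:~R *: e.1.2 a (n - 1),
   T e.2).

Lemma modes_eq e e' : (forall x n, e.1.1 x n = e'.1.1 x n) ->
  (forall a n, e.1.2 a n = e'.1.2 a n) -> e.2 = e'.2 -> e = e'.
Proof.
case: e e' => [[f h] s] [[f' h'] s'] /= hf hh ->.
by congr ((_, _), _); do 2![apply/funext => ?].
Qed.

Lemma modes_fD e e' x n : (e + e').1.1 x n = e.1.1 x n + e'.1.1 x n.
Proof. by []. Qed.
Lemma modes_hD e e' a n : (e + e').1.2 a n = e.1.2 a n + e'.1.2 a n.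
Proof. by []. Qed.
Lemma modes_1Z c e : (c *: e).1 = c *: e.1. Proof. by []. Qed.
Lemma modes_fZ c e x n : (c *: e).1.1 x n = c *: e.1.1 x n.
Proof. by rewrite modes_1Z. Qed.
Lemma modes_hZ c e a n : (c *: e).1.2 a n = c *: e.1.2 a n.
Proof. by rewrite modes_1Z. Qed.
Lemma modes_sD e e' : (e + e').2 = e.2 + e'.2. Proof. by []. Qed.
Lemma modes_sZ c e : (c *: e).2 = c *: e.2. Proof. by []. Qed.
Definition modesE := (modes_fD, modes_hD, modes_sD, modes_fZ, modes_hZ, modes_sZ).

Lemma XE_f p y e x n : (XE p y e).1.1 x n = X p y (e.1.1 x n)
  + e.1.1 (br x y) (n + Negz p) + n%:~R *: e.1.2 (pr x y) (n + Negz p - 1).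
Proof. by []. Qed.
Lemma XE_h p y e a n :
  (XE p y e).1.2 a n = X p y (e.1.2 a n) - e.1.2 (act y a) (n + Negz p).
Proof. by []. Qed.
Lemma TE_f e x n : (TE e).1.1 x n = T (e.1.1 x n) + n%:~R *: e.1.1 x (n - 1).
Proof. by []. Qed.
Lemma TE_h e a n : (TE e).1.2 a n = T (e.1.2 a n) + n%:~R *: e.1.2 a (n - 1).
Proof. by []. Qed.
Lemma XE_s p y e : (XE p y e).2 = X p y e.2. Proof. by []. Qed.
Lemma TE_s e : (TE e).2 = T e.2. Proof. by []. Qed.
Definition opE := (XE_f, XE_h, TE_f, TE_h, XE_s, TE_s).

Lemma natz_neq0 p : p.+1%:R != 0 :> C. Proof. by rewrite pnatr_eq0. Qed.

Lemma kap_neq0 p q : 2 + (p%:R + q%:R) != 0 :> C.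
Proof. by rewrite -!natrD pnatr_eq0. Qed.

(** The relation [(d a)_(n) = - n a_(n-1)] leaves [a_(-1)] as the only mode of
    [a] that the modes of weight one elements do not determine. *)
Lemma mode_ok_eq e e' : mode_ok e -> mode_ok e' -> e.2 = e'.2 ->
  (forall x p, e.1.1 x (Posz p) = e'.1.1 x (Posz p)) ->
  (forall a, e.1.2 a (-1) = e'.1.2 a (-1)) -> e = e'.
Proof.
move=> he he' ee' hf hh.
have hf' x n : e.1.1 x n = e'.1.1 x n.
  by case: n => n; [exact: hf | rewrite !mode_ok_neg // ee'].
apply: modes_eq => // a n; have [->|ne] := eqVneq n (-1); first exact: hh.
have := hf' (d a) (n + 1); rewrite !mode_ok_d // addrK.
apply: scalerI; rewrite oppr_eq0 intr_eq0; apply/eqP; lia.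
Qed.

Lemma mode_ok_lin c e e' : mode_ok e -> mode_ok e' -> mode_ok (c *: e + e').
Proof.
move=> he he'; split=> [n t x y|n t a b|a n|x p]; rewrite !modesE.
- by rewrite !mode_ok_fl //; lmod_coefs C V; ring.
- by rewrite !mode_ok_hl //; lmod_coefs C V; ring.
- by rewrite !mode_ok_d //; lmod_coefs C V; ring.
- by rewrite !mode_ok_neg // X_linr.
Qed.

Lemma NegzB1 p : Negz p - 1 = Negz p.+1. Proof. lia. Qed.
Lemma NegzD p q : Negz p + Negz q = Negz (p + q).+1. Proof. lia. Qed.
Lemma NegzR p : (Negz p)%:~R = - p.+1%:R :> C.
Proof. by rewrite NegzE rmorphN. Qed.

Lemma mode_ok_base a : mode_ok (baseE a).
Proof.
split=> [n t x y|n t b c|b n|x p] //=.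
- case: n => [[|n]|p]; rewrite ?act_linear_l ?base_lin ?X_linl //.
  by rewrite scaler0 addr0.
- case: n => [n|[|p]]; first by rewrite scaler0 addr0.
    by rewrite mul_linear_l base_lin.
  by rewrite linearP X_linl; lmod_coefs C V; ring.
- case: n => [[|n]|p].
  + by rewrite act_d (lin0 base_lin) oppr0 scale0r.
  + by rewrite (_ : n.+1%:Z - 1 = n) ?scaler0 //; lia.
  + by rewrite NegzB1 NegzR opprK scalerA divff ?scale1r // natz_neq0.
Qed.

Lemma mode_ok_X p y e : mode_ok e -> mode_ok (XE p y e).
Proof.
move=> he; split=> [n t x z|n t a b|a n|x q]; rewrite !opE.
- rewrite (mode_ok_fl he) br_linear_l pr_linear_l (mode_ok_fl he) (mode_ok_hl he) X_linr.
  by lmod_coefs C V; ring.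
- rewrite (mode_ok_hl he) act_linear_r (mode_ok_hl he) X_linr.
  by lmod_coefs C V; ring.
- rewrite br_d_x (lin0 (mode_ok_fl he _)) pr_d (mode_ok_d he) (linZ (X_linr p y)).
  rewrite (_ : n - 1 + Negz p = n + Negz p - 1); last by lia.
  by lmod_coefs C V; ring.
- rewrite X_X !(mode_ok_neg he) NegzD /brk (linB (X_linl _ _)) (linZ (X_linl _ _)).
  rewrite -[X _ (d _) _](mode_ok_neg he) (mode_ok_d he) !NegzR.
  lmod_coefs C V; rewrite /kap; field; exact: kap_neq0.
Qed.

Lemma mode_ok_T e : mode_ok e -> mode_ok (TE e).
Proof.
move=> he; split=> [n t x z|n t a b|a n|x q]; rewrite !opE.
- rewrite !(mode_ok_fl he) T_lin; by lmod_coefs C V; ring.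
- rewrite !(mode_ok_hl he) T_lin; by lmod_coefs C V; ring.
- rewrite !(mode_ok_d he) (linZ T_lin).
  by lmod_coefs C V; ring.
- by rewrite NegzB1 !(mode_ok_neg he) T_X NegzR; lmod_coefs C V; ring.
Qed.

(** This is the Jacobi identity of the Lie algebra of modes. *)
Lemma XE_XE p q y z e : mode_ok e ->
  XE p y (XE q z e) = XE q z (XE p y e) + XE (p + q).+1 (brk p q y z) e.
Proof.
move=> he.
have fB n := linB (mode_ok_fl he n); have fZ n := linZ (mode_ok_fl he n).
have hB n := linB (mode_ok_hl he n); have hD n := linD (mode_ok_hl he n).
have hZ n := linZ (mode_ok_hl he n).
apply: modes_eq => [x n|a n|]; last exact: X_X.
- rewrite !modesE !opE.
  have [N Ne] : exists N, N = n + Negz p + Negz q by eexists.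
  rewrite (_ : n + Negz (p + q).+1 = N); last by rewrite Ne -NegzD addrA.
  rewrite (_ : n + Negz p + Negz q = N) //.
  rewrite (_ : n + Negz q + Negz p = N); last by rewrite Ne; lia.
  rewrite (_ : n + Negz p - 1 + Negz q = N - 1); last by rewrite Ne; lia.
  rewrite (_ : n + Negz q - 1 + Negz p = N - 1); last by rewrite Ne; lia.
  rewrite !(linD (X_linr _ _)) !(linZ (X_linr _ _)) X_X.
  rewrite !rmorphD /= !NegzR.
  rewrite /brk br_jacobi (brN y (br x z)) pr_inv (prC (br x z) y).
  rewrite (act_pr x y z).
  rewrite (linB (br_linear_r x)) (linZ (br_linear_r x)) br_x_d.
  rewrite (linB (pr_linear_r x)) (linZ (pr_linear_r x)) [pr x (d _)]prC pr_d.
  rewrite !(fB, hB, hD) !(fZ, hZ) !(mode_ok_d he).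
  have -> : N%:~R = n%:~R - p.+1%:R - q.+1%:R :> C.
    by rewrite Ne !rmorphD /= !NegzR.
  by lmod_coefs C V; rewrite /kap; field; exact: kap_neq0.
- rewrite !modesE !opE.
  have [N Ne] : exists N, N = n + Negz p + Negz q by eexists.
  rewrite (_ : n + Negz (p + q).+1 = N); last by rewrite Ne -NegzD addrA.
  rewrite (_ : n + Negz p + Negz q = N) //.
  rewrite (_ : n + Negz q + Negz p = N); last by rewrite Ne; lia.
  rewrite !(linB (X_linr _ _)) X_X /brk (linB (act_linear_l a)).
  rewrite (linZ (act_linear_l a)) act_d scaler0 subr0 act_br hB.
  by lmod_coefs C V; ring.
Qed.

Lemma TE_XE p y e : mode_ok e ->
  TE (XE p y e) = XE p y (TE e) + p.+1%:R *: XE p.+1 y e.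
Proof.
move=> he; apply: modes_eq => [x n|a n|]; last exact: T_X.
- rewrite !modesE !opE.
  rewrite (_ : n + Negz p.+1 = n + Negz p - 1); last by lia.
  rewrite (_ : n - 1 + Negz p = n + Negz p - 1); last by lia.
  rewrite !(linD T_lin) !(linZ T_lin) !(linD (X_linr _ _)) !(linZ (X_linr _ _)).
  by rewrite T_X !rmorphB !rmorphD /= !NegzR; lmod_coefs C V; ring.
- rewrite !modesE !opE.
  rewrite (_ : n + Negz p.+1 = n + Negz p - 1); last by lia.
  rewrite (_ : n - 1 + Negz p = n + Negz p - 1); last by lia.
  rewrite !(linB T_lin) !(linD (X_linr _ _)) !(linZ (X_linr _ _)).
  by rewrite T_X !rmorphD /= !NegzR; lmod_coefs C V; ring.
Qed.

(** The values of [x_(-1) a] in [W] are compatible with all modes: this is where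
    the module structure of [W] in weights zero and one enters. *)
Lemma XE_base x a : XE 0 x (baseE a) = XE 0 (rmul x a) (baseE vac).
Proof.
apply: mode_ok_eq; [exact/mode_ok_X/mode_ok_base|exact/mode_ok_X/mode_ok_base|exact: X_base|..].
- move=> y [|[|n]] /=; rewrite ?scale0r ?scale1r ?addr0.
  + rewrite X_base [X 0 (br y x) _]X_base -(linD (X_linl _ _)) act1.
    by rewrite (lin0 base_lin) (lin0 (X_linr _ _)) add0r br_rmul addrC subrK.
  + rewrite !(lin0 (X_linr _ _)) !add0r act1 (lin0 base_lin) add0r mula1 pr_rmul.
    by rewrite (linD base_lin).
  + by rewrite !scaler0 !(lin0 (X_linr _ _)).
- move=> b /=; rewrite invr1 !scale1r mula1 rmul_act.
  rewrite !(X_base _ a) !(X_base _ b) X_base rmul_rmul d_mul.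
  rewrite !(linD (X_linl _ _)) [mul b a]mulC.
  by lmod_coefs C V; ring.
Qed.

Lemma TE_base a : TE (baseE a) = XE 0 (d a) (baseE vac).
Proof.
apply: mode_ok_eq; [exact/mode_ok_T/mode_ok_base|exact/mode_ok_X/mode_ok_base|exact: T_base|..].
- move=> y [|[|n]] /=; rewrite ?scale0r ?scale1r ?addr0.
  + by rewrite act1 (lin0 base_lin) (lin0 (X_linr _ _)) add0r br_x_d T_base.
  + rewrite (lin0 T_lin) (lin0 (X_linr _ _)) !add0r act1 (lin0 base_lin) add0r.
    by rewrite mula1 prC pr_d.
  + by rewrite !scaler0 (lin0 T_lin) (lin0 (X_linr _ _)) !addr0.
- move=> b /=; rewrite mula1 act_d linear0 (lin0 (X_linl _ _)) invr1 !scale1r.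
  rewrite T_base d_mul (linD (X_linl _ _)) -!X_base.
  by lmod_coefs C V; ring.
Qed.

Lemma modes_walg : is_walg mode_ok baseE XE TE.
Proof.
split=> //.
- exact: mode_ok_lin.
- exact: mode_ok_base.
- exact: mode_ok_X.
- exact: mode_ok_T.
- move=> c a b; apply: modes_eq => [x n|x n|]; rewrite !modesE /=.
  + case: n => [[|n]|p]; rewrite ?scaler0 ?addr0 //.
      by rewrite act_linear_r base_lin.
    by rewrite base_lin X_linr.
  + case: n => [n|[|p]]; rewrite ?scaler0 ?addr0 //.
      by rewrite mul_linear_r base_lin.
    by rewrite base_lin X_linr; lmod_coefs C V; ring.
  + exact: base_lin.
- move=> p e he c y z; apply: modes_eq => [x n|a n|]; rewrite !modesE !opE.
  + rewrite X_linl br_linear_r pr_linear_r (mode_ok_fl he) (mode_ok_hl he).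
    by lmod_coefs C V; ring.
  + by rewrite X_linl act_linear_l (mode_ok_hl he); lmod_coefs C V; ring.
  + exact: X_linl.
- move=> p y c e e'; apply: modes_eq => [x n|a n|]; rewrite !(modesE, opE).
  + by rewrite X_linr; lmod_coefs C V; ring.
  + by rewrite X_linr; lmod_coefs C V; ring.
  + exact: X_linr.
- move=> c e e'; apply: modes_eq => [x n|a n|]; rewrite !(modesE, opE).
  + by rewrite T_lin; lmod_coefs C V; ring.
  + by rewrite T_lin; lmod_coefs C V; ring.
  + exact: T_lin.
- by move=> *; exact: XE_XE.
- by move=> *; exact: TE_XE.
- exact: XE_base.
- exact: TE_base.
Qed.

Definition modes_of : V -> modes := sval (ev_rec V modes_walg).

Lemma modes_of_spec : [/\ linear modes_of, forall v, mode_ok (modes_of v),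
  forall a, modes_of (base a) = baseE a,
  forall p x v, modes_of (X p x v) = XE p x (modes_of v)
  & forall v, modes_of (T v) = TE (modes_of v)].
Proof. exact: (svalP (ev_rec V modes_walg)). Qed.

Lemma modes_ofE v : (modes_of v).2 = v.
Proof.
case: modes_of_spec => ml _ mb mX mT.
elim/(ev_ind (e := V)): v => [c u v hu hv|a|p x v hv|v hv].
- by rewrite ml !modesE hu hv.
- by rewrite mb.
- by rewrite mX opE hv.
- by rewrite mT opE hv.
Qed.

Fact mode_key : unit. Proof. exact: tt. Qed.

(** [mx x n] and [ma a n] are the modes of the weight one field of [x] and of
    the weight zero field of [a]. *)
Definition mx : B -> int -> V -> V :=
  locked_with mode_key (fun x n v => (modes_of v).1.1 x n).
Definition ma : A -> int -> V -> V :=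
  locked_with mode_key (fun a n v => (modes_of v).1.2 a n).

Lemma mxE x n v : mx x n v = (modes_of v).1.1 x n.
Proof. by rewrite /mx unlock. Qed.
Lemma maE a n v : ma a n v = (modes_of v).1.2 a n.
Proof. by rewrite /ma unlock. Qed.

Lemma mx_linr x n : linear (mx x n).
Proof. by move=> c u v; rewrite !mxE; case: modes_of_spec => -> *; rewrite modesE modes_fZ. Qed.
Lemma ma_linr a n : linear (ma a n).
Proof. by move=> c u v; rewrite !maE; case: modes_of_spec => -> *; rewrite modesE modes_hZ. Qed.
Lemma mx_linl n v : linear (fun x => mx x n v).
Proof. by move=> c x y; rewrite !mxE mode_ok_fl //; case: modes_of_spec. Qed.
Lemma ma_linl n v : linear (fun a => ma a n v).
Proof. by move=> c a b; rewrite !maE mode_ok_hl //; case: modes_of_spec. Qed.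
Lemma mx_d a n v : mx (d a) n v = - n%:~R *: ma a (n - 1) v.
Proof. by rewrite mxE maE; apply: mode_ok_d; case: modes_of_spec. Qed.
Lemma mx_neg x p v : mx x (Negz p) v = X p x v.
Proof.
by rewrite mxE mode_ok_neg ?modes_ofE //; case: modes_of_spec.
Qed.
Lemma mx_base x n a : mx x n (base a) = (baseE a).1.1 x n.
Proof. by rewrite !mxE; case: modes_of_spec => _ _ ->. Qed.
Lemma ma_base b n a : ma b n (base a) = (baseE a).1.2 b n.
Proof. by rewrite !maE; case: modes_of_spec => _ _ ->. Qed.
Lemma mx_X x n p y v : mx x n (X p y v) =
  X p y (mx x n v) + mx (br x y) (n + Negz p) v
  + n%:~R *: ma (pr x y) (n + Negz p - 1) v.
Proof. by rewrite !mxE maE; case: modes_of_spec => _ _ _ -> _; rewrite opE. Qed.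
Lemma ma_X a n p y v : ma a n (X p y v) =
  X p y (ma a n v) - ma (act y a) (n + Negz p) v.
Proof. by rewrite !maE; case: modes_of_spec => _ _ _ -> _; rewrite opE. Qed.
Lemma mx_T x n v : mx x n (T v) = T (mx x n v) + n%:~R *: mx x (n - 1) v.
Proof. by rewrite !mxE; case: modes_of_spec => _ _ _ _ ->; rewrite opE. Qed.
Lemma ma_T a n v : ma a n (T v) = T (ma a n v) + n%:~R *: ma a (n - 1) v.
Proof. by rewrite !maE; case: modes_of_spec => _ _ _ _ ->; rewrite opE. Qed.

(** Only [a_(-1)] is not a multiple of a mode of [d a]. *)
Lemma ma_d a n v : n != -1 -> ma a n v = - (n + 1)%:~R^-1 *: mx (d a) (n + 1) v.
Proof.
move=> ne; rewrite mx_d addrK scalerA mulrNN mulVf ?scale1r //.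
by rewrite intr_eq0; apply/eqP; move/eqP: ne; lia.
Qed.

End ModeSpace.

(** * Commutation relations between the modes *)

Section ModeRelations.
Variables (R : realType) (W : oneTruncVA R) (V : envelope W).
Local Notation C := R[i].
Local Notation A := (ot_space W false).
Local Notation B := (ot_space W true).
Local Notation vac := (ot_vac W).
Local Notation d := (ot_d W).
Local Notation base := (@ev_base R W V).
Local Notation X := (@ev_X R W V).
Local Notation T := (@ev_T R W V).
Local Notation mx := (@mx R W V).
Local Notation ma := (@ma R W V).
Implicit Types (a b : A) (x y z : B) (n m k : int) (p q : nat) (v : V).

Definition comm_xx v := forall x y m k, mx x m (mx y k v) =
  mx y k (mx x m v) + mx (br x y) (m + k) v + m%:~R *: ma (pr x y) (m + k - 1) v.
Definition comm_xa v := forall x a m k, mx x m (ma a k v) =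
  ma a k (mx x m v) + ma (act x a) (m + k) v.
Definition comm_aa v := forall a b m k, ma a m (ma b k v) = ma b k (ma a m v).

Lemma comm_xx_neg x y m q v : mx x m (mx y (Negz q) v) =
  mx y (Negz q) (mx x m v) + mx (br x y) (m + Negz q) v
  + m%:~R *: ma (pr x y) (m + Negz q - 1) v.
Proof. by rewrite !mx_neg mx_X. Qed.

(** Skew-symmetry [br y x = d (pr x y) - br x y] makes the relation symmetric. *)
Lemma comm_xx_swap x y m k v :
  mx y k (mx x m v) = mx x m (mx y k v) + mx (br y x) (k + m) v
    + k%:~R *: ma (pr y x) (k + m - 1) v ->
  mx x m (mx y k v) = mx y k (mx x m v) + mx (br x y) (m + k) v
    + m%:~R *: ma (pr x y) (m + k - 1) v.
Proof.
move=> ->; rewrite [br y x]brN (linB (mx_linl _ _)) mx_d [pr y x]prC [k + m]addrC.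
by rewrite rmorphD /=; lmod_coefs C V; ring.
Qed.

Lemma comm_xa_neg x a p k v : mx x (Negz p) (ma a k v) =
  ma a k (mx x (Negz p) v) + ma (act x a) (Negz p + k) v.
Proof. by rewrite !mx_neg ma_X [Negz p + k]addrC subrK. Qed.

Lemma comm_xa_d x a m k v : comm_xx v -> k != -1 ->
  mx x m (ma a k v) = ma a k (mx x m v) + ma (act x a) (m + k) v.
Proof.
move=> hv ne; rewrite (ma_d a v ne) (ma_d a (mx x m v) ne).
rewrite (linZ (mx_linr _ _)) hv br_x_d (mx_d (act x a)) prC pr_d.
rewrite (_ : m + (k + 1) - 1 = m + k); last by lia.
have n0 : k%:~R + 1 != 0 :> C.
  by rewrite -(rmorphD _ k 1) /= intr_eq0; apply/eqP; move/eqP: ne; lia.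
rewrite !rmorphD /=.
by lmod_coefs C V; field.
Qed.

Lemma mx_base_pos x p a : mx x p.+1 (base a) = 0. Proof. by rewrite mx_base. Qed.
Lemma mx_base0 x a : mx x 0 (base a) = base (act x a).
Proof. by rewrite mx_base. Qed.
Lemma ma_base_nneg b p a : ma b (Posz p) (base a) = 0. Proof. by rewrite ma_base. Qed.
Lemma ma_baseN1 b a : ma b (-1) (base a) = base (mul b a).
Proof. by rewrite ma_base. Qed.

Lemma mx0 x n : mx x n 0 = 0. Proof. exact: lin0 (mx_linr x n). Qed.
Lemma ma0 a n : ma a n 0 = 0. Proof. exact: lin0 (ma_linr a n). Qed.

Lemma comm_xx_base c : comm_xx (base c).
Proof.
move=> x y m k; case: k => [k|q]; last exact: comm_xx_neg.
case: m => [m|p]; last by apply: comm_xx_swap; exact: comm_xx_neg.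
case: m k => [|m] [|k]; rewrite ?(mx_base_pos, mx_base0, mx0).
- by rewrite scale0r addr0 act_br (linB (base_lin V)) addrC subrK.
- by rewrite scale0r !addr0.
- rewrite (_ : m.+1%:Z + 0%:Z - 1 = m); last by lia.
  by rewrite ma_base_nneg scaler0 !addr0.
- rewrite (_ : m.+1%:Z + k.+1%:Z - 1 = (m + k).+1%:Z); last by lia.
  by rewrite ma_base_nneg scaler0 !addr0.
Qed.

Lemma comm_xa_base c : comm_xa (base c).
Proof.
move=> x a m k; have [->|ne] := eqVneq k (-1); last first.
  by apply: comm_xa_d => //; exact: comm_xx_base.
case: m => [[|m]|p]; last exact: comm_xa_neg.
- by rewrite ma_baseN1 !mx_base0 add0r !ma_baseN1 act_mul (linD (base_lin V)) addrC.
- rewrite ma_baseN1 !mx_base_pos ma0 (_ : m.+1%:Z + -1 = m); last by lia.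
  by rewrite ma_base_nneg addr0.
Qed.

Lemma comm_aa_d a b m k v : comm_xa v -> m != -1 ->
  ma a m (ma b k v) = ma b k (ma a m v).
Proof.
move=> hv ne; rewrite (ma_d a v ne) (ma_d a (ma b k v) ne) hv act_d.
rewrite (lin0 (ma_linl _ _)) addr0.
by rewrite (linZ (ma_linr _ _)).
Qed.

Lemma comm_aa_base c : comm_aa (base c).
Proof.
move=> a b m k; have [->|ne] := eqVneq m (-1); last first.
  by apply: comm_aa_d => //; exact: comm_xa_base.
have [->|ne] := eqVneq k (-1); last first.
  by apply/esym/comm_aa_d => //; exact: comm_xa_base.
by rewrite !ma_baseN1 mulCA.
Qed.

Definition comm v := [/\ comm_xx v, comm_xa v & comm_aa v].

(** The relations pass from [v] to [z_(-p-1) v] by the Jacobi identity. *)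
Lemma comm_X p z v : comm v -> comm (X p z v).
Proof.
move=> [hxx hxa haa]; split.
- move=> x y m k.
  have [N Ne] : exists N, N = m + k + Negz p by eexists.
  rewrite !mx_X !ma_X !(linD (mx_linr _ _)) !(linZ (mx_linr _ _)) !mx_X.
  rewrite (hxx x y) (hxx x (br y z)) (hxx (br x z) y) !hxa.
  have -> : ma (pr x z) (m + Negz p - 1) (mx y k v) =
      mx y k (ma (pr x z) (m + Negz p - 1) v) - ma (act y (pr x z)) (N - 1) v.
    rewrite hxa (_ : k + (m + Negz p - 1) = N - 1); last by rewrite Ne; lia.
    by rewrite addrK.
  rewrite (_ : m + k - 1 + Negz p = N - 1); last by rewrite Ne; lia.
  rewrite (_ : m + (k + Negz p) = N); last by rewrite Ne; lia.
  rewrite (_ : m + Negz p + k = N); last by rewrite Ne; lia.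
  rewrite (_ : k + (m + Negz p - 1) = N - 1); last by rewrite Ne; lia.
  rewrite (_ : m + (k + Negz p - 1) = N - 1); last by rewrite Ne; lia.
  rewrite -Ne (br_jacobi x y z) (brN y (br x z)) (act_pr x y z) (pr_inv x y z).
  rewrite (prC (br x z) y).
  rewrite !(linD (X_linr _ _)) !(linZ (X_linr _ _)).
  rewrite !(linB (mx_linl _ _)) !mx_d.
  rewrite !(linD (ma_linl _ _)) !(linN (ma_linl _ _)).
  have -> : N%:~R = m%:~R + k%:~R + (Negz p)%:~R :> C by rewrite Ne !rmorphD.
  by rewrite !rmorphD /=; lmod_coefs C V; ring.
- move=> x a m k.
  have [N Ne] : exists N, N = m + k + Negz p by eexists.
  rewrite mx_X !ma_X (linB (mx_linr _ _)) mx_X !hxa haa.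
  rewrite 2!(linD (ma_linr a k)) (linZ (ma_linr a k)) ma_X.
  rewrite (_ : m + Negz p + k = N); last by rewrite Ne; lia.
  rewrite (_ : m + (k + Negz p) = N); last by rewrite Ne; lia.
  rewrite -Ne act_br (linB (ma_linl _ _)) (linD (X_linr _ _)).
  by lmod_coefs C V; ring.
- move=> a b m k.
  rewrite !ma_X (linB (ma_linr a m)) (linB (ma_linr b k)) !ma_X (haa a b) (haa a (act z b)).
  by rewrite (haa b (act z a)); lmod_coefs C V; ring.
Qed.

Lemma comm_T v : comm v -> comm (T v).
Proof.
move=> [hxx hxa haa]; split.
- move=> x y m k.
  have [N Ne] : exists N, N = m + k - 1 by eexists.
  rewrite !mx_T !ma_T (linD (mx_linr x m)) (linZ (mx_linr x m)).
  rewrite (linD (mx_linr y k)) (linZ (mx_linr y k)) !mx_T !(hxx x y).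
  rewrite (_ : m - 1 + k = N); last by rewrite Ne; lia.
  rewrite (_ : m + (k - 1) = N); last by rewrite Ne; lia.
  rewrite -Ne 2!(linD (T_lin (V := V))) (linZ (T_lin (V := V))).
  have -> : N%:~R = m%:~R + k%:~R - 1 :> C by rewrite Ne rmorphB rmorphD.
  by rewrite !rmorphD /=; lmod_coefs C V; ring.
- move=> x a m k.
  have [N Ne] : exists N, N = m + k - 1 by eexists.
  rewrite mx_T !ma_T (linD (mx_linr x m)) (linZ (mx_linr x m)) !mx_T.
  rewrite (linD (ma_linr a k)) (linZ (ma_linr a k)) !ma_T !hxa.
  rewrite (_ : m - 1 + k = N); last by rewrite Ne; lia.
  rewrite (_ : m + (k - 1) = N); last by rewrite Ne; lia.
  rewrite -Ne (linD (T_lin (V := V))).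
  by rewrite !rmorphD /=; lmod_coefs C V; ring.
- move=> a b m k.
  rewrite !ma_T (linD (ma_linr a m)) (linZ (ma_linr a m)) (linD (ma_linr b k)).
  rewrite (linZ (ma_linr b k)) !ma_T.
  by rewrite !(haa a b); lmod_coefs C V; ring.
Qed.

Lemma commP v : comm v.
Proof.
elim/(ev_ind (e := V)): v => [c u v [u1 u2 u3] [v1 v2 v3]|a|p x v|v].
- split=> [x y m k|x a m k|a b m k].
  + rewrite !mx_linr ma_linr u1 v1.
    by lmod_coefs C V; ring.
  + by rewrite ma_linr mx_linr mx_linr ma_linr ma_linr u2 v2; lmod_coefs C V; ring.
  + by rewrite ma_linr ma_linr ma_linr ma_linr u3 v3; lmod_coefs C V; ring.
- by split; [exact: comm_xx_base | exact: comm_xa_base | exact: comm_aa_base].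
- exact: comm_X.
- exact: comm_T.
Qed.

Lemma mx_mx x y m k v : mx x m (mx y k v) =
  mx y k (mx x m v) + mx (br x y) (m + k) v + m%:~R *: ma (pr x y) (m + k - 1) v.
Proof. by case: (commP v). Qed.
Lemma mx_ma x a m k v : mx x m (ma a k v) =
  ma a k (mx x m v) + ma (act x a) (m + k) v.
Proof. by case: (commP v). Qed.
Lemma ma_ma a b m k v : ma a m (ma b k v) = ma b k (ma a m v).
Proof. by case: (commP v). Qed.

Lemma modes_trunc v : exists N : nat, forall n, N%:Z <= n ->
  (forall x, mx x n v = 0) /\ (forall a, ma a n v = 0).
Proof.
elim/(ev_ind (e := V)): v => [c u v [N hN] [M hM]|a|p x v [N hN]|v [N hN]].
- exists (maxn N M) => n hn.
  have [u1 u2] : _ /\ _ := hN n ltac:(lia).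
  have [v1 v2] : _ /\ _ := hM n ltac:(lia).
  by split=> [x|a]; rewrite ?mx_linr ?ma_linr ?u1 ?u2 ?v1 ?v2 scaler0 addr0.
- exists 1%N => -[[|n]|//] // _.
  by split=> [x|b]; rewrite ?mx_base_pos ?ma_base_nneg.
- exists (N + p + 2)%N => n hn.
  have [u1 u2] : _ /\ _ := hN n ltac:(lia).
  have [v1 v2] : _ /\ _ := hN (n + Negz p) ltac:(lia).
  have [w1 w2] : _ /\ _ := hN (n + Negz p - 1) ltac:(lia).
  split=> [y|a]; first by rewrite mx_X u1 v1 w2 (lin0 (X_linr _ _)) scaler0 !addr0.
  by rewrite ma_X u2 v2 (lin0 (X_linr _ _)) subr0.
- exists N.+1 => n hn.
  have [u1 u2] : _ /\ _ := hN n ltac:(lia).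
  have [v1 v2] : _ /\ _ := hN (n - 1) ltac:(lia).
  by split=> [x|a]; rewrite ?mx_T ?ma_T ?u1 ?u2 ?v1 ?v2 (lin0 (T_lin (V := V))) scaler0 addr0.
Qed.

(** * The enveloping vertex algebra *)

Local Notation one := (base vac).

Lemma T_one : T one = 0.
Proof. by rewrite T_base ot_dvac (lin0 (X_linl _ _)). Qed.

Definition gen (i : A + B) : int -> V -> V :=
  match i with inl a => ma a | inr x => mx x end.

Lemma mx_field x : is_field (mx x).
Proof.
split=> [n|v]; first exact: mx_linr.
by have [N hN] := modes_trunc v; exists N => n /hN[].
Qed.

Lemma ma_field a : is_field (ma a).
Proof.
split=> [n|v]; first exact: ma_linr.
by have [N hN] := modes_trunc v; exists N => n /hN[].
Qed.

Definition evT (v : V) : V := T v.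
HB.instance Definition _ := GRing.isLinear.Build C V V *:%R evT (T_lin (V := V)).

Lemma gen_good i : good one evT (gen i).
Proof.
case: i => [a|x] /=; split.
- exact: ma_field.
- by case=> // n _; exact: ma_base_nneg.
- by move=> n v; rewrite /evT ma_T addrK.
- exact: mx_field.
- by case=> // -[|n] _; rewrite ?mx_base_pos // mx_base0 act1 (lin0 (base_lin V)).
- by move=> n v; rewrite /evT mx_T addrK.
Qed.

Lemma loc_xa x a : loc (mx x) (ma a).
Proof.
have [hx ha] := (mx_field x, ma_field a).
apply: (@loc_from _ _ _ _ 1) => // m k v.
rewrite -[1%:Z]/(0 + 1 : int) Bk_D // !Bk0 !mx_ma.
rewrite (_ : m + (k + 1) = m + 1 + k); last by lia.
by lmod_coefs C V; ring.
Qed.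

Lemma loc_xx x y : loc (mx x) (mx y).
Proof.
have [hx hy] := (mx_field x, mx_field y).
apply: (@loc_from _ _ _ _ 2) => // m k v.
rewrite -[2%:Z]/(0 + 1 + 1 : int) !Bk_D // !Bk0 !(mx_mx x y).
have [N Ne] : exists N, N = m + k + 2 by eexists.
rewrite (_ : m + 1 + 1 + k = N); last by rewrite Ne; lia.
rewrite (_ : m + 1 + (k + 1) = N); last by rewrite Ne; lia.
rewrite (_ : m + (k + 1 + 1) = N); last by rewrite Ne; lia.
by rewrite !rmorphD /=; lmod_coefs C V; ring.
Qed.

Lemma gen_loc i j : loc (gen i) (gen j).
Proof.
case: i j => [a|x] [b|y] /=; [|exact/loc_sym/loc_xa|exact: loc_xa|exact: loc_xx].
apply: (@loc_from _ _ _ _ 0); try exact: ma_field.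
by move=> m k v; rewrite Bk0 ma_ma subrr.
Qed.

Lemma base_ma a : base a = ma a (-1) one.
Proof. by rewrite ma_baseN1 mula1. Qed.

(** The span of the words in the generators is stable under [T], which kills the
    vacuum and commutes with the modes up to other modes. *)
Lemma gen_span (P : V -> Prop) :
  (forall (t : C) u v, P u -> P v -> P (t *: u + v)) -> P one ->
  (forall i n v, P v -> P (gen i n v)) -> forall v, P v.
Proof.
move=> PL P1 Pg.
pose closed (Q : V -> Prop) := [/\ forall (t : C) u v, Q u -> Q v -> Q (t *: u + v),
  Q one & forall i n v, Q v -> Q (gen i n v)].
pose S v := forall Q, closed Q -> Q v.
have clS : closed S.
  split=> [t u v hu hv Q cQ|Q []//|i n v hv Q cQ]; have [QL Q1 Qg] := cQ.
    by apply: QL; [exact: hu | exact: hv].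
  by apply: Qg; exact: hv.
have [SL S1 Sg] := clS.
have S0 : S 0 by have := SL (-1) _ _ S1 S1; rewrite scaleN1r addNr.
have ST v : S v -> S (T v).
  move=> Sv; have : S v /\ S (T v).
    apply: (Sv (fun v => S v /\ S (T v))); split=> [t u v' [u1 u2] [v1 v2]||i n v' [v1 v2]].
    - by split; [exact: SL | rewrite T_lin; exact: SL].
    - by split; [exact: S1 | rewrite T_one; exact: S0].
    - split; first exact: Sg.
      rewrite -[T _]/(evT _) (good_T (gen_good i)) addrC -scaleNr.
      by apply: SL; apply: Sg.
  by case.
suff all v : S v by move=> v; apply: all.
elim/(ev_ind (e := V)): v => [c u v hu hv|a|p x v hv|v hv].
- exact: SL.
- by rewrite base_ma; exact: (Sg (inl a)).
- by rewrite -mx_neg; exact: (Sg (inr x)).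
- exact: ST.
Qed.

Definition env_va : vertexAlgebra R :=
  reconstruct (T := evT) T_one gen_good gen_loc gen_span.

End ModeRelations.

(** * Conformal weights of the envelope *)

Section Eigensums.
Variables (K : fieldType) (V : lmodType K) (H : V -> V).
Hypothesis H_lin : linear H.

(** Sums of [n] eigenvectors of [H] with eigenvalues in [P]. *)
Inductive eigs (P : K -> Prop) : nat -> V -> Prop :=
| eigs0 : eigs P 0 0
| eigsS n w x r : H x = w *: x -> P w -> eigs P n r -> eigs P n.+1 (x + r).

Definition eig (P : K -> Prop) (v : V) : Prop := exists n, eigs P n v.

Lemma eig0 P : eig P 0. Proof. by exists 0%N; exact: eigs0. Qed.

Lemma eig1 (P : K -> Prop) w x : H x = w *: x -> P w -> eig P x.
Proof.
by move=> hx hw; exists 1%N; rewrite -[x]addr0; apply: (eigsS hx hw); exact: eigs0.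
Qed.

Lemma eigs_map (P Q : K -> Prop) (f : V -> V) n r : linear f ->
  (forall w x, P w -> H x = w *: x -> exists2 w', Q w' & H (f x) = w' *: f x) ->
  eigs P n r -> eigs Q n (f r).
Proof.
move=> fl fP; elim=> [|{}n w x {}r hx hw _ IH]; first by rewrite lin0 //; exact: eigs0.
by rewrite linD //; have [w' qw' hfx] := fP _ _ hw hx; apply: (eigsS hfx qw').
Qed.

Lemma eig_map (P Q : K -> Prop) (f : V -> V) r : linear f ->
  (forall w x, P w -> H x = w *: x -> exists2 w', Q w' & H (f x) = w' *: f x) ->
  eig P r -> eig Q (f r).
Proof. by move=> fl fP [n hr]; exists n; apply: eigs_map hr. Qed.

Lemma eig_sub (P Q : K -> Prop) r : (forall w, P w -> Q w) -> eig P r -> eig Q r.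
Proof.
move=> PQ; apply: (eig_map (f := id)) => // w x /PQ qw hx.
by exists w.
Qed.

Lemma eigD P u v : eig P u -> eig P v -> eig P (u + v).
Proof.
move=> [n hu] hv; elim: hu => [|{}n w x r hx hw _ [m hm]]; first by rewrite add0r.
by exists m.+1; rewrite -addrA; apply: (eigsS hx hw).
Qed.

Lemma eigZ P c u : eig P u -> eig P (c *: u).
Proof.
apply: (eig_map (f := fun u => c *: u)) => [t x y|w x pw hx].
  by rewrite scalerDr !scalerA mulrC.
by exists w => //; rewrite linZ // hx !scalerA mulrC.
Qed.

Lemma eigs_inv P n r : eigs P n r ->
  if n is n'.+1 then
    exists w x r', [/\ H x = w *: x, P w, eigs P n' r' & r = x + r']
  else r = 0.
Proof. by case=> // {}n w x {}r hx hw hr; exists w, x, r. Qed.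

(** Applying [H - w] removes one of the eigenvectors from the sum and multiplies
    [r] by [z - w]. *)
Lemma eig_indep (P : K -> Prop) z r :
  ~ P z -> H r = z *: r -> eig P r -> r = 0.
Proof.
move=> nPz hr [n]; elim: n r hr => [|n IH] r hr.
  exact: eigs_inv.
case/eigs_inv=> [w [x [r' [hx hw hr' er]]]]; rewrite {}er in hr *.
have zw : z - w != 0 by rewrite subr_eq0; apply/eqP => e; apply: nPz; rewrite e.
have e : (z - w) *: (x + r') = H r' - w *: r'.
  by rewrite scalerBl -hr (linD H_lin) hx; lmod_coefs K V; ring.
suff : (z - w) *: (x + r') = 0.
  by move/eqP; rewrite scaler_eq0 (negPf zw) => /eqP.
apply: IH; first by rewrite linZ // hr !scalerA mulrC.
rewrite e; apply: (eigs_map (P := P) (f := fun r => H r - w *: r)) => //.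
  move=> t u v; rewrite H_lin; by lmod_coefs K V; ring.
move=> w' y pw' hy; exists w' => //.
by rewrite hy -scalerBl (linZ H_lin) hy !scalerA mulrC.
Qed.

End Eigensums.

Section Grading.
Variables (R : realType) (W : oneTruncVA R) (V : envelope W).
Local Notation C := R[i].
Local Notation A := (ot_space W false).
Local Notation B := (ot_space W true).
Local Notation vac := (ot_vac W).
Local Notation d := (ot_d W).
Local Notation base := (@ev_base R W V).
Local Notation X := (@ev_X R W V).
Local Notation T := (@ev_T R W V).
Local Notation mx := (@mx R W V).
Local Notation ma := (@ma R W V).
Local Notation one := (base vac).
Local Notation VA := (env_va V).
Local Notation op := (@va_op R VA).
Implicit Types (a b : A) (x y z : B) (n m k : int) (p q : nat) (v : V).

Lemma op_base a n v : op n (base a) v = ma a n v.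
Proof. by rewrite base_ma; exact: (Y_gen_vac (T := @evT R W V) (T_one V) (gen_good V) (gen_loc V) (@gen_span R W V)
   (inl a)). Qed.

Lemma op_x x n v : op n (X 0 x one) v = mx x n v.
Proof. by rewrite -mx_neg; exact: (Y_gen_vac (T := @evT R W V) (T_one V) (gen_good V) (gen_loc V) (@gen_span R W V)
   (inr x)). Qed.

Lemma op_gen (i : A + B) n u k v :
  op k (gen (V := V) i n u) v = nprod n (gen (V := V) i) (fun k => op k u) k v.
Proof. exact: (Y_gen (T := @evT R W V) (T_one V) (gen_good V) (gen_loc V) (@gen_span R W V)). Qed.

Lemma op_field u : is_field (fun k => op k u).
Proof. exact: (Y_field (T := @evT R W V) (gen_good V) (gen_loc V) (@gen_span R W V)). Qed.

(** The energy operator is built together with the identity, [(H v, v)], so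
    that the commutator [[H, x_(-p-1)] = (p + 1) x_(-p-1)] defines it. *)
Definition dual : lmodType C := (V * V)%type.
Definition dual_base a : dual := (0, base a).
Definition dual_X p x (u : dual) : dual :=
  (X p x u.1 + p.+1%:R *: X p x u.2, X p x u.2).
Definition dual_T (u : dual) : dual := (T u.1 + T u.2, T u.2).

Lemma dual_eq (u v : dual) : u.1 = v.1 -> u.2 = v.2 -> u = v.
Proof. by case: u v => [? ?] [? ?] /= -> ->. Qed.

Lemma dual_1D (u v : dual) : (u + v).1 = u.1 + v.1. Proof. by []. Qed.
Lemma dual_2D (u v : dual) : (u + v).2 = u.2 + v.2. Proof. by []. Qed.
Lemma dual_1Z c (u : dual) : (c *: u).1 = c *: u.1. Proof. by []. Qed.
Lemma dual_2Z c (u : dual) : (c *: u).2 = c *: u.2. Proof. by []. Qed.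
Definition dualE := (dual_1D, dual_2D, dual_1Z, dual_2Z).

Lemma dual_walg : is_walg (fun=> True) dual_base dual_X dual_T.
Proof.
split=> //.
- move=> c a b; apply: dual_eq; rewrite !dualE /=; last exact: base_lin.
  by rewrite scaler0 addr0.
- move=> p u _ c x y; apply: dual_eq; rewrite !dualE /=; last exact: X_linl.
  by rewrite !X_linl; lmod_coefs C V; ring.
- move=> p x c u v; apply: dual_eq; rewrite !dualE /= ?dualE; last exact: X_linr.
  by rewrite !X_linr; lmod_coefs C V; ring.
- move=> c u v; apply: dual_eq; rewrite !dualE /= ?dualE; last exact: T_lin.
  by rewrite !T_lin; lmod_coefs C V; ring.
- move=> p q x y u _; apply: dual_eq; rewrite !dualE /=; last exact: X_X.
  rewrite !(linD (X_linr _ _)) !(linZ (X_linr _ _)).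
  rewrite (X_X p q x y u.1) (X_X p q x y u.2).
  rewrite -addSn -addnS natrD.
  by lmod_coefs C V; ring.
- move=> p x u _; apply: dual_eq; rewrite !dualE /=; last exact: T_X.
  rewrite !(linD (T_lin (V := V))) (linZ (T_lin (V := V))) !T_X.
  rewrite (linD (X_linr _ _)) -[p.+2%:R]natr1.
  by lmod_coefs C V; ring.
- move=> x a; apply: dual_eq; rewrite /= ?(lin0 (X_linr _ _)) X_base //.
- move=> a; apply: dual_eq; rewrite /= ?(lin0 (X_linr _ _)) T_base //.
  by rewrite (lin0 (T_lin (V := V))) scale1r.
Qed.

Definition energy_pair : V -> dual := sval (ev_rec V dual_walg).
Definition energy v : V := (energy_pair v).1.
Local Notation H := energy.

Lemma energy_pair_spec : [/\ linear energy_pair,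
  forall a, energy_pair (base a) = dual_base a,
  forall p x v, energy_pair (X p x v) = dual_X p x (energy_pair v)
  & forall v, energy_pair (T v) = dual_T (energy_pair v)].
Proof. by have [h1 _ h2 h3 h4] := svalP (ev_rec V dual_walg). Qed.

Lemma energy_pair2 v : (energy_pair v).2 = v.
Proof.
case: energy_pair_spec => hl hb hX hT.
elim/(ev_ind (e := V)): v => [c u v hu hv|a|p x v hv|v hv].
- by rewrite hl !dualE hu hv.
- by rewrite hb.
- by rewrite hX /= hv.
- by rewrite hT /= hv.
Qed.

Lemma H_lin : linear H.
Proof. by move=> c u v; rewrite /H; case: energy_pair_spec => -> *; rewrite !dualE. Qed.
Lemma H_base a : H (base a) = 0.
Proof. by rewrite /H; case: energy_pair_spec => _ ->. Qed.
Lemma H_X p x v : H (X p x v) = X p x (H v) + p.+1%:R *: X p x v.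
Proof. by rewrite /H; case: energy_pair_spec => _ _ -> _ /=; rewrite energy_pair2. Qed.
Lemma H_T v : H (T v) = T (H v) + T v.
Proof. by rewrite /H; case: energy_pair_spec => _ _ _ -> /=; rewrite energy_pair2. Qed.

Definition H_modes v :=
  (forall x n, H (mx x n v) = mx x n (H v) - n%:~R *: mx x n v) /\
  (forall a n, H (ma a n v) = ma a n (H v) - (n + 1)%:~R *: ma a n v).

Lemma H_mx_neg x p v :
  H (mx x (Negz p) v) = mx x (Negz p) (H v) - (Negz p)%:~R *: mx x (Negz p) v.
Proof. by rewrite !mx_neg H_X NegzR scaleNr opprK. Qed.

Lemma H_modesP v : H_modes v.
Proof.
elim/(ev_ind (e := V)): v => [c u v [u1 u2] [v1 v2]|a|p x v [v1 v2]|v [v1 v2]].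
- split=> [x n|a n].
    rewrite H_lin !mx_linr H_lin u1 v1.
    by lmod_coefs C V; ring.
  rewrite H_lin !ma_linr H_lin u2 v2.
  by lmod_coefs C V; ring.
- have hx x n : H (mx x n (base a)) = mx x n (H (base a)) - n%:~R *: mx x n (base a).
    case: n => [n|p]; last exact: H_mx_neg.
    rewrite H_base mx0 sub0r; case: n => [|n].
      by rewrite mx_base0 H_base scale0r oppr0.
    by rewrite mx_base_pos (lin0 H_lin) scaler0 oppr0.
  split=> [//|b n].
  have [->|ne] := eqVneq n (-1).
    by rewrite ma_baseN1 !H_base ma0 scale0r subr0.
  rewrite (ma_d _ (base a) ne) (ma_d _ (H (base a)) ne) (linZ H_lin) hx.
  by lmod_coefs C V; ring.
- split=> [y n|a n].
    rewrite H_X (linD (mx_linr y n)) (linZ (mx_linr y n)) !mx_X.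
    rewrite 2!(linD H_lin) (linZ H_lin) H_X !v1 v2.
    rewrite (linB (X_linr _ _)) (linZ (X_linr _ _)).
    by rewrite !rmorphD /= NegzR; lmod_coefs C V; ring.
  rewrite H_X (linD (ma_linr a n)) (linZ (ma_linr a n)) !ma_X.
  rewrite (linB H_lin) H_X !v2.
  rewrite (linB (X_linr _ _)) (linZ (X_linr _ _)).
  by rewrite !rmorphD /= NegzR; lmod_coefs C V; ring.
- split=> [y n|a n].
    rewrite H_T (linD (mx_linr y n)) !mx_T.
    rewrite (linD H_lin) (linZ H_lin) H_T !v1.
    rewrite (linB (T_lin (V := V))) (linZ (T_lin (V := V))).
    by lmod_coefs C V; ring.
  rewrite H_T (linD (ma_linr a n)) !ma_T.
  rewrite (linD H_lin) (linZ H_lin) H_T !v2.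
  rewrite (linB (T_lin (V := V))) (linZ (T_lin (V := V))).
  by lmod_coefs C V; ring.
Qed.

Lemma H_mx x n v : H (mx x n v) = mx x n (H v) - n%:~R *: mx x n v.
Proof. by case: (H_modesP v). Qed.
Lemma H_ma a n v : H (ma a n v) = ma a n (H v) - (n + 1)%:~R *: ma a n v.
Proof. by case: (H_modesP v). Qed.

(** If [H] shifts the weights of the modes of two fields, up to [a'] and [b'], it
    does so for all terms of [Pk] by the same amount. *)
Lemma H_Pk (a b a' b' : int -> V -> V) (s t : C) n m k v :
  is_field a -> is_field b -> is_field a' -> is_field b' ->
  (forall n v, H (a n v) = a n (H v) + a' n v - (n%:~R + s) *: a n v) ->
  (forall n v, H (b n v) = b n (H v) + b' n v - (n%:~R + t) *: b n v) ->
  H (Pk a b n m k v) = Pk a b n m k (H v) + Pk a' b n m k v + Pk a b' n m k v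
    - (n%:~R + m%:~R + k%:~R + s + t) *: Pk a b n m k v.
Proof.
move=> ha hb ha' hb' Ha Hb; rewrite /Pk (fs_lin H_lin); last ev_field.
rewrite -fsZ; last ev_field.
rewrite -fsD; [|ev_field|ev_field].
rewrite -fsD; [|by apply: ev0D; ev_field|ev_field].
rewrite -fsB; [|by do 2?apply: ev0D; ev_field|ev_field].
apply: eq_fs => j; rewrite (linZ H_lin) Ha Hb (linB (fld_lin ha _)).
rewrite (linZ (fld_lin ha _)) (linD (fld_lin ha _)) !rmorphD /= rmorphN /=.
by lmod_coefs C V; ring.
Qed.

(** The mode [n] of the generator [i] lowers the weight by [n + gen_wt i]. *)
Definition gen_wt (i : A + B) : C := if i is inl _ then 1 else 0.

Lemma H_gen (i : A + B) n v : H (gen (V := V) i n v) =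
  gen (V := V) i n (H v) - (n%:~R + gen_wt i) *: gen (V := V) i n v.
Proof.
case: i => [a|x] /=; last by rewrite H_mx addr0.
by rewrite H_ma rmorphD.
Qed.

Lemma op_linl n v : linear (fun u : V => op n u v).
Proof. exact: (va_opl_linear (v := VA) n v). Qed.

Lemma zero_field : is_field (fun (_ : int) (_ : V) => 0 : V).
Proof.
by split=> [n c u v|v]; [rewrite scaler0 addr0 | exists 0%N].
Qed.

Lemma H_op n u v :
  H (op n u v) = op n (H u) v + op n u (H v) - (n + 1)%:~R *: op n u v.
Proof.
elim/(gen_span (V := V)): u n v => [c u u' hu hu' n v|n v|i k u hu n v].
- rewrite !op_linl !H_lin op_linl hu hu'.
  by lmod_coefs C V; ring.
- rewrite H_base (lin0 (op_linl _ _)) add0r !(va_vacl (v := VA)).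
  case: eqP => [->|_]; first by rewrite scale0r subr0.
  by rewrite (lin0 H_lin) scaler0 subr0.
- have hg : is_field (gen (V := V) i) by exact: good_field (gen_good V i).
  have hz := zero_field; have hf := op_field u; have hf' := op_field (H u).
  rewrite H_gen (linB (op_linl _ _)) (linZ (op_linl _ _)) !op_gen /nprod /Bk.
  rewrite (linB H_lin) (linZ H_lin).
  rewrite (@H_Pk _ _ (fun _ _ => 0) (fun k => op k (H u)) (gen_wt i) 1) //; first last.
  - by move=> m w; rewrite hu rmorphD /= [op _ _ _ + _]addrC.
  - by move=> m w; rewrite H_gen addr0.
  rewrite (@H_Pk _ _ (fun k => op k (H u)) (fun _ _ => 0) 1 (gen_wt i)) //; first last.
  - by move=> m w; rewrite H_gen addr0.
  - by move=> m w; rewrite hu rmorphD /= [op _ _ _ + _]addrC.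
  rewrite [Pk (fun _ _ => 0) _ _ _ _ _]fs0 => [|j]; last by rewrite scaler0.
  rewrite [Pk _ (fun _ _ => 0) _ _ _ _]fs0 => [|j]; last first.
    by rewrite (lin0 (fld_lin hf _)) scaler0.
  by rewrite !rmorphD /=; lmod_coefs C V; ring.
Qed.

Definition nat_weight (l : nat) (w : C) : Prop := exists D : nat, w = (l + D)%:R.

Lemma X_eig l p x v : eig H (nat_weight l) v -> eig H (nat_weight (l + p.+1)) (X p x v).
Proof.
apply: eig_map => [|_ u [D ->] hu]; first exact: X_linr.
exists ((l + p.+1 + D)%:R); first by exists D.
rewrite H_X hu (linZ (X_linr _ _)) -scalerDl -natrD; congr (_%:R *: _).
by rewrite addnAC.
Qed.

Lemma T_eig l v : eig H (nat_weight l) v -> eig H (nat_weight l.+1) (T v).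
Proof.
apply: eig_map => [|_ u [D ->] hu]; first exact: T_lin.
exists ((l.+1 + D)%:R); first by exists D.
by rewrite H_T hu (linZ (T_lin (V := V))) -[X in _ + X]scale1r -scalerDl natr1.
Qed.

Lemma weight_mono l l' v : (l' <= l)%N ->
  eig H (nat_weight l) v -> eig H (nat_weight l') v.
Proof.
move=> le; apply: eig_sub => _ [D ->]; exists (l - l' + D)%N.
by rewrite addnA subnKC.
Qed.

Lemma base_eig a : eig H (nat_weight 0) (base a).
Proof. by apply: (@eig1 _ _ _ _ 0); [rewrite H_base scale0r | exists 0%N]. Qed.

Lemma env_eig v : eig H (nat_weight 0) v.
Proof.
elim/(ev_ind (e := V)): v => [c u v hu hv|a|p x v hv|v hv].
- by apply: eigD => //; apply: (eigZ H_lin).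
- exact: base_eig.
- by apply: (@weight_mono (0 + p.+1)) => //; exact: X_eig.
- by apply: (@weight_mono 1) => //; exact: T_eig.
Qed.

HB.instance Definition _ := GRing.isLinear.Build C V V *:%R energy H_lin.

Lemma env_diag : diagonalizable (energy : {linear VA -> VA}).
Proof.
move=> v; have [n hn] := env_eig v.
elim: hn => [|{}n w x r hx _ _ [s [hs ->]]]; first by exists [::]; rewrite big_nil.
exists (x :: s); rewrite big_cons; split=> // y.
rewrite inE => /predU1P[->|/hs //]; exists w; exact/eqP.
Qed.

Lemma env_op_weight n (D D' : C) (u v : VA) :
  u \in in_eigenspace energy D -> v \in in_eigenspace energy D' ->
  va_op n u v \in in_eigenspace energy (D + D' - n%:~R - 1).
Proof.
move=> /eqP hu /eqP hv; apply/eqP; rewrite H_op hu hv.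
rewrite (linZ (op_linl _ _)) (linZ (fld_lin (op_field _) _)) rmorphD /=.
by lmod_coefs C V; ring.
Qed.

Definition env_gva : gradedVA R := GradedVA env_diag env_op_weight.

Lemma env_restricted (z : int) : z < 0 -> ~ conformal_weight env_gva z%:~R.
Proof.
move=> z0 [v /eqP hv /eqP]; apply; apply: (eig_indep H_lin _ hv (env_eig v)).
move=> [D]; rewrite -[_%:R]/(D%:Z%:~R) => /intr_inj e; lia.
Qed.

Definition env_rva : restrictedVA R := RestrictedVA env_restricted.

End Grading.

(** * The part of weight at most one *)

Section TruncatedEnvelope.
Variables (R : realType) (W : oneTruncVA R) (V : envelope W).
Local Notation C := R[i].
Local Notation A := (ot_space W false).
Local Notation B := (ot_space W true).
Local Notation vac := (ot_vac W).
Local Notation d := (ot_d W).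
Local Notation base := (@ev_base R W V).
Local Notation X := (@ev_X R W V).
Local Notation T := (@ev_T R W V).
Local Notation mx := (@mx R W V).
Local Notation ma := (@ma R W V).
Local Notation one := (base vac).
Local Notation H := (@energy R W V).
Local Notation U := (env_rva V).
Implicit Types (a b : A) (x y z : B) (n m k : int) (p q : nat) (v : V).

(** The part of weight at most one of a word, with its value in [W]; a word of
    weight two or more is sent to [0]. *)
Definition low : lmodType C := (A * B)%type.
Definition low_base a : low := (a, 0).
Definition low_X p x (u : low) : low := (0, if p is 0%N then rmul x u.1 else 0).
Definition low_T (u : low) : low := (0, d u.1).

Lemma low_walg : is_walg (fun=> True) low_base low_X low_T.
Proof.
split=> //.
- by move=> c a b; congr pair; rewrite /= scaler0 addr0.
- move=> p u _ c x y; congr pair; rewrite /= ?scaler0 ?addr0 //.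
  by case: p => [|p]; rewrite ?rmul_linear_l // scaler0 addr0.
- move=> p x c u v; congr pair; rewrite /= ?scaler0 ?addr0 //.
  by case: p => [|p]; rewrite ?rmul_linear_r // scaler0 addr0.
- move=> c u v; congr pair; rewrite /= ?scaler0 ?addr0 //.
  exact: linearP.
- move=> p q x y u _; congr pair; rewrite /= ?addr0 // rmulx0.
  by case: p => [|p]; case: q => [|q]; rewrite /= ?rmulx0 ?addr0.
- move=> p x u _; congr pair; rewrite /= ?scaler0 ?addr0 // linear0.
  by case: p => [|p] //; rewrite rmulx0.
- by move=> x a; congr pair; rewrite /= rmul1.
- by move=> a; congr pair; rewrite /= rmul1.
Qed.

Definition low_part : V -> low := sval (ev_rec V low_walg).

Lemma low_part_spec : [/\ linear low_part,
  forall a, low_part (base a) = low_base a,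
  forall p x v, low_part (X p x v) = low_X p x (low_part v)
  & forall v, low_part (T v) = low_T (low_part v)].
Proof. by have [h1 _ h2 h3 h4] := svalP (ev_rec V low_walg). Qed.

Lemma low_part_base a : low_part (base a) = (a, 0).
Proof. by case: low_part_spec => _ ->. Qed.
Lemma low_part_one x : low_part (X 0 x one) = (0, x).
Proof. by case: low_part_spec => _ hb -> _; rewrite hb /low_X /= rmul1. Qed.

Lemma X_one_weight x : H (X 0 x one) = X 0 x one.
Proof. by rewrite H_X H_base (lin0 (X_linr _ _)) add0r scale1r. Qed.

Lemma X_one_eig x : eig H (nat_weight 1) (X 0 x one).
Proof. exact: (X_eig 0 x (base_eig V vac)). Qed.

(** Among the words of weight at most one only [a] and [x_(-1) 1] remain, because
    the relations give [x_(-1) a] and [T a] this form. *)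
Lemma low_decomposition v : exists r, eig H (nat_weight 2) r /\
  v = base (low_part v).1 + X 0 (low_part v).2 one + r.
Proof.
have [ll lb lX lT] := low_part_spec.
elim/(ev_ind (e := V)): v
  => [c u v [r [hr eu]] [s [hs ev]]|a|p x v [r [hr ev]]|v [r [hr ev]]].
- exists (c *: r + s); split; first by apply: eigD => //; apply: (eigZ (@H_lin _ _ V)).
  rewrite ll -[(c *: low_part u + low_part v).1]/(c *: (low_part u).1 + (low_part v).1).
  rewrite -[(c *: low_part u + low_part v).2]/(c *: (low_part u).2 + (low_part v).2).
  rewrite base_lin X_linl {1}eu {1}ev.
  by lmod_coefs C V; ring.
- exists 0; split; first exact: (eig0 H).
  by rewrite lb /= (lin0 (X_linl _ _)) !addr0.
- rewrite lX /= (lin0 (base_lin V)) add0r {1}ev !(linD (X_linr _ _)).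
  case: p => [|p].
    exists (X 0 x (X 0 (low_part v).2 one) + X 0 x r); split.
      apply: eigD; first exact: (X_eig 0 x (X_one_eig _)).
      by apply: (@weight_mono _ _ _ 3) => //; exact: (X_eig 0 x hr).
    by rewrite X_base addrA.
  exists (X p.+1 x (base (low_part v).1) + X p.+1 x (X 0 (low_part v).2 one)
          + X p.+1 x r); split; last by rewrite (lin0 (X_linl _ _)) add0r.
  do 2?apply: eigD.
  + by apply: (@weight_mono _ _ _ (0 + p.+2)) => //; exact: X_eig (base_eig V _).
  + by apply: (@weight_mono _ _ _ (1 + p.+2)) => //; exact: X_eig (X_one_eig _).
  + by apply: (@weight_mono _ _ _ (2 + p.+2)) => //; exact: X_eig.
- rewrite lT /= (lin0 (base_lin V)) add0r {1}ev !(linD (T_lin (V := V))).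
  exists (T (X 0 (low_part v).2 one) + T r); split.
    apply: eigD; first exact: T_eig (X_one_eig _).
    by apply: (@weight_mono _ _ _ 3) => //; exact: T_eig.
  by rewrite T_base addrA.
Qed.

Lemma weight0_base v : H v = 0 -> v = base (low_part v).1.
Proof.
move=> Hv; have [r [hr ev]] := low_decomposition v.
apply/eqP; rewrite -subr_eq0; apply/eqP.
apply: (@eig_indep _ _ H (@H_lin _ _ V) (nat_weight 1) 0).
- by case=> D /eqP; rewrite eq_sym pnatr_eq0.
- by rewrite (linB (@H_lin _ _ V)) Hv H_base subrr scale0r.
- have -> : v - base (low_part v).1 = X 0 (low_part v).2 one + r.
    by rewrite {1}ev; lmod_coefs C V; ring.
  by apply: eigD; [exact: X_one_eig | exact: (@weight_mono _ _ _ 2)].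
Qed.

Lemma weight1_X v : H v = v -> v = X 0 (low_part v).2 one.
Proof.
move=> Hv; have [r [hr ev]] := low_decomposition v.
apply/eqP; rewrite -subr_eq0; apply/eqP.
apply: (@eig_indep _ _ H (@H_lin _ _ V) (fun w => w != 1) 1); first by rewrite eqxx.
- by rewrite (linB (@H_lin _ _ V)) Hv X_one_weight scale1r.
- have -> : v - X 0 (low_part v).2 one = base (low_part v).1 + r.
    by rewrite {1}ev; lmod_coefs C V; ring.
  apply: eigD.
    apply: (@eig1 _ _ _ _ 0); first by rewrite H_base scale0r.
    by rewrite eq_sym oner_eq0.
  apply: eig_sub hr => _ [D ->].
  by rewrite -[1]/(1%:R) eqr_nat.
Qed.

Lemma base_in_weight a : (base a : U) \in @in_weight R U false%:R.
Proof. by apply/eqP; rewrite -[LHS]/(H (base a)) H_base scale0r. Qed.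

Lemma X_in_weight x : (X 0 x one : U) \in @in_weight R U true%:R.
Proof. by apply/eqP; rewrite -[LHS]/(H (X 0 x one)) X_one_weight scale1r. Qed.

Definition unit_fun (i : bool) : W i -> truncation U i :=
  if i return W i -> truncation U i then fun x => WeightSpace (X_in_weight x)
  else fun a => WeightSpace (base_in_weight a).

Definition counit_fun (i : bool) : truncation U i -> W i :=
  if i return truncation U i -> W i then fun w => (low_part (wval w)).2
  else fun w => (low_part (wval w)).1.

Lemma unit_linear i : linear (@unit_fun i).
Proof.
case: i => c u v; apply: val_inj => /=.
  by rewrite -[LHS]/(X 0 _ one) X_linl.
by rewrite -[LHS]/(base _) base_lin.
Qed.

Lemma unit_vac : unit_fun vac = ot_vac (truncation U).
Proof. exact: val_inj. Qed.

Lemma unit_d a : unit_fun (d a) = ot_d (truncation U) (unit_fun a).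
Proof. by apply: val_inj; rewrite /= -T_base. Qed.

Lemma ma_m2 b a : ma b (-2) (base a) = X 0 (d b) (base a).
Proof. by rewrite ma_base /= invr1 scale1r. Qed.

Lemma unit_op i j l (u : W i) (v : W j) :
  unit_fun (ot_op l u v) = ot_op l (unit_fun u) (unit_fun v).
Proof.
apply: val_inj; case: i u => u; case: j v => v; case: l => /=.
- rewrite -[RHS]/(va_op (v := env_va V) 0 (X 0 u one) (X 0 v one)) op_x mx_X mx_base0.
  rewrite act1 (lin0 (base_lin V)) (lin0 (X_linr _ _)) add0r scale0r addr0.
  by rewrite -mx_neg add0r.
- rewrite -[RHS]/(va_op (v := env_va V) 1 (X 0 u one) (X 0 v one)) op_x mx_X.
  rewrite mx_base_pos (lin0 (X_linr _ _)) add0r scale1r.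
  rewrite -[1 + Negz 0]/(0 : int) mx_base0 act1 (lin0 (base_lin V)) add0r.
  by rewrite -[0 - 1]/(-1 : int) ma_baseN1 mula1.
- rewrite -[RHS]/(va_op (v := env_va V) (-1) (X 0 u one) (base v)) op_x.
  by rewrite -[-1]/(Negz 0) mx_neg (X_base V u v).
- by rewrite -[RHS]/(va_op (v := env_va V) 0 (X 0 u one) (base v)) op_x mx_base0.
- rewrite -[RHS]/(va_op (v := env_va V) (-1) (base u) (X 0 v one)) op_base ma_X.
  rewrite ma_baseN1 mula1 -[-1 + Negz 0]/(-2 : int) ma_m2.
  rewrite (X_base V v u).
  by rewrite -(linB (X_linl _ _)) lmul_rmul.
- rewrite -[RHS]/(va_op (v := env_va V) 0 (base u) (X 0 v one)) op_base ma_X.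
  rewrite ma_base_nneg (lin0 (X_linr _ _)) add0r -[0 + Negz 0]/(-1 : int).
  by rewrite ma_baseN1 mula1 -(linN (base_lin V)) -act_lact.
- rewrite -[RHS]/(va_op (v := env_va V) (-2) (base u) (base v)) op_base ma_m2.
  by rewrite (X_base V (d u) v) -op_aa2.
- rewrite -[RHS]/(va_op (v := env_va V) (-1) (base u) (base v)) op_base.
  by rewrite ma_baseN1.
Qed.

Definition env_unit : otHom W (truncation U) :=
  OTHom unit_linear unit_vac unit_d unit_op.

Lemma unit_funK i : cancel (@unit_fun i) (@counit_fun i).
Proof.
by case: i => u; rewrite /counit_fun /= ?low_part_one ?low_part_base.
Qed.

Lemma counit_funK i : cancel (@counit_fun i) (@unit_fun i).
Proof.
case: i => -[v hv]; apply: val_inj => /=.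
  apply/esym/weight1_X.
  by have /eqP := hv; rewrite -[LHS]/(H v) scale1r.
by apply/esym/weight0_base; have /eqP := hv; rewrite -[LHS]/(H v) scale0r.
Qed.

End TruncatedEnvelope.

Lemma ot_iso (R : realType) (W W' : OneTruncVACat R) (f : otHom W W')
    (g : forall i, W' i -> W i) :
  (forall i, cancel (@ot_fun _ _ _ f i) (g i)) ->
  (forall i, cancel (g i) (@ot_fun _ _ _ f i)) -> is_iso (A := OneTruncVACat R) f.
Proof.
move=> fK gK.
have g_lin i : linear (g i).
  by move=> c u v; apply: (can_inj (fK i)); rewrite ot_fun_linear !gK.
have g_vac : g false (ot_vac W') = ot_vac W.
  by apply: (can_inj (fK false)); rewrite gK ot_fun_vac.
have g_d a : g true (ot_d W' a) = ot_d W (g false a).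
  by apply: (can_inj (fK true)); rewrite ot_fun_d !gK.
have g_op i j l (a : W' i) (b : W' j) :
    g l (ot_op l a b) = ot_op l (g i a) (g j b).
  by apply: (can_inj (fK l)); rewrite ot_fun_op !gK.
exists (OTHom g_lin g_vac g_d g_op); split; apply: otHom_eq => i u /=.
  exact: fK.
exact: gK.
Qed.

Lemma unit_iso (R : realType) (W : OneTruncVACat R) (V : envelope W) :
  is_iso (A := OneTruncVACat R) (a := W) (b := truncation (env_rva V)) (env_unit V).
Proof.
exact: (@ot_iso R W (truncation (env_rva V)) (env_unit V) (@counit_fun R W V)
  (@unit_funK R W V) (@counit_funK R W V)).
Qed.

(** * The universal property *)

Section VertexAlgebraFacts.
Variables (R : realType) (V : vertexAlgebra R).
Local Notation C := R[i].
Implicit Types (a b c u v : V) (m n k : int).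

Lemma va_field a : is_field (fun n => va_op n a : V -> V).
Proof.
split=> [n|v]; first exact: va_opr_linear.
have [N hN] := va_local a v; exists (absz N) => n hn; apply: hN; lia.
Qed.

(** The Borcherds identity for [m = 0]. *)
Lemma va_assoc n k a b c : va_op k (va_op n a b) c =
  nprod n (fun n => va_op n a) (fun n => va_op n b) k c.
Proof.
have := va_borcherds 0 n k a b c; rewrite /borcherds !fsE.
rewrite fs1 => [|j]; last by rewrite binz0S scale0r.
rewrite binz0 scale1r add0r subr0 [n + 0%:Z]addr0 => ->; rewrite /nprod /Bk /Pk.
have ha := va_field a; have hb := va_field b.
congr (_ - _); first by apply: eq_fs => j; rewrite addr0.
rewrite -fsZ; last ev_field.
apply: eq_fs => j; rewrite scalerA; congr (_ *: _).
by rewrite expfzDr ?oppr_eq0 ?oner_eq0 // [RHS]mulrCA mulrA.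
Qed.

(** The Borcherds identity for [n = 0], where only two products are nonzero. *)
Lemma va_comm1 m k a b c : (forall j : nat, va_op j.+2 a b = 0) ->
  va_op m a (va_op k b c) = va_op k b (va_op m a c)
    + va_op (m + k) (va_op 0 a b) c + m%:~R *: va_op (m + k - 1) (va_op 1 a b) c.
Proof.
move=> ab0; have := va_borcherds m 0 k a b c; rewrite /borcherds !fsE.
rewrite (fs_ord (N := 2)) => [|[|[|j]] // _]; last first.
  by rewrite add0r ab0 va_op0l scaler0.
rewrite big_ord_recl big_ord1 /= fs1 => [|j]; last by rewrite binz0S mulr0 scale0r.
rewrite fs1 => [|j]; last by rewrite binz0S mulr0 scale0r.
rewrite -[bump 0 0]/1%N !binz0 binz1 !mulr1 expr0 !scale1r !subr0 !add0r ?addr0.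
by move=> e; rewrite -[LHS](subrK (va_op k b (va_op m a c))) -e addrC addrA.
Qed.

Lemma binzN2 j : binz R (-2) j = (-1) ^+ j * j.+1%:R.
Proof.
elim: j => [|j IH]; first by rewrite binz0 expr0 mulr1.
have n0 : j.+1%:R != 0 :> C by rewrite pnatr_eq0.
apply: (mulfI n0); rewrite binzS_mul IH exprS.
rewrite (_ : (-2 - j%:Z)%:~R = - j.+2%:R :> C); first by ring.
by ring.
Qed.

(** The Borcherds identity for [u_(-2) 1]: the vacuum has a single nonzero mode,
    which leaves one term, on the side that depends on the sign of [n]. *)
Lemma va_d_op_left n u v : va_op n (va_d V u) v = - n%:~R *: va_op (n - 1) u v.
Proof.
have hu := va_field u; have h1 := va_field (va_vac V).
rewrite va_dE va_assoc /nprod /Bk -[(-1) ^ (-2)]/(((-1) ^+ 2)^-1).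
rewrite sqrrN expr1n invr1 scale1r.
have single j0 (F : nat -> V) : (forall j, j != j0 -> F j = 0) -> fs F = F j0.
  move=> F0; rewrite (fs_ord (N := j0.+1)) => [|j jj]; last first.
    by apply: F0; rewrite gtn_eqF.
  rewrite big_ord_recr /= big1 ?add0r // => i _.
  by apply: F0; rewrite ltn_eqF.
case: n => [[|n]|p].
- rewrite /Pk !fs0 ?subrr ?oppr0 ?scale0r // => j.
    by rewrite va_vacl; case: eqP => [e|_]; [lia | rewrite scaler0].
  by rewrite va_vacl; case: eqP => [e|_]; [lia | rewrite va_op0r scaler0].
- rewrite {1}/Pk fs0 => [|j]; last first.
    by rewrite va_vacl; case: eqP => [e|_]; [lia | rewrite va_op0r scaler0].
  rewrite sub0r /Pk (single n) => [|j jn]; last first.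
    rewrite va_vacl; case: eqP => [e|_]; last by rewrite scaler0.
    by case/eqP: jn; lia.
  rewrite va_vacl (_ : _ == -1); last by apply/eqP; lia.
  rewrite binzN2 mulrA -expr2 -exprM mulnC exprM sqrrN !expr1n mul1r add0r.
  by rewrite (_ : n.+1%:Z - 1 = n%:Z) ?scaleNr //; lia.
- rewrite [X in _ - X]/Pk fs0 => [|j]; last first.
    by rewrite va_vacl; case: eqP => [e|_]; [lia | rewrite scaler0].
  rewrite subr0 /Pk (single p) => [|j jn]; last first.
    rewrite va_vacl; case: eqP => [e|_]; last by rewrite va_op0r scaler0.
    by case/eqP: jn; lia.
  rewrite va_vacl (_ : _ == -1); last by apply/eqP; lia.
  rewrite binzN2 mulrA -expr2 -exprM mulnC exprM sqrrN !expr1n mul1r addr0.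
  by rewrite (_ : -2 - p%:Z = Negz p - 1) ?NegzR ?opprK //; lia.
Qed.

End VertexAlgebraFacts.

Lemma Pk_hom (R : realType) (V V' : lmodType R[i]) (F : V -> V')
    (a b : int -> V -> V) (a' b' : int -> V' -> V') n m k v :
  linear F -> is_field a -> is_field b ->
  (forall n v, F (a n v) = a' n (F v)) -> (forall n v, F (b n v) = b' n (F v)) ->
  F (Pk a b n m k v) = Pk a' b' n m k (F v).
Proof.
move=> Fl ha hb Fa Fb; rewrite /Pk (fs_lin Fl); last ev_field.
by apply: eq_fs => j; rewrite (linZ Fl) Fa Fb.
Qed.

Section Extension.
Variables (R : realType) (W : oneTruncVA R) (V : envelope W).
Variables (V' : restrictedVA R) (f : otHom W (truncation V')).
Local Notation C := R[i].
Local Notation A := (ot_space W false).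
Local Notation B := (ot_space W true).
Local Notation vac := (ot_vac W).
Local Notation d := (ot_d W).
Local Notation base := (@ev_base R W V).
Local Notation X := (@ev_X R W V).
Local Notation T := (@ev_T R W V).
Local Notation mx := (@mx R W V).
Local Notation ma := (@ma R W V).
Local Notation one := (base vac).
Local Notation H := (@energy R W V).
Implicit Types (a b : A) (x y z : B) (n m k : int) (p q : nat).

Definition fa a : V' := wval (@ot_fun _ _ _ f false a).
Definition fx x : V' := wval (@ot_fun _ _ _ f true x).

Lemma fa_linear : linear fa.
Proof. by move=> c a b; rewrite /fa ot_fun_linear. Qed.
Lemma fx_linear : linear fx.
Proof. by move=> c x y; rewrite /fx ot_fun_linear. Qed.
Lemma fa_vac : fa vac = va_vac V'.
Proof. by rewrite /fa ot_fun_vac. Qed.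
Lemma fx_d a : fx (d a) = va_d V' (fa a).
Proof. by rewrite /fx ot_fun_d. Qed.
Lemma f_mul a b : va_op (-1) (fa a) (fa b) = fa (mul a b).
Proof. by rewrite /fa /mul ot_fun_op. Qed.
Lemma f_act x a : va_op 0 (fx x) (fa a) = fa (act x a).
Proof. by rewrite /fa /act ot_fun_op. Qed.
Lemma f_rmul x a : va_op (-1) (fx x) (fa a) = fx (rmul x a).
Proof. by rewrite /fx /rmul ot_fun_op. Qed.
Lemma f_pr x y : va_op 1 (fx x) (fx y) = fa (pr x y).
Proof. by rewrite /fa /pr ot_fun_op. Qed.
Lemma f_br x y : va_op 0 (fx x) (fx y) = fx (br x y).
Proof. by rewrite /fx /br ot_fun_op. Qed.

Lemma fa_weight a : fa a \in @in_weight R V' 0.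
Proof. exact: wvalP. Qed.
Lemma fx_weight x : fx x \in @in_weight R V' 1.
Proof. exact: wvalP. Qed.

Lemma op_neg_weight (i j n : int) (u v : V') : u \in @in_weight R V' i%:~R ->
  v \in @in_weight R V' j%:~R -> i + j - n - 1 < 0 -> va_op n u v = 0.
Proof.
move=> hu hv lt0; apply: (weight_neg0 lt0).
have := gva_op n hu hv; congr (_ \in _).
by rewrite !rmorphB rmorphD.
Qed.

Lemma f_xx2 x y (j : nat) : va_op j.+2 (fx x) (fx y) = 0.
Proof.
by apply: (@op_neg_weight 1 1); [exact: fx_weight | exact: fx_weight | lia].
Qed.
Lemma f_xa1 x a (j : nat) : va_op j.+1 (fx x) (fa a) = 0.
Proof.
by apply: (@op_neg_weight 1 0); [exact: fx_weight | exact: fa_weight | lia].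
Qed.
Lemma f_comm_xx x y m k (v : V') : va_op m (fx x) (va_op k (fx y) v) =
  va_op k (fx y) (va_op m (fx x) v) + va_op (m + k) (fx (br x y)) v
  + m%:~R *: va_op (m + k - 1) (fa (pr x y)) v.
Proof. by rewrite va_comm1 ?f_br ?f_pr // => j; exact: f_xx2. Qed.

Lemma f_comm_ax a x m k (v : V') : va_op m (fa a) (va_op k (fx x) v) =
  va_op k (fx x) (va_op m (fa a) v) - va_op (m + k) (fa (act x a)) v.
Proof.
rewrite [in RHS]va_comm1; last by move=> j; exact: f_xa1.
by rewrite f_act f_xa1 va_op0l scaler0 addr0 [k + m]addrC addrK.
Qed.

Lemma f_d_modes a n (v : V') : va_op n (fx (d a)) v = - n%:~R *: va_op (n - 1) (fa a) v.
Proof. by rewrite fx_d va_d_op_left. Qed.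

Definition ext_X p x (v : V') : V' := va_op (Negz p) (fx x) v.

Lemma ext_walg : is_walg (fun=> True) fa ext_X (va_d V').
Proof.
split=> //.
- exact: fa_linear.
- move=> p v _ c x y; rewrite /ext_X fx_linear; exact: va_opl_linear.
- by move=> p x; exact: va_opr_linear.
- by move=> c u v; exact: linearP.
- move=> p q x y v _; rewrite /ext_X f_comm_xx -addrA; congr (_ + _).
  rewrite NegzD /brk (linB fx_linear) (linZ fx_linear).
  rewrite (linB (va_opl_linear _ _)) (linZ (va_opl_linear _ _)) f_d_modes !NegzR.
  by lmod_coefs C V'; rewrite /kap; field; exact: kap_neq0.
- move=> p x v _; rewrite /ext_X va_d_op NegzB1 NegzR.
  by rewrite scaleNr opprK.
- move=> x a; rewrite /ext_X -[Negz 0]/(-1 : int) f_rmul fa_vac va_vacr //.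
- move=> a; rewrite /ext_X -[Negz 0]/(-1 : int) fa_vac va_vacr fx_d //.
Qed.

Definition ext_fun : V -> V' := sval (ev_rec V ext_walg).
Local Notation F := ext_fun.

Lemma ext_spec : [/\ linear F, forall a, F (base a) = fa a,
  forall p x v, F (X p x v) = va_op (Negz p) (fx x) (F v)
  & forall v, F (T v) = va_d V' (F v)].
Proof. by have [h1 _ h2 h3 h4] := svalP (ev_rec V ext_walg). Qed.

Lemma F_lin : linear F. Proof. by case: ext_spec. Qed.
Lemma F_base a : F (base a) = fa a. Proof. by case: ext_spec. Qed.
Lemma F_X p x v : F (X p x v) = va_op (Negz p) (fx x) (F v).
Proof. by case: ext_spec. Qed.
Lemma F_T v : F (T v) = va_d V' (F v). Proof. by case: ext_spec. Qed.

Definition F_modes v := (forall x n, F (mx x n v) = va_op n (fx x) (F v))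
  /\ (forall a n, F (ma a n v) = va_op n (fa a) (F v)).

Lemma F_ma_d v a n : n != -1 -> (forall x n, F (mx x n v) = va_op n (fx x) (F v)) ->
  F (ma a n v) = va_op n (fa a) (F v).
Proof.
move=> ne hv; rewrite (ma_d _ _ ne) (linZ F_lin) hv f_d_modes addrK scalerA.
rewrite mulrNN mulVf ?scale1r // intr_eq0; apply/eqP; move/eqP: ne; lia.
Qed.

Lemma F_modesP v : F_modes v.
Proof.
elim/(ev_ind (e := V)): v => [c u v [u1 u2] [v1 v2]|a|p x v [v1 v2]|v [v1 v2]].
- split=> [x n|a n].
    by rewrite mx_linr !F_lin u1 v1 (va_opr_linear n (fx x)).
  by rewrite ma_linr !F_lin u2 v2 (va_opr_linear n (fa a)).
- have hx x n : F (mx x n (base a)) = va_op n (fx x) (F (base a)).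
    case: n => [[|n]|p]; last by rewrite mx_neg F_X.
      by rewrite mx_base0 !F_base f_act.
    by rewrite mx_base_pos (lin0 F_lin) F_base f_xa1.
  split=> [//|b n]; have [->|ne] := eqVneq n (-1); last exact: F_ma_d.
  by rewrite ma_baseN1 !F_base f_mul.
- split=> [y n|a n].
    by rewrite mx_X 2!(linD F_lin) (linZ F_lin) !F_X !v1 v2 [RHS]f_comm_xx.
  by rewrite ma_X (linB F_lin) !F_X !v2 f_comm_ax.
- split=> [y n|a n].
    by rewrite mx_T (linD F_lin) (linZ F_lin) !F_T !v1 va_d_op subrK.
  by rewrite ma_T (linD F_lin) (linZ F_lin) !F_T !v2 va_d_op subrK.
Qed.

Lemma F_mx x n v : F (mx x n v) = va_op n (fx x) (F v).
Proof. by case: (F_modesP v). Qed.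
Lemma F_ma a n v : F (ma a n v) = va_op n (fa a) (F v).
Proof. by case: (F_modesP v). Qed.

Definition fgen (i : A + B) : V' := match i with inl a => fa a | inr x => fx x end.

Lemma F_gen (i : A + B) n v : F (gen (V := V) i n v) = va_op n (fgen i) (F v).
Proof. by case: i => [a|x]; [exact: F_ma | exact: F_mx]. Qed.

(** Both sides expand in the same way when [u] is a mode applied to a state, so an
    induction on [u] reduces the claim to the modes. *)
Lemma F_op n (u v : env_va V) : F (va_op n u v) = va_op n (F u) (F v).
Proof.
elim/(gen_span (V := V)): u n v => [c u u' hu hu' n v|n v|i k u hu n v].
- rewrite (op_linl n v) !F_lin hu hu'.
  by rewrite (va_opl_linear n (F v)).
- rewrite (va_vacl (v := env_va V)) F_base fa_vac va_vacl.
  by case: eqP => // _; exact: lin0 F_lin.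
- have hg : is_field (gen (V := V) i) by exact: good_field (gen_good V i).
  have hf := op_field u.
  rewrite op_gen F_gen va_assoc /nprod /Bk (linB F_lin) (linZ F_lin).
  rewrite (Pk_hom (a' := fun n => va_op n (fgen i)) (b' := fun n => va_op n (F u))
    _ _ _ _ F_lin hg hf (F_gen i)) //.
  by rewrite (Pk_hom (b' := fun n => va_op n (fgen i)) (a' := fun n => va_op n (F u))
    _ _ _ _ F_lin hf hg _ (F_gen i)).
Qed.

Lemma F_energy v : F (H v) = gva_H V' (F v).
Proof.
have hvac : gva_H V' (va_vac V') = 0.
  by have /eqP := va_vac_weight V'; rewrite scale0r.
elim/(ev_ind (e := V)): v => [c u v hu hv|a|p x v hv|v hv].
- by rewrite H_lin !F_lin linearP hu hv.
- rewrite H_base F_base (lin0 F_lin).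
  by have /eqP := fa_weight a; rewrite scale0r.
- rewrite H_X (linD F_lin) (linZ F_lin) !F_X hv gva_H_op.
  have /eqP -> := fx_weight x; rewrite scale1r rmorphD /= NegzR.
  by lmod_coefs C V'; ring.
- rewrite H_T (linD F_lin) !F_T hv !va_dE gva_H_op hvac va_op0r.
  by rewrite -[(-2 + 1)%:~R]/((-1 : int)%:~R) mulrN1z addr0 scaleN1r opprK.
Qed.

Lemma F_vac : F (va_vac (env_va V)) = va_vac V'.
Proof. by rewrite -fa_vac -F_base. Qed.

Lemma F_weight D u : u \in @in_weight R (env_gva V) D -> F u \in @in_weight R V' D.
Proof. by move=> /eqP hu; apply/eqP; rewrite -F_energy hu (linZ F_lin). Qed.

Definition ext_hom : vaHom (env_rva V) V' :=
  @VAHom R (env_rva V) V' F F_lin F_vac F_op F_weight.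

Lemma ext_unit : otHom_comp (truncation_map ext_hom) (env_unit V) = f.
Proof.
apply: otHom_eq => -[] u; apply: val_inj => /=.
  by rewrite F_X F_base fa_vac -[Negz 0]/(-1 : int) va_vacr.
exact: F_base.
Qed.

End Extension.

Lemma env_hom_eq (R : realType) (W : oneTruncVA R) (V : envelope W)
    (V' : restrictedVA R) (g h : vaHom (env_rva V) V') :
  otHom_comp (truncation_map g) (env_unit V)
    = otHom_comp (truncation_map h) (env_unit V) -> g = h.
Proof.
move=> gh; apply: vaHom_eq => v.
have ghi i u : wval (ot_fun (otHom_comp (truncation_map g) (env_unit V)) (i := i) u)
    = wval (ot_fun (otHom_comp (truncation_map h) (env_unit V)) (i := i) u).
  by rewrite gh.
elim/(gen_span (V := V)): v => [c u v hu hv||i n v hv].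
- by rewrite (va_fun_linear g) (va_fun_linear h) hu hv.
- exact: (ghi false).
- case: i => [a|x] /=.
    rewrite -op_base (va_fun_op g) (va_fun_op h) hv; congr va_op.
    exact: (ghi false a).
  rewrite -op_x (va_fun_op g) (va_fun_op h) hv; congr va_op.
  exact: (ghi true x).
Qed.

(** * The adjunction *)

Section Adjunction.
Variable R : realType.

Definition U1_obj (W : OneTruncVACat R) : RestrictedVACat R :=
  env_rva (the_envelope W).

Definition U1_unit (W : OneTruncVACat R) : otHom W (truncation (U1_obj W)) :=
  env_unit (the_envelope W).

Definition U1_transpose (W : OneTruncVACat R) (V : RestrictedVACat R)
    (h : vaHom (U1_obj W) V) : otHom W (truncation V) :=
  otHom_comp (truncation_map h) (U1_unit W).

Definition U1_map (W W' : OneTruncVACat R) (f : otHom W W') :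
    vaHom (U1_obj W) (U1_obj W') :=
  ext_hom (the_envelope W) (otHom_comp (U1_unit W') f).

Lemma U1_transpose_map W W' (f : otHom W W') :
  U1_transpose (U1_map f) = otHom_comp (U1_unit W') f.
Proof. exact: ext_unit. Qed.

Lemma U1_transpose_comp (W : OneTruncVACat R) (V V' : RestrictedVACat R)
    (g : vaHom V V') (h : vaHom (U1_obj W) V) :
  U1_transpose (vaHom_comp g h) = otHom_comp (truncation_map g) (U1_transpose h).
Proof. by apply: otHom_eq => i u; apply: val_inj. Qed.

Lemma U1_transpose_inj (W : OneTruncVACat R) (V : RestrictedVACat R) :
  injective (@U1_transpose W V).
Proof. by move=> g h; exact: env_hom_eq. Qed.

Lemma U1_id W : U1_map (otHom_id W) = vaHom_id (U1_obj W).
Proof.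
apply: U1_transpose_inj; rewrite U1_transpose_map.
by apply: otHom_eq => i u; apply: val_inj.
Qed.

Lemma U1_comp (W1 W2 W3 : OneTruncVACat R) (f : otHom W2 W3) (g : otHom W1 W2) :
  U1_map (otHom_comp f g) = vaHom_comp (U1_map f) (U1_map g).
Proof.
apply: U1_transpose_inj; rewrite U1_transpose_map U1_transpose_comp U1_transpose_map.
rewrite otHom_compA -U1_transpose_map.
by apply: otHom_eq => i u; apply: val_inj.
Qed.

Definition U1 : functor (OneTruncVACat R) (RestrictedVACat R) :=
  @Functor (OneTruncVACat R) (RestrictedVACat R) U1_obj
    (fun W W' f => U1_map f) U1_id U1_comp.

Lemma U1_transpose_bij (W : OneTruncVACat R) (V : RestrictedVACat R) :
  bijective (@U1_transpose W V).
Proof.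
exists (fun f => ext_hom (the_envelope W) f) => [h|f]; last exact: ext_unit.
by apply: U1_transpose_inj; exact: ext_unit.
Qed.

Lemma U1_transpose_natural (W W' : OneTruncVACat R) (V V' : RestrictedVACat R)
    (f : hom W' W) (g : hom V V') (h : hom (U1 W) V) :
  (U1_transpose (comp g (comp h (fmap U1 f))) : hom W' (TruncationFunctor R V'))
  = comp (fmap (TruncationFunctor R) g)
      (comp (U1_transpose h : hom W (TruncationFunctor R V)) f).
Proof.
rewrite /= U1_transpose_comp (U1_transpose_comp h (U1_map f)) U1_transpose_map.
by apply: otHom_eq => i u; apply: val_inj.
Qed.

Definition U1_adjunction : adjunction U1 (TruncationFunctor R) :=
  @Adjunction _ _ U1 (TruncationFunctor R) U1_transpose U1_transpose_bij
    U1_transpose_natural.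

Lemma U1_adjunction_unit W : unit_of U1_adjunction W = U1_unit W.
Proof. by apply: otHom_eq => i u; apply: val_inj. Qed.

End Adjunction.

Theorem mainTheorem5 (R : realType) :
  exists (U1 : functor (OneTruncVACat R) (RestrictedVACat R))
         (adj : adjunction U1 (TruncationFunctor R)),
    forall W : OneTruncVACat R, is_iso (unit_of adj W).
Proof.
exists (U1 R), (U1_adjunction R) => W; rewrite U1_adjunction_unit.
exact: unit_iso.
Qed.
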